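(* Let $k\ge 2$ be a fixed integer and let $X_n=(X_{n,1},\ldots,X_{n,k-1})^T$ be the vector of the numbers $X_{n,j}$ of spacings of length $j$, $j=1,\ldots,k-1$, in the random placement process of units of length $k$ on a discrete string of $n$ positions (as described in the context). Let $\theta=(\theta_1,\ldots,\theta_{k-1})^T$ and $\Sigma=(\sigma_{ij})_{i,j=1}^{k-1}$ with $\theta_j$ and $\sigma_{ij}$ given by the explicit formulas in the context. Then $$Z_n=n^{-1/2}\bigl(X_n-EX_n\bigr)\ \longrightarrow\ \mathcal N(0,\Sigma)\quad\text{in distribution, as } n\to\infty,$$ and $$n^{-1/2}\bigl(EX_n-n\theta\bigr)\longrightarrow 0,\quad\text{as } n\to\infty .$$
   Context: Fix an integer $k\ge 2$. Placement process: on a row of $n$ positions, units of length $k$ are placed successively. At each step, a set of $k$ adjacent positions is chosen uniformly at random among all sets of $k$ adjacent positions that are all still free, and these positions become occupied. The process stops when no set of $k$ adjacent free positions remains, i.e. when all maximal runs of adjacent free positions have length less than $k$. For $1\le j\le k-1$, $X_{n,j}$ is the number of maximal runs of adjacent free positions of length exactly $j$ (spacings of length $j$) in the final configuration. (For $n<k$ nothing is placed, so $X_{n,j}=1$ if $j=n$ and $0$ otherwise; $X_0=0$.) Notation: $$e_k(y)=\exp\Bigl\{2\bigl[y+y^2/2+\cdots+y^{k-1}/(k-1)\bigr]\Bigr\},$$ $$\theta_j=\frac{2}{e_k(1)}\int_0^1(1-y)\,y^j e_k(y)\,dy,\qquad j=1,\ldots,k-1,$$ $$G_i(z)=2(1-z)^{-2}\bigl(e_k(z)\bigr)^{-1}\int_0^z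 y^i(1-y)e_k(y)\,dy,\qquad i=1,\ldots,k-1,$$ and for $i,j=1,\ldots,k-1$, $$\begin{aligned}H_{ij}(z)={}&(1-z)z^i\mathbf 1_{[i=j]}+(1-z)^2\bigl(z^i+z^{k-1}G_i(z)\bigr)\bigl(z^j+z^{k-1}G_j(z)\bigr)\\&-\theta_i\theta_j(1-z)^{-2}\Bigl(3+(4k-5)(1-z)+2(k-1)^2(1-z)^2-2k^2(1-z)^4\\&\qquad-\bigl(2+(4k-3)(1-z)+(2k-1)^2(1-z)^2-4k^2(1-z)^3\bigr)z^k\Bigr),\end{aligned}$$ $$\sigma_{ij}=\frac{2}{e_k(1)}\int_0^1 H_{ij}(y)\,e_k(y)\,dy,$$ where $H_{ij}$ is evaluated for $0\le y<1$ (its singularity at $y=1$ is removable). $\mathcal N(0,\Sigma)$ denotes the centered (possibly degenerate) multivariate normal distribution on $\mathbb R^{k-1}$ with covariance matrix $\Sigma$. *)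

(* Defs.v *)
From HB Require Import structures.
From mathcomp Require Import all_boot all_order all_algebra.
From mathcomp Require Import all_classical all_reals all_analysis.

Set Implicit Arguments.
Unset Strict Implicit.
Unset Printing Implicit Defensive.

Import Order.TTheory GRing.Theory Num.Theory.
Import numFieldNormedType.Exports.

Local Open Scope ring_scope.

(* A configuration of the row of n positions is its set of occupied positions;
   k adjacent positions are encoded by the first of them. *)
Definition block (n k : nat) (a : 'I_n) : {set 'I_n} :=
  [set p : 'I_n | a <= p < a + k]%N.

Definition free_blocks (n k : nat) (c : {set 'I_n}) : {set 'I_n} :=
  [set a : 'I_n | (a + k <= n)%N && [disjoint block k a & c]].

(* One step of the process, as a transition probability from c to c'; the
   configurations without a free block, where the process stops, are
   absorbing. *)
Definition step_prob (R : realType) (n k : nat) (c c' : {set 'I_n}) : R :=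
  if free_blocks k c == finset.set0 then (c' == c)%:R
  else #|[set a in free_blocks k c | c :|: block k a == c']|%:R
       / #|free_blocks k c|%:R.

Fixpoint placement_prob (R : realType) (n k t : nat) (c : {set 'I_n}) : R :=
  if t is t'.+1 then
    \sum_(b : {set 'I_n}) placement_prob R k t' b * step_prob R k b c
  else (c == finset.set0)%:R.

(* Law of the final configuration: for k > 0 every step before absorption
   occupies new positions, so the process has stopped after n steps. *)
Definition final_prob (R : realType) (n k : nat) (c : {set 'I_n}) : R :=
  placement_prob R k n c.

Definition final_expect (R : realType) (n k : nat) (V : lmodType R)
    (f : {set 'I_n} -> V) : V :=
  \sum_(c : {set 'I_n}) final_prob R k c *: f c.

(* Number of maximal runs of free positions of length exactly j (for j > 0),
   counted by their first position a. *)
Definition nspacings (n j : nat) (c : {set 'I_n}) : nat :=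
  #|[set a : 'I_n |
      [&& (a + j <= n)%N,
          [forall p : 'I_n, (a <= p < a + j)%N ==> (p \notin c)],
          [forall p : 'I_n, (p.+1 == a :> nat) ==> (p \in c)] &
          [forall p : 'I_n, (p == a + j :> nat)%N ==> (p \in c)]]]|.

(* The entry of index i of a vector in 'cV_k.-1 is the one for spacings of
   length i.+1, so that lengths range over 1, ..., k - 1. *)
Definition spacings (R : realType) (n k : nat) (c : {set 'I_n}) :
    'cV[R]_k.-1 :=
  \col_i (nspacings i.+1 c)%:R.

Definition mean_spacings (R : realType) (k n : nat) : 'cV[R]_k.-1 :=
  final_expect k (@spacings R n k).

Definition normalized_spacings (R : realType) (k n : nat) (c : {set 'I_n}) :
    'cV[R]_k.-1 :=
  (Num.sqrt n%:R)^-1 *: (spacings R k c - mean_spacings R k n).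

Local Open Scope classical_set_scope.

Section asymptotic_parameters.
Variables (R : realType) (k : nat).
Implicit Types (i j : nat) (y z : R).

Let mu := @lebesgue_measure R.

Definition e_ y : R := expR (2 * \sum_(1 <= l < k) y ^+ l / l%:R).

Definition theta j : R :=
  2 / e_ 1 * \int[mu]_(y in `[0, 1]) ((1 - y) * y ^+ j * e_ y).

Definition G_ i z : R :=
  2 * (1 - z) ^- 2 * (e_ z)^-1
    * \int[mu]_(y in `[0, z]) (y ^+ i * (1 - y) * e_ y).

Definition H_ i j z : R :=
  (1 - z) * z ^+ i * (i == j)%:R
  + (1 - z) ^+ 2 * (z ^+ i + z ^+ k.-1 * G_ i z)
                 * (z ^+ j + z ^+ k.-1 * G_ j z)
  - theta i * theta j * (1 - z) ^- 2 *
    (3 + (4 * k%:R - 5) * (1 - z) + 2 * (k%:R - 1) ^+ 2 * (1 - z) ^+ 2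
       - 2 * k%:R ^+ 2 * (1 - z) ^+ 4
     - (2 + (4 * k%:R - 3) * (1 - z) + (2 * k%:R - 1) ^+ 2 * (1 - z) ^+ 2
          - 4 * k%:R ^+ 2 * (1 - z) ^+ 3) * z ^+ k).

Definition sigma i j : R :=
  2 / e_ 1 * \int[mu]_(y in `[0, 1[) (H_ i j y * e_ y).

Definition theta_vec : 'cV[R]_k.-1 := \col_i theta i.+1.

Definition Sigma_mx : 'M[R]_k.-1 := \matrix_(i, j) sigma i.+1 j.+1.

End asymptotic_parameters.

Definition borel_cV (R : realType) (m : nat) :=
  g_sigma_algebraType (@open 'cV[R]_m).

(* N(0, v) on the real line. The library's normal_prob takes the standard
   deviation and is not a point mass when it is 0, whence the case v = 0. *)
Definition is_centered_normal (R : realType)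
    (mu : set (measurableTypeR R) -> \bar R) (v : R) : Prop :=
  0 <= v /\
  forall A : set (measurableTypeR R), measurable A ->
    mu A = if v == 0 then \d_(0 : R) A else normal_prob 0 (Num.sqrt v) A.

(* N(0, S) on R^m, possibly degenerate: the image of mu under every linear
   form x |-> a^T x is N(0, a^T S a). *)
Definition is_centered_mvnormal (R : realType) (m : nat)
    (mu : probability (borel_cV R m) R) (S : 'M[R]_m) : Prop :=
  S^T = S /\
  forall a : 'cV[R]_m,
    is_centered_normal
      (pushforward mu (fun x : 'cV[R]_m => (a^T *m x) 0 0))
      ((a^T *m S *m a) 0 0).

(* Convergence in distribution of the n^(-1/2) (X_n - E X_n) to mu. *)
Definition normalized_spacings_cvg_in_distribution (R : realType) (k : nat)
    (mu : probability (borel_cV R k.-1) R) : Prop :=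
  forall f : 'cV[R]_k.-1 -> R, continuous f -> bounded_fun f ->
    (fun n : nat =>
       final_expect k (fun c : {set 'I_n} =>
         f (normalized_spacings R k c) : R^o))
      @ \oo --> (\int[mu]_x f x : R).

(* Main.v *)
(* After the first unit is placed the row splits into two independent rows, so
   the spacings X_n of a row of length n >= k satisfy X_n = X_a + X'_(n-k-a) in
   law, with a uniform in {0, ..., n - k}.  Additive functionals therefore obey
   averaging recursions (m + 1) x_(m+k) = 2 (x_0 + ... + x_m) + b_m, whose
   solutions are l (n + k) up to an exponentially small error as soon as b is
   exponentially small: the sequence x_n / (n + k) has increments that contract
   faster than any geometric rate.  The limits l of the mean and of the second
   moment centred at theta (n + k) are expressed through the initial values by
   summing the recursion against the integrals of y^n (1 - y) e_k(y), and the
   result is theta_j, respectively sigma_ij.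

   For a linear form g, with mean m_n and variance v_n, a second-order Taylor
   expansion in the same recursion bounds the distance from
   E cos(s (g - m_n) + al) to exp(- v_n s^2 / 2) cos al by a multiple of
   s^3 (n + k), which tends to 0 for s = n^(-1/2).  The limits are the
   characteristic functions of a Gaussian vector, built by taking successive
   Schur complements of Sigma.  Bernstein polynomials in the variables
   (1 + sin (b x_i)) / 2 approximate bounded continuous functions on boxes by
   globally bounded trigonometric polynomials, whence weak convergence, the
   tails being controlled by the second moments; the same argument in dimension
   one shows that a law is determined by its characteristic function. *)

Require Import Defs.
From mathcomp Require Import all_boot all_order all_algebra.
From mathcomp Require Import all_classical all_reals all_analysis.
From mathcomp Require Import measurable_realfun.
From mathcomp Require Import zify ring lra.
Import Order.TTheory GRing.Theory Num.Theory.
Import numFieldNormedType.Exports.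
Set Implicit Arguments.
Unset Strict Implicit.
Unset Printing Implicit Defensive.
Local Open Scope classical_set_scope.
Local Open Scope ring_scope.

(** * Gaps and the law of the final configuration *)

(** The shift by [k] makes all quantities additive: when the first unit leaves rows of [a] and
    [m - a] positions out of [m + k], one has [(m + k) + k = (a + k) + ((m - a) + k)]. Centring at a
    multiple of [n + k] is therefore inherited by both rows without correction, whereas centring
    second moments at the exact mean adds at each step a squared drift depending on [a]. In the
    moment formulas the obstacle is the singularity at 1 of the generating function of [n + k].
    Generating functions occur only through truncations: each differential equation is a polynomial
    identity with explicit boundary terms, which decay geometrically, and dominated convergence on
    [0, 1[ then reaches [H_]. Each convolution and each factor linear in [n] is paid for by doubling
    the geometric rate, hence the small numerical rates chosen at the start. Cosines with a free
    phase take the place of complex exponentials: conditioning on one of the two rows only changes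
    the phase of the other, so the estimates have to be uniform in it. *)

Section gap_lists.
Implicit Types (s : bitseq) (g m k j a : nat).

(** [true] marks an occupied position, and [g] counts the free positions read since the last one.
    Adjacent occupied positions produce gaps of length 0; they are kept, since they do not affect
    the count of any length [j > 0]. *)
Fixpoint gaps_from g s : seq nat :=
  match s with
  | [::] => [:: g]
  | true :: s' => g :: gaps_from 0 s'
  | false :: s' => gaps_from g.+1 s'
  end.

Definition gaps s := gaps_from 0 s.

Lemma gaps_from_nseq g m s :
  gaps_from g (nseq m false ++ s) = gaps_from (g + m) s.
Proof. by elim: m g => [|m IH] g /=; rewrite ?addn0 // IH addSnnS. Qed.

Lemma gaps_nseq m : gaps (nseq m false) = [:: m].
Proof. by rewrite -[nseq _ _]cats0 /gaps gaps_from_nseq. Qed.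

Lemma gaps_cat m s : gaps (nseq m false ++ true :: s) = m :: gaps s.
Proof. by rewrite /gaps gaps_from_nseq. Qed.

Lemma first_gap s :
  s = nseq (size s) false \/ exists m s', s = nseq m false ++ true :: s'.
Proof.
elim: s => [|[] s IH]; first by left.
  by right; exists 0%N, s.
case: IH => [E|[m [s' E]]]; first by left; rewrite /= -E.
by right; exists m.+1, s'; rewrite /= -E.
Qed.

(** Peels off the first gap together with the occupied position that closes it, so that the
    remainder is again a row delimited by its own ends. *)
Lemma bitseq_gap_ind (P : bitseq -> Prop) :
  (forall m, P (nseq m false)) ->
  (forall m s, P s -> P (nseq m false ++ true :: s)) -> forall s, P s.
Proof.
move=> P0 PS s; have [n] := ubnP (size s); elim: n s => // n IH s sn.
have [->|[m [s' E]]] := first_gap s; first exact: P0.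
rewrite E; apply: PS; apply: IH.
by move: sn; rewrite E size_cat size_nseq /=; lia.
Qed.

Lemma nth_nseq_false m i : nth false (nseq m false) i = false.
Proof. by rewrite nth_nseq if_same. Qed.

Definition fits k s a :=
  (a + k <= size s)%N && (take k (drop a s) == nseq k false).

Definition place k s a := take a s ++ nseq k true ++ drop (a + k) s.

Definition gap_at j s a :=
  [&& fits j s a, (a == 0%N) || nth false s a.-1 &
      (a + j == size s)%N || nth false s (a + j)].

Lemma fits_nseq k m a : fits k (nseq m false) a = (a + k <= m)%N.
Proof.
rewrite /fits size_nseq; case: leqP => //= akm.
by rewrite drop_nseq take_nseq ?eqxx //; lia.
Qed.

Lemma fitsP k s a : reflect
  ((a + k <= size s)%N /\ forall i, (a <= i < a + k)%N -> nth false s i = false)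
  (fits k s a).
Proof.
rewrite /fits; apply: (iffP andP) => -[aks].
  move=> /eqP E; split=> // i /andP[ai iak].
  have : nth false (take k (drop a s)) (i - a) = false.
    by rewrite E nth_nseq if_same.
  by rewrite nth_take ?nth_drop ?subnKC //; lia.
have sz : size (take k (drop a s)) = k by rewrite size_takel // size_drop; lia.
move=> E; split=> //; apply/eqP/(@eq_from_nth _ false).
  by rewrite sz size_nseq.
move=> i; rewrite sz => ik; rewrite nth_take // nth_drop nth_nseq ik E //; lia.
Qed.

Lemma nth_nseq_cat m s i :
  nth false (nseq m false ++ true :: s) i =
    if (i < m)%N then false else if i == m then true else nth false s (i - m.+1).
Proof.
rewrite nth_cat size_nseq; case: ltnP => im; first by rewrite nth_nseq im.
case: eqVneq => [->|im']; first by rewrite subnn.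
have -> : (i - m)%N = (i - m.+1).+1 by lia.
by [].
Qed.

(** A nonempty block that starts in the first gap cannot cross the occupied position at [m]. The
    range includes [a = m], where [k > 0] makes both sides false. *)
Lemma fits_catl k m s a : (0 < k)%N -> (a <= m)%N ->
  fits k (nseq m false ++ true :: s) a = (a + k <= m)%N.
Proof.
move=> k0 am; apply/fitsP/idP.
  move=> [_ E]; rewrite leqNgt; apply/negP => mak.
  have := E m; rewrite nth_nseq_cat ltnn eqxx; move=> H.
  by have := H ltac:(lia).
move=> akm; split; first by rewrite size_cat size_nseq /=; lia.
by move=> i ia; rewrite nth_nseq_cat ifT //; lia.
Qed.

Lemma fits_catr k m s a :
  fits k (nseq m false ++ true :: s) (m.+1 + a) = fits k s a.
Proof.
rewrite /fits size_cat size_nseq /= drop_cat size_nseq ifF; last by lia.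
by rewrite -(_ : a.+1 = (m.+1 + a - m)%N) /=; [congr andb; lia | lia].
Qed.

Lemma place_nseq k m a : (a + k <= m)%N ->
  place k (nseq m false) a =
    nseq a false ++ nseq k true ++ nseq (m - k - a) false.
Proof.
move=> akm; rewrite /place take_nseq ?drop_nseq; last by lia.
by congr (_ ++ (_ ++ nseq _ _)); lia.
Qed.

Lemma place_catl k m s a : (a + k <= m)%N ->
  place k (nseq m false ++ true :: s) a =
    nseq a false ++ nseq k true ++ nseq (m - k - a) false ++ true :: s.
Proof.
move=> akm; rewrite /place take_cat drop_cat size_nseq.
case: ltnP => am; last first.
  have -> : k = 0%N by lia.
  rewrite /= addn0 (_ : a = m); last by lia.
  by rewrite ltnn subn0 subnn /= cats0.
rewrite take_nseq; last by lia.
case: ltnP => akm'; first by rewrite drop_nseq subnDA subnAC.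
have -> : (a + k - m = 0)%N by lia.
by have -> : (m - k - a = 0)%N by lia.
Qed.

Lemma place_catr k m s a :
  place k (nseq m false ++ true :: s) (m.+1 + a) =
    nseq m false ++ true :: place k s a.
Proof.
rewrite /place take_cat drop_cat size_nseq !ifF; try lia.
rewrite -catA; congr (_ ++ _).
rewrite (_ : m.+1 + a - m = a.+1)%N; last by lia.
by rewrite (_ : m.+1 + a + k - m = (a + k).+1)%N //; lia.
Qed.

Lemma gap_at_catr j m s a :
  gap_at j (nseq m false ++ true :: s) (m.+1 + a) = gap_at j s a.
Proof.
rewrite /gap_at fits_catr; congr (_ && (_ && _)).
  rewrite nth_nseq_cat ifF; last by lia.
  case: a => [|a]; first by rewrite addn0 /= eqxx.
  rewrite addSn /= ifF; last by lia.
  by have -> : (m + a.+1 - m.+1 = a)%N by lia.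
rewrite size_cat size_nseq /= nth_nseq_cat ifF ?ifF; try lia.
by congr (_ || nth _ _ _); lia.
Qed.

Lemma count_gaps j s : (0 < j)%N ->
  (\sum_(0 <= a < size s) gap_at j s a = count_mem j (gaps s))%N.
Proof.
move=> j0; elim/bitseq_gap_ind: s => [m|m s IH].
  rewrite gaps_nseq /= addn0 size_nseq; case: m => [|m].
    by rewrite big_geq //; lia.
  rewrite big_ltn // big_nat_cond big1 ?addn0; last first.
    move=> a /andP[am _]; rewrite /gap_at !nth_nseq_false.
    by rewrite (_ : (a == 0) = false) ?andbF //; lia.
  rewrite /gap_at fits_nseq size_nseq !nth_nseq_false orbF andTb.
  by congr nat_of_bool; rewrite add0n; lia.
rewrite gaps_cat /= -IH size_cat size_nseq /=.
rewrite (@big_cat_nat _ _ _ m.+1) //=; last by lia.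
congr (_ + _)%N; last first.
  rewrite -{1}[m.+1]add0n big_addn (_ : (m + (size s).+1 - m.+1 = size s)%N); last by lia.
  by apply: eq_bigr => a _; rewrite addnC gap_at_catr.
rewrite big_ltn // big_nat_cond big1 ?addn0; last first.
  move=> a /andP[am _]; rewrite /gap_at nth_nseq_cat ifT; last by lia.
  by rewrite (_ : (a == 0) = false) ?andbF //; lia.
rewrite /gap_at fits_catl //= add0n size_cat size_nseq /= nth_nseq_cat.
congr nat_of_bool; case: (eqVneq m j) => [->|mj].
  by rewrite leqnn ltnn orbT.
case: (leqP j m) => //= jm; have -> : (j < m)%N by lia.
by lia.
Qed.

End gap_lists.

(** * The expectation functional of the splitting recursion *)

Section law.
Variables (R : realType) (V : zmodType) (k : nat) (e : nat -> V).
Hypothesis k_gt0 : (0 < k)%N.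
Hypothesis e0 : e 0 = 0.
Implicit Types (f : V -> R) (m n t : nat).

(** The recursion runs on the two shorter rows left by the first unit, which is not structural,
    hence the fuel. A law is represented by its expectation functional; nesting the two calls
    expresses the independence of the two rows. *)
Fixpoint law_fuel t m f : R :=
  if t is t'.+1 then
    if (m < k)%N then f (e m)
    else (m - k).+1%:R^-1 * \sum_(a < (m - k).+1)
      law_fuel t' a (fun x => law_fuel t' (m - k - a) (fun y => f (x + y)))
  else f (e m).

(* [law m f] is the expectation of [f] at the vector of the spacings left by
   the process on a row of [m] positions. *)
Definition law m f := law_fuel m.+1 m f.

Lemma law_fuelE t m f : (m < t)%N -> law_fuel t m f = law m f.
Proof.
rewrite /law; have [N] := ubnP m; elim: N m t f => // N IH m [//|t] f mN mt /=.
case: ltnP => // km; congr (_ * _); apply: eq_bigr => -[a /= Ha] _.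
rewrite !(IH a) //; try lia.
by congr law_fuel; apply/funext => x; rewrite !(IH (m - k - a)%N) //; lia.
Qed.

Lemma law_small m f : (m < k)%N -> law m f = f (e m).
Proof. by rewrite /law /= => ->. Qed.

Lemma lawE m f : (k <= m)%N ->
  law m f = (m - k).+1%:R^-1 * \sum_(a < (m - k).+1)
      law a (fun x => law (m - k - a) (fun y => f (x + y))).
Proof.
move=> km; rewrite {1}/law /= ifF; last by lia.
congr (_ * _); apply: eq_bigr => -[a /= Ha] _.
rewrite law_fuelE; last by lia.
by congr law; apply/funext => x; rewrite law_fuelE //; lia.
Qed.

Lemma law_sum m f : (k <= m)%N ->
  \sum_(a < (m - k).+1) law a (fun x => law (m - k - a) (fun y => f (x + y)))
  = (m - k).+1%:R * law m f.
Proof. by move=> km; rewrite lawE // mulrA divff ?mul1r. Qed.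

(** The form with finite sums gives at once additivity, scaling and the exchange with the sum over
    free blocks in [law_gaps_harmonic]. *)
Lemma law_lin m I (r : seq I) (c : I -> R) (F : I -> V -> R) :
  law m (fun x => \sum_(i <- r) c i * F i x) = \sum_(i <- r) c i * law m (F i).
Proof.
have [N] := ubnP m; elim: N m F => // N IH m F mN.
have [mk|km] := ltnP m k; first by rewrite law_small //; under [RHS]eq_bigr do rewrite law_small //.
rewrite lawE //.
have -> : \sum_(a < (m - k).+1) law a (fun x =>
      law (m - k - a) (fun y => \sum_(i <- r) c i * F i (x + y))) =
    \sum_(a < (m - k).+1) \sum_(i <- r)
      c i * law a (fun x => law (m - k - a) (fun y => F i (x + y))).
  apply: eq_bigr => -[a /= Ha] _; rewrite -IH; last by lia.
  congr law; apply/funext => x; rewrite IH //; lia.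
rewrite exchange_big /= mulr_sumr; apply: eq_bigr => i _.
by rewrite lawE // -mulr_sumr mulrCA.
Qed.

Lemma law_ge0 m f : (forall x, 0 <= f x) -> 0 <= law m f.
Proof.
have [N] := ubnP m; elim: N m f => // N IH m f mN f0.
have [mk|km] := ltnP m k; first by rewrite law_small.
rewrite lawE // mulr_ge0 ?invr_ge0 // sumr_ge0 // => -[a /= Ha] _.
apply: (IH a) => [|x]; first by lia.
by apply: (IH (m - k - a)%N) => [|y //]; lia.
Qed.

Lemma lawD m f g : law m (fun x => f x + g x) = law m f + law m g.
Proof.
have := @law_lin m bool [:: true; false] (fun=> 1) (fun b => if b then f else g).
rewrite !big_cons big_nil /= !mul1r addr0 => <-.
by congr law; apply/funext => x; rewrite !big_cons big_nil !mul1r addr0.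
Qed.

Lemma lawZ m c f : law m (fun x => c * f x) = c * law m f.
Proof.
have := @law_lin m unit [:: tt] (fun=> c) (fun=> f).
rewrite big_seq1 => <-.
by congr law; apply/funext => x; rewrite big_seq1.
Qed.

Lemma lawN m f : law m (fun x => - f x) = - law m f.
Proof.
by rewrite -mulN1r -lawZ; congr law; apply/funext => x; rewrite mulN1r.
Qed.

Lemma lawB m f g : law m (fun x => f x - g x) = law m f - law m g.
Proof. by rewrite lawD lawN. Qed.

Lemma law_cst m c : law m (fun=> c) = c.
Proof.
have [N] := ubnP m; elim: N m => // N IH m mN.
have [mk|km] := ltnP m k; first by rewrite law_small.
rewrite lawE // (eq_bigr (fun=> c)); last first.
  move=> -[a /= Ha] _; rewrite -[RHS](IH a); last by lia.
  by congr law; apply/funext => x; rewrite IH //; lia.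
by rewrite sumr_const card_ord -[c *+ _]mulr_natl mulrA mulVf ?mul1r.
Qed.

Lemma ler_law m f g : (forall x, f x <= g x) -> law m f <= law m g.
Proof.
by move=> fg; rewrite -subr_ge0 -lawB law_ge0 // => x; rewrite subr_ge0.
Qed.

Lemma ler_norm_law m f : `|law m f| <= law m (fun x => `|f x|).
Proof.
rewrite ler_norml -lawN; apply/andP; split; apply: ler_law => x.
  by rewrite lerNl ler_normr lexx orbT.
exact: ler_norm.
Qed.

Fixpoint law_gaps (s : seq nat) f : R :=
  if s is m :: s' then law m (fun x => law_gaps s' (fun y => f (x + y)))
  else f 0.

Lemma law0 f : law 0 f = f 0.
Proof. by rewrite law_small // e0. Qed.

Lemma law_gaps0 s f : law_gaps (0%N :: s) f = law_gaps s f.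
Proof.
by rewrite /= law0; congr law_gaps; apply/funext => y; rewrite add0r.
Qed.

Lemma law_gaps_ones j s f :
  law_gaps (gaps (nseq j true ++ s)) f = law_gaps (gaps s) f.
Proof.
elim: j => // j IH; rewrite -IH -[gaps (nseq j.+1 _ ++ _)]/(_ :: gaps _).
exact: law_gaps0.
Qed.

Lemma law_gaps_stopped s f : (forall m, m \in s -> (m < k)%N) ->
  law_gaps s f = f (\sum_(m <- s) e m).
Proof.
elim: s f => [|m s IH] f sk; first by rewrite big_nil.
rewrite /= law_small ?sk ?inE ?eqxx // IH ?big_cons // => i si.
by rewrite sk // inE si orbT.
Qed.

Lemma sum_fits_nseq m (F : nat -> R) :
  \sum_(0 <= a < m) (a + k <= m)%N%:R * F a =
  if (m < k)%N then 0 else \sum_(a < (m - k).+1) F a.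
Proof.
have [mk|km] := ltnP m k.
  rewrite big_nat_cond big1 // => a /andP[_ _].
  by rewrite (_ : (a + k <= m)%N = false) ?mul0r //; lia.
rewrite (@big_cat_nat _ _ _ (m - k).+1) //=; last by lia.
rewrite [X in _ + X]big_nat_cond [X in _ + X]big1 ?addr0; last first.
  by move=> a /andP[/andP[a1 a2] _]; rewrite (_ : (a + k <= m)%N = false) ?mul0r //; lia.
rewrite big_mkord; apply: eq_bigr => -[a /= Ha] _.
by rewrite (_ : (a + k <= m)%N = true) ?mul1r //; lia.
Qed.

(** Harmonicity for the process, before division by the number of free blocks. Blocks in the first
    gap reproduce the recursion [law_sum] of that gap, the others fall under the induction
    hypothesis. As both groups return the same value, the order in which different gaps are served
    does not influence the law. *)
Lemma law_gaps_harmonic s f :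
  \sum_(0 <= a < size s) (fits k s a)%:R * law_gaps (gaps (place k s a)) f =
  (\sum_(0 <= a < size s) (fits k s a)%:R) * law_gaps (gaps s) f.
Proof.
elim/bitseq_gap_ind: s f => [m|m s IH] f.
  rewrite size_nseq gaps_nseq /=.
  under eq_bigr do rewrite fits_nseq.
  under [in RHS]eq_bigr do rewrite fits_nseq -[_%:R]mulr1.
  rewrite !sum_fits_nseq; case: ltnP => km; first by rewrite mul0r.
  rewrite sumr_const card_ord.
  under [X in law m X]eq_fun do rewrite addr0.
  rewrite -law_sum //; apply: eq_bigr => -[a /= Ha] _.
  rewrite place_nseq; last by lia.
  (* The first cell of the new unit closes the gap of length [a]; its remaining cells create gaps of
     length 0, which [law_gaps_ones] removes. *)
  case: k k_gt0 => // k' _ in Ha km *.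
  rewrite gaps_cat /=; congr law; apply/funext => x.
  by rewrite law_gaps_ones gaps_nseq /=; under eq_fun do rewrite addr0.
rewrite size_cat size_nseq /=.
rewrite !(@big_cat_nat _ _ _ m.+1 0 (m + (size s).+1)) //=; try lia.
rewrite mulrDl; congr (_ + _); last first.
  have shift (F : nat -> R) : \sum_(m.+1 <= i < m + (size s).+1) F i =
      \sum_(0 <= i < size s) F (m.+1 + i)%N.
    rewrite -{1}[m.+1]add0n big_addn; have -> : (m + (size s).+1 - m.+1 = size s)%N by lia.
    by apply: eq_bigr => i _; rewrite addnC.
  rewrite !shift.
  under eq_bigr => a _ do rewrite fits_catr place_catr gaps_cat /=.
  under [in RHS]eq_bigr => a _ do rewrite fits_catr.
  rewrite gaps_cat /=.
  rewrite -law_lin -lawZ; congr law; apply/funext => x.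
  exact: IH.
rewrite !big_nat_recr //= !fits_catl // (_ : (m + k <= m)%N = false) ?mul0r ?addr0; last by lia.
have fitsE (F : nat -> R) :
    \sum_(0 <= i < m) (fits k (nseq m false ++ true :: s) i)%:R * F i =
    \sum_(0 <= i < m) (i + k <= m)%N%:R * F i.
  by apply: eq_big_nat => i /andP[_ im]; rewrite fits_catl // ltnW.
rewrite fitsE; under [in RHS]eq_bigr do rewrite -[_%:R]mulr1.
rewrite fitsE !sum_fits_nseq; case: ltnP => km; first by rewrite mul0r.
rewrite sumr_const card_ord gaps_cat /= -law_sum //.
apply: eq_bigr => -[a /= Ha] _.
rewrite place_catl; last by lia.
case: k k_gt0 => // k' _ in Ha km *.
rewrite gaps_cat /=; congr law; apply/funext => x.
rewrite law_gaps_ones gaps_cat /=; congr law; apply/funext => y.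
by congr law_gaps; apply/funext => z; rewrite addrA.
Qed.

End law.

(** * Reduction of the placement process to gap lists *)

Section configurations.
Variables (R : realType) (k n : nat).
Hypothesis k_gt0 : (0 < k)%N.
Implicit Types (c : {set 'I_n}).

Definition bits c : bitseq := [seq i \in c | i <- enum 'I_n].

Lemma size_bits c : size (bits c) = n.
Proof. by rewrite size_map size_enum_ord. Qed.

Lemma nth_bits c (i : 'I_n) : nth false (bits c) i = (i \in c).
Proof.
by rewrite (nth_map i) ?size_enum_ord // nth_ord_enum.
Qed.

Lemma nth_bits_lt c i (ilt : (i < n)%N) :
  nth false (bits c) i = (Ordinal ilt \in c).
Proof. by rewrite -nth_bits. Qed.

Lemma bits0 : bits finset.set0 = nseq n false.
Proof.
apply: (@eq_from_nth _ false); first by rewrite size_bits size_nseq.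
by move=> i; rewrite size_bits => ilt; rewrite nth_bits_lt inE nth_nseq_false.
Qed.

Lemma free_blocksE c (a : 'I_n) : (a \in free_blocks k c) = fits k (bits c) a.
Proof.
rewrite inE; apply/andP/fitsP; rewrite size_bits => -[akn H]; split=> //.
  move=> i ia; have ilt : (i < n)%N by lia.
  rewrite nth_bits_lt; apply/negbTE.
  apply/negP => ic; move/pred0P/(_ (Ordinal ilt)): H; rewrite /= ic inE /= ia.
by [].
apply/pred0P => p /=; apply/negP => /andP[]; rewrite inE => pa pc.
by have := H p pa; rewrite nth_bits pc.
Qed.

Lemma bits_place c (a : 'I_n) : (a + k <= n)%N ->
  bits (c :|: block k a)%SET = place k (bits c) a.
Proof.
move=> akn; apply: (@eq_from_nth _ false).
  rewrite size_bits !size_cat size_takel ?size_bits; last by lia.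
  by rewrite size_nseq size_drop size_bits; lia.
move=> i; rewrite size_bits => ilt; rewrite nth_bits_lt !inE /=.
rewrite !nth_cat size_takel ?size_bits; last by lia.
rewrite size_nseq -nth_bits /=.
have [ia|ia] /= := ltnP i a; first by rewrite nth_take // orbF.
rewrite ltn_subLR //; have [iak|iak] := ltnP i (a + k).
  by rewrite nth_nseq orbT ifT //; lia.
by rewrite nth_drop orbF; congr nth; lia.
Qed.

Lemma nspacings_gaps j c : (0 < j)%N ->
  nspacings j c = count_mem j (gaps (bits c)).
Proof.
move=> j0; rewrite -count_gaps // size_bits big_mkord /nspacings -sum1dep_card big_mkcond /=.
apply: eq_bigr => a _; rewrite -[RHS]/(nat_of_bool (gap_at j (bits c) a)) /gap_at.
rewrite -[LHS]/(nat_of_bool _); congr nat_of_bool.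
have -> : fits j (bits c) a = (a + j <= n)%N && [forall p : 'I_n, (a <= p < a + j)%N ==> (p \notin c)].
  apply/fitsP/andP; rewrite size_bits => -[aj H]; split=> //.
    apply/forallP => p; apply/implyP => pa.
    by have := H p pa; rewrite nth_bits => ->.
  move=> i ia; have ilt : (i < n)%N by lia.
  rewrite nth_bits_lt; apply/negbTE.
  by have /forallP/(_ (Ordinal ilt))/implyP := H; apply.
rewrite -andbA; case: leqP => //= ajn; congr (_ && (_ && _)).
  apply/forallP/orP.
    move=> H; case: (posnP a) => [->|a0]; [by left | right].
    have alt : (a.-1 < n)%N by have := ltn_ord a; lia.
    rewrite nth_bits_lt; have /implyP := H (Ordinal alt); apply => /=.
    by apply/eqP; lia.
  move=> H p; apply/implyP => /eqP pa; move: H => [|].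
    by rewrite -pa.
  by rewrite -pa /= nth_bits.
rewrite size_bits; apply/forallP/orP.
  move=> H; case: (ltnP (a + j) n) => [{}ajn|najn].
    right; rewrite nth_bits_lt; have /implyP := H (Ordinal ajn); apply => /=.
    exact: eqxx.
  by left; apply/eqP; lia.
move=> H p; apply/implyP => /eqP pa; have := ltn_ord p; rewrite pa.
case: H => [/eqP ->|]; first by rewrite ltnn.
by move=> H _; rewrite -nth_bits pa.
Qed.

Definition gap_value m : 'cV[R]_k.-1 := \col_i (i.+1 == m)%:R.

Lemma gap_value0 : gap_value 0 = 0.
Proof. by apply/colP => i; rewrite !mxE. Qed.

Local Notation lw := (@law R 'cV[R]_k.-1 k gap_value).

(* The conditional expectation of f at the final configuration given c: distinct
   gaps of c are filled independently of each other. *)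
Let potential (f : 'cV[R]_k.-1 -> R) c := law_gaps k gap_value (gaps (bits c)) f.

Lemma spacings_gaps c : spacings R k c = \sum_(m <- gaps (bits c)) gap_value m.
Proof.
apply/colP => i; rewrite mxE summxE nspacings_gaps //.
rewrite -sum1_count natr_sum [in RHS]big_mkcond /= big_mkcond /=.
by apply: eq_bigr => m _; rewrite mxE eq_sym; case: eqP.
Qed.

Lemma gaps_lt s : (forall a, (a < size s)%N -> ~~ fits k s a) ->
  forall m, m \in gaps s -> (m < k)%N.
Proof.
elim/bitseq_gap_ind: s => [m|m s IH] H g.
  rewrite gaps_nseq inE => /eqP ->; rewrite ltnNge; apply/negP => km.
  by have := H 0%N; rewrite size_nseq fits_nseq add0n km => /(_ ltac:(lia)).
rewrite gaps_cat inE => /orP[/eqP ->|gs].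
  rewrite ltnNge; apply/negP => km.
  by have := H 0%N; rewrite fits_catl // add0n km size_cat /= => /(_ ltac:(lia)).
apply: IH gs => a asz; have := H (m.+1 + a)%N; rewrite fits_catr; apply.
by rewrite size_cat size_nseq /=; lia.
Qed.

Lemma potential_stopped f c : free_blocks k c = finset.set0 ->
  potential f c = f (spacings R k c).
Proof.
move=> c0; rewrite /potential law_gaps_stopped ?spacings_gaps //.
apply: gaps_lt => a; rewrite size_bits => an.
by rewrite -(free_blocksE c (Ordinal an)) c0 inE.
Qed.

(** The transition probability counts the blocks that lead to [c']; regrouping the sum by [c'] turns
    it into an average over free blocks, to which [law_gaps_harmonic] applies. *)
Lemma step_potential f c :
  \sum_(c' : {set 'I_n}) step_prob R k c c' * potential f c' = potential f c.
Proof.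
have [c0|c0] := boolP (free_blocks k c == finset.set0).
  rewrite /potential /step_prob c0 (bigD1 c) //= eqxx mul1r big1 ?addr0 // => c' /negbTE.
  by rewrite eq_sym => ->; rewrite mul0r.
have N0 : (#|free_blocks k c|%:R : R) != 0 by rewrite pnatr_eq0 cards_eq0.
rewrite /step_prob (negbTE c0); transitivity (#|free_blocks k c|%:R^-1 *
    \sum_(a in free_blocks k c) potential f (c :|: block k a)%SET).
  rewrite mulr_sumr (partition_big (fun a => (c :|: block k a)%SET) xpredT) //=.
  apply: eq_bigr => c' _.
  rewrite (eq_bigr (fun=> #|free_blocks k c|%:R^-1 * potential f c')); last first.
    by move=> a /andP[_ /eqP ->].
  rewrite sumr_const -mulrA -[RHS]mulr_natl; congr (_%:R * _).
  by apply: eq_card => a; rewrite [RHS]inE !inE.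
have := law_gaps_harmonic k_gt0 gap_value0 (bits c) f.
rewrite size_bits !big_mkord.
under eq_bigr => a _ do rewrite -free_blocksE.
under [in X in _ = X]eq_bigr => a _ do rewrite -free_blocksE.
have -> : \sum_(a < n) (a \in free_blocks k c)%:R = #|free_blocks k c|%:R :> R.
  by rewrite -natr_sum -sum1_card [in RHS]big_mkcond.
move=> E; apply: (mulfI N0); rewrite mulrA mulfV // mul1r -E.
rewrite big_mkcond /=; apply: eq_bigr => a _.
case: ifP => [ac|_]; last by rewrite mul0r.
rewrite mul1r /potential bits_place //.
by move: ac; rewrite inE => /andP[].
Qed.

(** Martingale argument: the expected potential is constant in [t], and at time 0 the row is a
    single gap of length [n]. *)
Lemma placement_potential f t :
  \sum_(c : {set 'I_n}) placement_prob R k t c * potential f c = lw n f.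
Proof.
elim: t => [|t IH] /=.
  rewrite (bigD1 finset.set0) //= eqxx mul1r big1 ?addr0; last first.
    by move=> c /negbTE ->; rewrite mul0r.
  rewrite /potential bits0 gaps_nseq /=.
  by congr law; apply/funext => x; rewrite addr0.
under eq_bigr do rewrite mulr_suml.
rewrite exchange_big /= -IH; apply: eq_bigr => c _.
rewrite -[in RHS]step_potential mulr_sumr; apply: eq_bigr => c' _.
by rewrite mulrA.
Qed.

(** A unit occupies at least one new position, so a chain that has not stopped gains at least one
    position per step; this crude count suffices for absorption by time [n]. *)
Lemma placement_progress t c : placement_prob R k t c != 0 ->
  free_blocks k c = finset.set0 \/ (t <= #|c|)%N.
Proof.
elim: t c => [|t IH] c; first by right.
move=> /= P0; have [b Hb] : exists b, placement_prob R k t b * step_prob R k b c != 0.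
  apply/existsP; apply: contraNT P0; rewrite negb_exists => /forallP H.
  by rewrite big1 // => b _; apply/eqP; rewrite -[_ == _]negbK H.
have {P0} pb : placement_prob R k t b != 0.
  by apply: contraNneq Hb => ->; rewrite mul0r.
have sb : step_prob R k b c != 0.
  by apply: contraNneq Hb => ->; rewrite mulr0.
move: sb; rewrite /step_prob; case: ifPn => b0.
  by have [->|_] := eqVneq c b; [left; apply/eqP | rewrite eqxx].
have [b00|tb] := IH b pb; first by rewrite b00 eqxx in b0.
have [->|/finset.set0Pn[a]] := eqVneq [set a in free_blocks k b | (b :|: block k a)%SET == c]%SET finset.set0.
  by rewrite cards0 mul0r eqxx.
rewrite inE => /andP[afree /eqP <-] _; right.
move: afree; rewrite inE => /andP[akn abdisj].
rewrite cardsU disjoint_setI0 1?disjoint_sym // cards0 subn0.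
suff : (0 < #|block k a|)%N by move: tb => /=; lia.
by apply/card_gt0P; exists a; rewrite inE; lia.
Qed.

Lemma final_law f :
  \sum_(c : {set 'I_n}) final_prob R k c * f (spacings R k c) = lw n f.
Proof.
rewrite -(placement_potential f n); apply: eq_bigr => c _.
rewrite /final_prob; have [->|P0] := eqVneq (placement_prob R k n c) 0.
  by rewrite !mul0r.
rewrite potential_stopped //; have [//|nc] := placement_progress P0.
(* A chain not yet known to have stopped has filled all [n] positions after [n] steps, which also
   leaves no free block. *)
have cT : c = finset.setT.
  apply/eqP; rewrite finset.eqEcard finset.subsetT cardsT card_ord.
  exact: nc.
apply/finset.setP => a; rewrite !inE cT; apply/negbTE/negP => /andP[_].
move=> /pred0P/(_ a) /=; rewrite !inE andbT; lia.
Qed.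

End configurations.

(** * Averaging recursions *)

Section geometric_decay.
Variable R : realType.
Implicit Types (x y b : nat -> R) (r : R).

Definition geo_bounded r x := exists C, forall n, `|x n| <= C * r ^+ n.

Lemma geo_boundedW r r' x : 0 <= r <= r' -> geo_bounded r x -> geo_bounded r' x.
Proof.
move=> /andP[r0 rr'] [C H]; exists C => n; apply: le_trans (H n) _.
apply: ler_wpM2l; last by apply: lerXn2r => //; rewrite nnegrE (le_trans r0).
by have := H 0%N; rewrite expr0 mulr1; apply: le_trans.
Qed.

Lemma succ_le_pow2 n : (n.+1%:R : R) <= 2 ^+ n.
Proof. by rewrite -natrX ler_nat; exact: ltn_expl. Qed.

(** The convolution has [m + 1] terms of size [r ^ m], and [m + 1 <= 2 ^ m] is absorbed by doubling
    the rate. Other polynomial factors are treated in the same way. *)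
Lemma geo_bounded_conv r x y : 0 <= r -> geo_bounded r x -> geo_bounded r y ->
  geo_bounded (2 * r) (fun m => \sum_(a < m.+1) x a * y (m - a)%N).
Proof.
move=> r0 [C HC] [C' HC']; exists (C * C') => m.
have C0 : 0 <= C by have := HC 0%N; rewrite expr0 mulr1; apply: le_trans.
have C'0 : 0 <= C' by have := HC' 0%N; rewrite expr0 mulr1; apply: le_trans.
apply: le_trans (ler_norm_sum _ _ _) _.
apply: (@le_trans _ _ (\sum_(a < m.+1) C * C' * r ^+ m)).
  apply: ler_sum => -[a /= Ha] _; rewrite normrM.
  apply: le_trans (ler_pM _ _ (HC a) (HC' _)) _ => //.
  rewrite mulrACA -exprD; have -> // : (a + (m - a) = m)%N by lia.
rewrite sumr_const card_ord -[_ *+ _]mulr_natl exprMn mulrCA.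
by rewrite ler_wpM2l ?mulr_ge0 // ler_wpM2r ?exprn_ge0 // succ_le_pow2.
Qed.

End geometric_decay.

Section averaging_recursion.
Variables (R : realType) (k : nat).
Hypothesis k_gt0 : (0 < k)%N.
Implicit Types (x b : nat -> R) (r l : R).

Definition avg_rec x b := forall m,
  m.+1%:R * x (m + k)%N = 2 * \sum_(a < m.+1) x a + b m.

Section limit.
Variables (x b : nat -> R) (r C : R).
Hypothesis xb : avg_rec x b.
Hypothesis r01 : 0 < r < 1.
Hypothesis bC : forall m, `|b m| <= C * r ^+ m.

Let s n := x n / (n + k)%:R.
Let D n := s n.+1 - s n.

Let xE n : x n = s n * (n + k)%:R.
Proof. by rewrite mulfVK // pnatr_eq0; lia. Qed.

Let sum_D p q : s (p + q)%N - s p = \sum_(l < q) D (p + l)%N.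
Proof.
elim: q => [|q IH]; first by rewrite addn0 subrr big_ord0.
by rewrite big_ord_recr /= -IH addnS /D; ring.
Qed.

(** Subtracting consecutive instances of the recursion eliminates the full sum. Because [n + k]
    solves the homogeneous recursion, only differences of [s] are left, that is [k - 1] increments
    with the small factor [2 / (m + 1)]. *)
Let D_rec m : `|D (m + k)| <=
  2 / m.+1%:R * (\sum_(l < k.-1) `|D (m.+1 + l)|) + 2 * C * r ^+ m.
Proof.
have C0 : 0 <= C by have := bC 0%N; rewrite expr0 mulr1; apply: le_trans.
have E : m.+2%:R * (m + k + k).+1%:R * D (m + k) =
    2 * (m + k).+1%:R * (s m.+1 - s (m + k)) + (b m.+1 - b m).
  have := xb m.+1; have := xb m; rewrite big_ord_recr [in X in _ -> X]big_ord_recr.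
  rewrite [in X in _ -> X]big_ord_recr /=.
  set S := \sum_(i < m) _; rewrite !xE /D !addSn.
  rewrite -!natr1 !natrD => E1 E2.
  lra.
have W0 : 0 < m.+2%:R * (m + k + k).+1%:R :> R by rewrite mulr_gt0.
have W1 : (m.+1%:R : R) <= m.+2%:R by rewrite ler_nat.
have W2 : 2 * (m + k).+1%:R <= 2 * (m + k + k).+1%:R :> R by rewrite ler_wpM2l // ler_nat; lia.
rewrite -(ler_pM2l W0) -[X in X * `|_|]gtr0_norm // -normrM E.
apply: le_trans (ler_normD _ _) _; rewrite [leRHS]mulrDr; apply: lerD.
  rewrite normrM ger0_norm ?mulr_ge0 //.
  pose T : R := \sum_(l < k.-1) `|D (m.+1 + l)|; rewrite -/T.
  have -> : s m.+1 - s (m + k) = - \sum_(l < k.-1) D (m.+1 + l).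
    by rewrite -sum_D opprB; congr (_ - s _); lia.
  rewrite normrN.
  have T0 : 0 <= T by apply: sumr_ge0.
  have nT : `|\sum_(l < k.-1) D (m.+1 + l)| <= T by apply: ler_norm_sum.
  apply: (@le_trans _ _ (2 * (m + k + k).+1%:R * T)).
    apply: (@le_trans _ _ (2 * (m + k).+1%:R * T)); first by rewrite ler_wpM2l.
    exact: ler_wpM2r.
  have E2 : (m.+2%:R : R) * (m + k + k).+1%:R * (2 / m.+1%:R * T) =
      2 * (m + k + k).+1%:R * T * (m.+2%:R / m.+1%:R) by ring.
  rewrite E2 ler_peMr ?mulr_ge0 // ler_pdivlMr // mul1r; exact: W1.
have rm0 : 0 <= r ^+ m by rewrite exprn_ge0 // ltW; case/andP: r01.
have rm1 : C * r ^+ m.+1 <= C * r ^+ m.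
  by apply: ler_wpM2l => //; rewrite exprS ler_piMl // ltW; case/andP: r01.
have bb : `|b m.+1 - b m| <= 2 * C * r ^+ m.
  apply: le_trans (ler_normB _ _) _.
  by have := bC m; have := bC m.+1; lra.
apply: le_trans bb _; rewrite ler_peMl ?mulr_ge0 // -natrM ler1n.
by rewrite muln_gt0.
Qed.

Lemma avg_rec_cvg : exists l M, forall n, `|x n - l * (n + k)%:R| <= M * (n + k)%:R * r ^+ n.
Proof.
case/andP: r01 => r0 r1.
have C0 : 0 <= C by have := bC 0%N; rewrite expr0 mulr1; apply: le_trans.
have rk m : 0 < r ^+ m by exact: exprn_gt0.
(* From [m >= N] on, the increments in [D_rec] contribute at most half of [M * r ^ (m + k)]. The
   summand [4 * C / r ^ k] of [M] pays for the other half, which comes from [b], and the finite sum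
   in [M] for the indices below [N + k]. *)
pose N := Num.truncn (4 * k%:R / r ^+ k).
have HN m : (N <= m)%N -> 2 / m.+1%:R * k%:R <= r ^+ k / 2.
  move=> Nm; have : 4 * k%:R / r ^+ k <= m.+1%:R.
    apply: ltW; apply: lt_le_trans (truncnS_gt _) _; by rewrite ler_nat.
  rewrite ler_pdivrMr // mulrAC ler_pdivrMr // => H.
  by move: H; set u := r ^+ k; lra.
pose M := 4 * C / r ^+ k + \sum_(i < N + k) `|D i| / r ^+ i.
have M0 : 0 <= M.
  by rewrite addr_ge0 ?sumr_ge0 // => [|i _]; rewrite mulr_ge0 ?invr_ge0 ?mulr_ge0 // ltW.
have DM n : `|D n| <= M * r ^+ n.
  have [B] := ubnP n; elim: B n => // B IH n nB.
  have [nN|Nn] := ltnP n (N + k).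
    rewrite -ler_pdivrMr // /M (bigD1 (Ordinal nN)) //= addrCA lerDl addr_ge0 //.
      by rewrite mulr_ge0 ?invr_ge0 ?mulr_ge0 // ltW.
    by apply: sumr_ge0 => i _; rewrite mulr_ge0 ?invr_ge0 // ltW.
  have [m nE] : exists m, n = (m + k)%N by exists (n - k)%N; lia.
  rewrite nE; apply: le_trans (D_rec m) _.
  have S : \sum_(l < k.-1) `|D (m.+1 + l)| <= k%:R * (M * r ^+ m).
    apply: (@le_trans _ _ (\sum_(l < k.-1) M * r ^+ m)).
      apply: ler_sum => -[l /= lk] _; apply: le_trans (IH _ _) _; first by lia.
      apply: ler_wpM2l => //; rewrite ler_wiXn2l ?(ltW r0) ?(ltW r1) //; lia.
    rewrite sumr_const card_ord -[_ *+ _]mulr_natl ler_wpM2r ?mulr_ge0 ?(ltW (rk _)) //.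
    by rewrite ler_nat; lia.
  have CM : 4 * C <= M * r ^+ k.
    rewrite -ler_pdivrMr // /M lerDl sumr_ge0 // => i _.
    by rewrite mulr_ge0 ?invr_ge0 // ltW.
  have H2 : 2 / m.+1%:R * \sum_(l < k.-1) `|D (m.+1 + l)| <= r ^+ k / 2 * (M * r ^+ m).
    apply: (@le_trans _ _ (2 / m.+1%:R * (k%:R * (M * r ^+ m)))).
      by apply: ler_wpM2l => //.
    by rewrite [leLHS]mulrA; apply: ler_wpM2r; [rewrite mulr_ge0 // ltW | apply: HN; lia].
  have H3 : 4 * C * r ^+ m <= M * r ^+ k * r ^+ m by apply: ler_wpM2r => //; exact: ltW.
  rewrite exprD; move: H2 H3; set P := 2 / _ * _; set a := r ^+ m; set c := r ^+ k.
  clearbody M P a c; lra.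
(* [q * r ^ n] bounds the sum of all increments from [n] on, so [s n - q * r ^ n] increases and
   [s n + q * r ^ n] decreases; the limit is the supremum of the former. *)
pose q := M / (1 - r).
have q0 : 0 <= q by rewrite divr_ge0 // subr_ge0 ltW.
have qM : q - q * r = M by rewrite -{1}[q]mulr1 -mulrBr mulfVK //; lra.
have up n p : s (n + p) - q * r ^+ (n + p) >= s n - q * r ^+ n.
  elim: p => [|p]; first by rewrite addn0.
  move/le_trans; apply; rewrite addnS exprS.
  have := DM (n + p)%N; rewrite ler_norml /D => /andP[+ _]; rewrite -qM; lra.
have dn n p : s (n + p) + q * r ^+ (n + p) <= s n + q * r ^+ n.
  elim: p => [|p]; first by rewrite addn0.
  move=> H; apply: le_trans H; rewrite addnS exprS.
  have := DM (n + p)%N; rewrite ler_norml /D => /andP[_]; rewrite -qM; lra.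
pose A := [set s n - q * r ^+ n | n in [set: nat]].
have ubA m : ubound A (s m + q * r ^+ m).
  move=> _ [n _ <-].
  apply: le_trans (up n m) _; apply: le_trans (dn m n); rewrite addnC.
  by rewrite lerBlDr -addrA lerDl addr_ge0 // mulr_ge0 // ltW.
have A0 : A !=set0 by exists (s 0%N - q * r ^+ 0), 0%N.
exists (sup A), q => n.
have E : x n - sup A * (n + k)%:R = (s n - sup A) * (n + k)%:R.
  by rewrite xE mulrBl.
rewrite E normrM [`|_%:R|]ger0_norm // mulrAC ler_wpM2r //.
rewrite ler_norml; apply/andP; split.
  by have := ge_sup A0 (ubA n); lra.
have : s n - q * r ^+ n <= sup A.
  by apply: ub_le_sup; [exists (s 0%N + q * r ^+ 0); exact: ubA | exists n].
lra.
Qed.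

End limit.

Lemma avg_rec_geo x b r : avg_rec x b -> 0 < r < 1 -> geo_bounded r b ->
  exists l, geo_bounded (2 * r) (fun n => x n - l * (n + k)%:R).
Proof.
move=> xb r01 [C bC]; have [l [M H]] := avg_rec_cvg xb r01 bC.
exists l, (M * k%:R) => n; apply: le_trans (H n) _.
have M0 : 0 <= M.
  have := H 0%N; rewrite expr0 mulr1 add0n => /(le_trans (normr_ge0 _)).
  by rewrite pmulr_lge0 // ltr0n.
rewrite exprMn mulrA ler_wpM2r ?exprn_ge0 //; first by case/andP: r01 => /ltW.
rewrite -mulrA ler_wpM2l // -natrX -natrM ler_nat.
have := ltn_expl n (erefl : 1 < 2)%N; nia.
Qed.

End averaging_recursion.

(** * The weight [e_] and the generating integrals *)

Section weighted_integral.
Variables (R : realType) (k : nat).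
Hypothesis k_gt0 : (0 < k)%N.
Implicit Types (p q : {poly R}) (y z c : R).
Let mu := @lebesgue_measure R.

(** This is [(1 - X^(k-1)) / (1 - X)], half the logarithmic derivative of [e_]. *)
Definition geo_poly : {poly R} := \sum_(l < k.-1) 'X^l.

Lemma geo_polyE : (1 - 'X) * geo_poly = 1 - 'X^(k.-1).
Proof.
by rewrite -[RHS]opprB subrX1 -mulNr opprB.
Qed.

Let expo : {poly R} := 2 *: \sum_(1 <= l < k) l%:R^-1 *: 'X^l.

Let e_E : e_ k = expR \o horner expo.
Proof.
apply/funext => y; rewrite /e_ /expo /= hornerZ horner_sum; congr (expR (_ * _)).
by apply: eq_bigr => l _; rewrite hornerZ hornerXn mulrC.
Qed.

Let expo_deriv : expo^`() = 2 *: geo_poly.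
Proof.
rewrite derivZ raddf_sum /geo_poly; congr (_ *: _).
rewrite -{1}[1%N]add0n big_addn subn1 big_mkord; apply: eq_bigr => l _.
by rewrite /= derivZ derivXn addn1 /= -['X^l *+ _]scaler_nat scalerA mulVf ?scale1r.
Qed.

Lemma e_gt0 y : 0 < e_ k y.
Proof. exact: expR_gt0. Qed.

Lemma e_0 : e_ k (0 : R) = 1.
Proof.
rewrite /e_ big_nat big1 ?mulr0 ?expR0 // => l /andP[l0 _].
by rewrite expr0n gtn_eqF // mul0r.
Qed.

Lemma continuous_e : continuous (@e_ R k).
Proof.
move=> y; rewrite e_E; apply: continuous_comp; first exact: continuous_horner.
exact: continuous_expR.
Qed.

Lemma e_le1 y : 0 <= y <= 1 -> e_ k y <= e_ k 1.
Proof.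
move=> /andP[y0 y1]; rewrite ler_expR ler_wpM2l // ler_sum // => l _.
by rewrite ler_wpM2r ?invr_ge0 // lerXn2r ?nnegrE.
Qed.

(** Chosen so that [(p * e_)' = weighted_adj p * e_]: a polynomial identity for [weighted_adj]
    becomes, by integration, an identity for [wint]. *)
Definition weighted_adj p := p^`() + (geo_poly * p) *+ 2.

Lemma is_derive_horner p y : is_derive y 1 (horner p) (p^`()).[y].
Proof.
apply: DeriveDef; first exact: derivable_horner.
by rewrite derivE derive1E.
Qed.

Lemma is_derive_adj p y :
  is_derive y 1 (fun t => p.[t] * e_ k t) ((weighted_adj p).[y] * e_ k y).
Proof.
have de : is_derive y 1 (@e_ R k) (2 * geo_poly.[y] * e_ k y).
  rewrite e_E; have dh := is_derive_horner expo y.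
  have := is_derive1_comp (is_derive_expR (horner expo y)) dh.
  move/is_derive_eq; apply; rewrite expo_deriv hornerZ.
  by rewrite -mulrC.
have := is_deriveM (is_derive_horner p y) de.
move/is_derive_eq; apply.
by rewrite /weighted_adj hornerD hornerMn hornerM /GRing.scale /= -mulr_natr; ring.
Qed.

Lemma continuous_poly_e p : continuous (fun y => p.[y] * e_ k y).
Proof. by move=> y; apply: cvgM; [exact: continuous_horner | exact: continuous_e]. Qed.

Lemma integrable_cont (f : R -> R) z : continuous f ->
  mu.-integrable `[0, z] (EFin \o f).
Proof.
move=> cf; apply: continuous_compact_integrable; first exact: segment_compact.
by apply: continuous_subspaceT => y; exact: cf.
Qed.

Definition wint z p := \int[mu]_(y in `[0, z]) (p.[y] * e_ k y).

Lemma wintD z p q : wint z (p + q) = wint z p + wint z q.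
Proof.
rewrite /wint -RintegralD //; try exact/integrable_cont/continuous_poly_e.
by apply: eq_Rintegral => y _; rewrite hornerD mulrDl.
Qed.

Lemma wintZ z c p : wint z (c *: p) = c * wint z p.
Proof.
rewrite /wint -RintegralZl //; last exact/integrable_cont/continuous_poly_e.
by apply: eq_Rintegral => y _; rewrite hornerZ mulrA.
Qed.

Lemma wintN z p : wint z (- p) = - wint z p.
Proof. by rewrite -scaleN1r wintZ mulN1r. Qed.

Lemma wintB z p q : wint z (p - q) = wint z p - wint z q.
Proof. by rewrite wintD wintN. Qed.

Lemma wint0 z : wint z 0 = 0.
Proof. by rewrite -(scale0r 0) wintZ mul0r. Qed.

Lemma wint_sum z I (r : seq I) (P : pred I) (F : I -> {poly R}) :
  wint z (\sum_(i <- r | P i) F i) = \sum_(i <- r | P i) wint z (F i).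
Proof. by elim/big_rec2: _ => [|i a b _ <-]; rewrite ?wint0 ?wintD. Qed.

Lemma wint_adj z p : 0 <= z -> wint z (weighted_adj p) = p.[z] * e_ k z - p.[0].
Proof.
rewrite le_eqVlt => /predU1P[<-|z0].
  by rewrite /wint set_itv1 Rintegral_set1 e_0 mulr1 subrr.
have cp : continuous (fun y => p.[y] * e_ k y) by exact: continuous_poly_e.
have := @continuous_FTC2 R (fun y => (weighted_adj p).[y] * e_ k y) (fun y => p.[y] * e_ k y) 0 z z0.
rewrite /wint /Rintegral => -> //.
- by rewrite /= e_0 mulr1.
- by apply: continuous_subspaceT => y; exact: continuous_poly_e.
- split => [x _||]; [|exact: cvg_at_right_filter (cp 0)|exact: cvg_at_left_filter (cp z)].
  by case: (is_derive_adj p x).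
- by move=> x _; rewrite derive1E; have [_ ->] := is_derive_adj p x.
Qed.

Lemma wint_le z p c : 0 <= z <= 1 -> (forall y, 0 <= y <= z -> `|p.[y]| <= c) ->
  `|wint z p| <= c * e_ k 1.
Proof.
move=> /andP[z0 z1] H; have c0 : 0 <= c by apply: le_trans (H 0 _); rewrite ?lexx.
apply: le_trans (le_normr_Rintegral _ _) _ => //.
  exact/integrable_cont/continuous_poly_e.
apply: (@le_trans _ _ (\int[mu]_(y in `[0, z]) (c * e_ k 1))).
  apply: le_Rintegral => //.
  - apply: integrable_cont => y; apply: cvg_norm; exact: continuous_poly_e.
  - by apply: integrable_cont => y; exact: cvg_cst.
  move=> y /=; rewrite in_itv /= => /andP[y0 yz].
  rewrite normrM [`|e_ k y|]gtr0_norm ?e_gt0 // ler_pM // ?H ?y0 //; first exact/ltW/e_gt0.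
  by apply: e_le1; rewrite y0 (le_trans yz).
rewrite Rintegral_cst // [X in fine X]lebesgue_measure_itv /= lte_fin oppr0 adde0.
case: ifP => _ /=; last by rewrite mulr0 mulr_ge0 // ltW // e_gt0.
by rewrite ler_piMr // mulr_ge0 // ltW // e_gt0.
Qed.

End weighted_integral.

(** * Truncated differential equations as polynomial identities *)

Section polynomial_identities.
Variables (R : realType) (k : nat).
Hypothesis k_gt0 : (0 < k)%N.
Implicit Types (x b : nat -> R).
Local Notation adj := (@weighted_adj R k).
Local Notation geo := (@geo_poly R k).

Lemma onem_poly_neq0 : (1 - 'X : {poly R}) != 0.
Proof.
rewrite subr_eq0; apply/eqP => /(congr1 (size \o polyseq)) /=.
by rewrite size_poly1 size_polyX.
Qed.

(** Clears the denominator hidden in [geo_poly]; several identities for [adj] are checked after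
    multiplication by [1 - X], which is then cancelled. *)
Lemma adj_onemM (p : {poly R}) :
  (1 - 'X) * adj p = (1 - 'X) * p^`() + ((1 - 'X^(k.-1)) * p) *+ 2.
Proof. by rewrite /weighted_adj mulrDr -geo_polyE; ring. Qed.

Lemma adjD (p q : {poly R}) : adj (p + q) = adj p + adj q.
Proof. by rewrite /weighted_adj derivD; ring. Qed.

Lemma adjZ c (p : {poly R}) : adj (c *: p) = c *: adj p.
Proof. by rewrite /weighted_adj derivZ -!mul_polyC; ring. Qed.

Lemma adj_monomial M :
  adj ((1 - 'X) ^+ 2 * 'X^(M.+1)) =
  (1 - 'X) * (M.+1%:R * (1 - 'X) * 'X^M - 2 * 'X^(M + k)).
Proof.
apply: (mulfI onem_poly_neq0); rewrite adj_onemM.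
rewrite derivM expr2 derivM derivB derivX derivXn derivC sub0r /=.
rewrite (_ : M + k = k.-1 + M.+1)%N; last by lia.
by rewrite exprD exprS; ring.
Qed.

(** Let F be the generating function with coefficient x_(m+k) at z^(m+1), B that of b, and A the
    initial part. The recursion says F' = 2 (A + z^(k-1) F) / (1 - z) + B, with integrating factor
    (1 - z)^2 e(z). This is the truncation of that equation; the two subtracted terms depending on
    [M] are its boundary terms. *)
Lemma adj_avg_rec x b M : avg_rec k x b ->
  adj ((1 - 'X) ^+ 2 * \sum_(m < M) x (m + k)%N *: 'X^(m.+1)) =
  (1 - 'X) * (2 * \sum_(a < k) x a *: 'X^a
              - 2 * \sum_(l < k) x (M + l)%N *: 'X^(M + l)
              - (2 * \sum_(a < M) x a) *: 'X^M
              + (1 - 'X) * \sum_(m < M) b m *: 'X^m).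
Proof.
move=> xb; elim: M => [|M IH].
  by rewrite !big_ord0 !mulr0 /weighted_adj deriv0 mulr0 mul0rn scale0r subr0 !addr0 subrr mulr0.
rewrite !big_ord_recr /= mulrDr adjD IH -scalerAr adjZ adj_monomial.
have tele : \sum_(l < k) x (M.+1 + l)%N *: 'X^(M.+1 + l) =
    \sum_(l < k) x (M + l)%N *: 'X^(M + l) - x M *: 'X^M + x (M + k)%N *: 'X^(M + k) :> {poly R}.
  elim: (k) => [|K IHK]; first by rewrite !big_ord0 addn0; ring.
  by rewrite !big_ord_recr /= IHK addSnnS; ring.
rewrite tele; have := congr1 polyC (xb M); rewrite big_ord_recr /=.
rewrite -!mul_polyC !(polyCM, polyCD) exprS.
set A := \sum_(i < k) _ *: 'X^_; set B := \sum_(i < k) _ *: 'X^(_ + _).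
set S := (\sum_(i < M) x i)%:P; set T := \sum_(i < M) b i *: _.
move=> E; apply/eqP; rewrite -subr_eq0; apply/eqP.
transitivity ((M.+1%:R * (x (M + k)%N)%:P - (2%:R * (S + (x M)%:P) + (b M)%:P)) * (1 - 'X) ^+ 2 * 'X^M).
  ring.
by rewrite polyC_natr in E; rewrite E subrr !mul0r.
Qed.

Lemma sum_affine_geo M :
  (1 - 'X) ^+ 2 * \sum_(a < M) (a + k)%:R *: 'X^a =
  k%:R * (1 - 'X) + 'X - 'X^M * ((k + M)%:R * (1 - 'X) + 'X) :> {poly R}.
Proof.
elim: M => [|M IH]; first by rewrite big_ord0 mulr0 addn0 expr0 mul1r subrr.
rewrite big_ord_recr /= mulrDr IH scaler_nat ['X^(M.+1)]exprS.
ring.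
Qed.

(** The counterpart for the exact solution [n + k], summable in closed form; it evaluates the
    integral that multiplies the unknown slope [l]. *)
Lemma adj_affine :
  adj ('X * (2 * k%:R * (1 - 'X) + 'X)) =
  2 * (1 - 'X) * \sum_(a < k) (a + k)%:R *: 'X^a.
Proof.
apply: (mulfI onem_poly_neq0); rewrite adj_onemM.
transitivity (2 * ((1 - 'X) ^+ 2 * \sum_(a < k) (a + k)%:R *: 'X^a : {poly R})); last by ring.
rewrite sum_affine_geo.
have -> : 2 * k%:R = (2 * k%:R)%:P :> {poly R} by rewrite polyCM !polyC_natr.
rewrite !(derivM, derivD, derivN, derivX, derivC) polyCM !polyC_natr.
have -> : 'X^k = 'X * 'X^(k.-1) :> {poly R} by rewrite -exprS prednK.
rewrite natrD.
ring.
Qed.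

Lemma adj_monomial1 n :
  adj ('X * (1 - 'X) * 'X^n) =
  (n.+1%:R * (1 - 'X) + 'X - 2 * 'X^k) * 'X^n.
Proof.
apply: (mulfI onem_poly_neq0); rewrite adj_onemM.
rewrite !(derivM, derivD, derivN, derivX, derivC, derivXn).
have -> : 'X^k = 'X * 'X^(k.-1) :> {poly R} by rewrite -exprS prednK.
case: n => [|n]; first by rewrite expr0; ring.
by rewrite /= exprS; ring.
Qed.

(** Serves to integrate the generating function of [x] against [k (1 - X) + X], the numerator of
    that of [n + k]. The argument of [adj] vanishes at 0 and at 1, so integration over [0, 1] leaves
    only initial values and boundary terms. *)
Lemma avg_rec_moment x M : avg_rec k x (fun=> 0) ->
  \sum_(n < M) x n *: ((k%:R * (1 - 'X) + 'X) * 'X^n) =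
  adj ('X * (1 - 'X) * \sum_(n < M) x n *: 'X^n)
  + (1 - 'X) * \sum_(n < k) ((k%:R - 1 - n%:R) * x n) *: 'X^n
  + (1 - 'X) * \sum_(l < k) (((M + l)%:R + 1 - k%:R) * x (M + l)%N) *: 'X^(M + l)
  + (2 * \sum_(a < M) x a) *: 'X^(M + k).
Proof.
move=> xb; elim: M => [|M IH].
  rewrite !big_ord0 !mulr0 /weighted_adj deriv0 mulr0 mul0rn scale0r !add0r addr0.
  rewrite -mulrDr -big_split /= big1 ?mulr0 // => l _.
  by rewrite add0n -scalerDl -mulrDl (_ : _ - _ + _ = 0) ?mul0r ?scale0r //; ring.
rewrite big_ord_recr /= IH [\sum_(n < M.+1) x n *: 'X^n]big_ord_recr /=.
rewrite [in RHS](mulrDr ('X * (1 - 'X))) adjD -scalerAr adjZ adj_monomial1.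
rewrite [\sum_(a < M.+1) x a]big_ord_recr /=.
pose f n : {poly R} := ((n%:R + 1 - k%:R) * x n) *: 'X^n.
have tele : \sum_(l < k) f (M.+1 + l)%N = \sum_(l < k) f (M + l)%N - f M + f (M + k)%N.
  elim: (k) => [|K IHK]; first by rewrite !big_ord0 addn0; ring.
  by rewrite !big_ord_recr /= IHK addSnnS; ring.
rewrite -[\sum_(l < k) _ *: 'X^(M.+1 + l)]/(\sum_(l < k) f (M.+1 + l)%N) tele /f.
have := congr1 polyC (xb M); rewrite big_ord_recr /= addr0.
rewrite -!mul_polyC !(polyCM, polyCD, polyCN, polyC_natr) addSn [in X in _ -> X]exprS.
set A := \sum_(i < k) (_ * _) *: 'X^_; set B := \sum_(i < k) _.
set S := (\sum_(i < M) x i)%:P; set T := weighted_adj _ _.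
set y := (x (M + k)%N)%:P; set u := (x M)%:P.
rewrite exprD natrD => E; apply/eqP; rewrite -subr_eq0; apply/eqP.
transitivity ((2 * (S + u) - M.+1%:R * y) * (1 - 'X) * 'X^M * 'X^k).
  ring.
by rewrite E subrr !mul0r.
Qed.

(** The coefficient [(k + n) (3 k - 2 - n)] is the opposite of
    [- (n + k)^2 - 2 (k - 1 - n) (n + k)], which is what the initial values contribute to the factor
    of [theta i * theta j] in [sigma_limit]. *)
Lemma sum_cubic_geo N :
  (1 - 'X) ^+ 3 * \sum_(n < N) ((k + n)%:R * (3 * k%:R - 2 - n%:R)) *: 'X^n =
  (k%:R * (3 * k%:R - 2) * (1 - 'X) ^+ 2 + (2 * k%:R - 2) * 'X * (1 - 'X)
    - 'X * (1 + 'X))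
  - 'X^N * ((k + N)%:R * (3 * k%:R - 2 - N%:R) * (1 - 'X) ^+ 2
    + (2 * k%:R - 2 - 2 * N%:R) * 'X * (1 - 'X) - 'X * (1 + 'X)) :> {poly R}.
Proof.
elim: N => [|N IH]; first by rewrite big_ord0 mulr0 addn0 expr0; ring.
rewrite big_ord_recr /= mulrDr IH -mul_polyC ['X^(N.+1)]exprS.
rewrite !(polyCM, polyCD, polyCN, polyC_natr) !natrD.
ring.
Qed.

Definition bracket_poly : {poly R} :=
  3 + (4 * k%:R - 5) * (1 - 'X) + 2 * (k%:R - 1) ^+ 2 * (1 - 'X) ^+ 2
       - 2 * k%:R ^+ 2 * (1 - 'X) ^+ 4
     - (2 + (4 * k%:R - 3) * (1 - 'X) + (2 * k%:R - 1) ^+ 2 * (1 - 'X) ^+ 2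
          - 4 * k%:R ^+ 2 * (1 - 'X) ^+ 3) * 'X^k.

(* Obtained by undetermined coefficients so that [reduced_polyE] holds, the sum
   in [reduced_poly] being what the initial values contribute. *)
Definition primitive_poly : {poly R} :=
  - 'X * ((2 * k%:R - 1) + (2 * k%:R - 1) ^+ 2 * (1 - 'X)
          - 2 * k%:R ^+ 2 * (1 - 'X) ^+ 2).

Definition reduced_poly : {poly R} :=
  adj primitive_poly
  + (1 - 'X) * \sum_(n < k) ((k + n)%:R * (3 * k%:R - 2 - n%:R)) *: 'X^n.

(** Explains why the singularity of [H_] at 1 is removable: expanding the product in [H_] about the
    polar parts [theta * (k (1 - z) + z) / (1 - z)^2] leaves this right-hand side over [(1 - z)^2],
    which is therefore a polynomial. *)
Lemma reduced_polyE :
  (1 - 'X) ^+ 2 * reduced_poly = (k%:R * (1 - 'X) + 'X) ^+ 2 - bracket_poly.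
Proof.
rewrite /reduced_poly mulrDr [X in _ + X]mulrA -exprSr sum_cubic_geo.
rewrite expr2 -[(1 - 'X) * _ * _]mulrA adj_onemM /bracket_poly.
have dP : primitive_poly^`() = - ((2 * k%:R - 1) + (2 * k%:R - 1) ^+ 2 * (1 - 'X)
          - 2 * k%:R ^+ 2 * (1 - 'X) ^+ 2)
     - 'X * (- (2 * k%:R - 1) ^+ 2 + 4 * k%:R ^+ 2 * (1 - 'X)).
  rewrite /primitive_poly.
  have -> : k%:R = (k%:R)%:P :> {poly R} by rewrite polyC_natr.
  have -> : 2 = 2%:P :> {poly R} by rewrite polyC_natr.
  rewrite !expr2 !(derivM, derivD, derivN, derivX, derivC).
  ring.
rewrite dP /primitive_poly.
have -> : 'X^k = 'X * 'X^(k.-1) :> {poly R} by rewrite -exprS prednK.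
rewrite natrD.
ring.
Qed.

End polynomial_identities.

(** * Calculus of geometric bounds *)

Section geometric_calculus.
Variable R : realType.
Implicit Types (x y : nat -> R) (r c : R).

Lemma geo_bounded_nonneg r x : geo_bounded r x ->
  exists2 C, 0 <= C & forall n, `|x n| <= C * r ^+ n.
Proof.
move=> [C H]; exists C => //.
by have := H 0%N; rewrite expr0 mulr1; apply: le_trans.
Qed.

Lemma geo_boundedD r x y : geo_bounded r x -> geo_bounded r y ->
  geo_bounded r (fun n => x n + y n).
Proof.
move=> [C HC] [C' HC']; exists (C + C') => n.
by rewrite mulrDl; apply: le_trans (ler_normD _ _) _; rewrite lerD.
Qed.

Lemma geo_boundedZ r c x : geo_bounded r x -> geo_bounded r (fun n => c * x n).
Proof.
move=> [C HC]; exists (`|c| * C) => n.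
by rewrite normrM -mulrA ler_wpM2l.
Qed.

Lemma geo_boundedB r x y : geo_bounded r x -> geo_bounded r y ->
  geo_bounded r (fun n => x n - y n).
Proof.
move=> Hx /(geo_boundedZ (-1)) Hy; have := geo_boundedD Hx Hy.
by congr geo_bounded; apply/funext => n; rewrite mulN1r.
Qed.

Lemma geo_bounded_shift r m x : 0 <= r -> geo_bounded r x ->
  geo_bounded r (fun n => x (n + m)%N).
Proof.
move=> r0 [C HC]; exists (C * r ^+ m) => n.
by apply: le_trans (HC _) _; rewrite exprD; lra.
Qed.

Lemma geo_bounded_unshift r x : 0 < r -> geo_bounded r (fun n => x n.+1) ->
  geo_bounded r x.
Proof.
move=> r0 /geo_bounded_nonneg[C C0 HC]; exists (C / r + `|x 0%N|) => -[|n].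
  by rewrite expr0 mulr1 lerDr divr_ge0 // ltW.
apply: le_trans (HC n) _; rewrite mulrDl exprS.
rewrite mulrA mulfVK ?gt_eqF // lerDl mulr_ge0 // mulr_ge0 ?exprn_ge0 // ltW //.
Qed.

Lemma geo_bounded_natmul r x : 0 <= r -> geo_bounded r x ->
  geo_bounded (2 * r) (fun n => n.+1%:R * x n).
Proof.
move=> r0 /geo_bounded_nonneg[C C0 HC]; exists C => n.
rewrite normrM normr_nat exprMn mulrCA ler_pM // succ_le_pow2 //.
Qed.

Lemma geo_bounded_sum r q (F : 'I_q -> nat -> R) :
  (forall l, geo_bounded r (F l)) -> geo_bounded r (fun n => \sum_(l < q) F l n).
Proof.
move=> H; elim: q F H => [|q IH] F H.
  by exists 0 => n; rewrite big_ord0 normr0 mul0r.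
have := geo_boundedD (IH (fun l => F (widen_ord (leqnSn q) l)) (fun l => H _)) (H ord_max).
by congr geo_bounded; apply/funext => n; rewrite big_ord_recr.
Qed.

Lemma geo_bounded_cvg0 r x : 0 <= r < 1 -> geo_bounded r x -> x @ \oo --> 0.
Proof.
move=> /andP[r0 r1] [C HC]; apply/cvgr0Pnorm_lt => eps eps0.
have : (fun n => C * r ^+ n) @ \oo --> (0 : R).
  rewrite -[0](mulr0 C); apply: cvgM; first exact: cvg_cst.
  by apply: cvg_expr; rewrite ger0_norm.
move/cvgr0Pnorm_lt => /(_ _ eps0); apply: filterS => n.
by apply: le_lt_trans; apply: le_trans (HC n) _; exact: ler_norm.
Qed.

(** The constant depends on [x] alone, so that it bounds the truncated generating functions
    uniformly in their argument. *)
Lemma geo_bounded_tail r x : 0 <= r < 1 -> geo_bounded r x ->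
  exists2 C, 0 <= C & forall y M M', (forall n, `|y n| <= 1) -> (M <= M')%N ->
    `|\sum_(n < M') x n * y n - \sum_(n < M) x n * y n| <= C * r ^+ M.
Proof.
move=> /andP[r0 r1] /geo_bounded_nonneg[C C0 HC].
exists (C / (1 - r)); first by rewrite divr_ge0 // subr_ge0 ltW.
move=> y M M' y1 MM'.
have [q ->] : exists q, M' = (M + q)%N by exists (M' - M)%N; lia.
suff : `|\sum_(n < M + q) x n * y n - \sum_(n < M) x n * y n| <=
    C / (1 - r) * (r ^+ M - r ^+ (M + q)).
  move/le_trans; apply; rewrite ler_wpM2l ?divr_ge0 ?subr_ge0 ?(ltW r1) //.
  by rewrite gerBl exprn_ge0.
elim: q => [|q IH]; first by rewrite addn0 !subrr normr0 mulr0.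
rewrite addnS big_ord_recr /= addrAC; apply: le_trans (ler_normD _ _) _.
apply: le_trans (lerD IH (_ : _ <= C * r ^+ (M + q))) _.
  by rewrite normrM -[leRHS]mulr1 ler_pM.
rewrite exprS -[X in _ + X](@mulfVK _ (1 - r)) ?subr_eq0 ?gt_eqF //.
by rewrite le_eqVlt; apply/orP; left; apply/eqP; ring.
Qed.

End geometric_calculus.

(** * Solution of the recursions and the limit of the means *)

Section limits.
Variables (R : realType) (k : nat).
Hypothesis k_gt0 : (0 < k)%N.
Implicit Types (x b : nat -> R) (r z : R).
Local Notation wint := (@wint R k).
Local Notation e := (@e_ R k).

Lemma wint_lin z (p : {poly R}) I (r : seq I) (c : I -> R) (q : I -> {poly R}) :
  wint z (p * \sum_(i <- r) c i *: q i) = \sum_(i <- r) c i * wint z (p * q i).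
Proof.
rewrite mulr_sumr wint_sum; apply: eq_bigr => i _.
by rewrite -scalerAr wintZ.
Qed.

Lemma avg_rec_affine l : avg_rec k (fun n => l * (n + k)%:R : R) (fun=> 0).
Proof.
move=> m; rewrite addr0 -mulr_sumr.
suff -> : \sum_(a < m.+1) (a + k)%:R = m.+1%:R * (m + k + k)%:R / 2 :> R by field.
elim: m => [|m IH]; first by rewrite big_ord1 !add0n natrD; field.
by rewrite big_ord_recr /= IH !natrD -!natr1; field.
Qed.

Lemma avg_recB x y b c : avg_rec k x b -> avg_rec k y c ->
  avg_rec k (fun n => x n - y n) (fun n => b n - c n).
Proof. by move=> Hx Hy m; rewrite sumrB !mulrBr Hx Hy; ring. Qed.

(** The recursion itself expresses the partial sum as [((m + 1) x_(m+k) - b_m) / 2]; hence it tends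
    to 0 and not merely to some limit. *)
Lemma avg_rec_geo_sum x b r : avg_rec k x b -> 0 < r < 1 -> geo_bounded r x ->
  geo_bounded r b -> geo_bounded (2 * r) (fun M => \sum_(a < M) x a).
Proof.
move=> xb /andP[r0 r1] gx gb; apply: geo_bounded_unshift; first by rewrite mulr_gt0.
have := geo_boundedZ 2^-1 (geo_boundedB
  (geo_bounded_natmul (ltW r0) (geo_bounded_shift k (ltW r0) gx))
  (@geo_boundedW _ r (2 * r) _ _ gb)).
move/(_ ltac:(rewrite (ltW r0); lra)).
congr geo_bounded; apply/funext => m; rewrite xb addrK mulKf //.
Qed.

(** [adj_avg_rec] integrated over [0, z], with the boundary terms [B] tending to 0; the bound 1/2 on
    the rate leaves room for the doubling in [avg_rec_geo_sum]. The case [z = 1] is included on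
    purpose: there [(1 - z)^2] vanishes and a linear relation between initial values and [b]
    remains. *)
Lemma avg_rec_wint x b r z : avg_rec k x b -> 0 < r < 2^-1 ->
  geo_bounded r x -> geo_bounded r b -> 0 <= z <= 1 ->
  (fun M => (1 - z) ^+ 2 * (\sum_(m < M) x (m + k)%N * z ^+ m.+1) * e z
            - \sum_(m < M) b m * wint z ((1 - 'X) ^+ 2 * 'X^m)) @ \oo -->
  2 * wint z ((1 - 'X) * \sum_(a < k) x a *: 'X^a).
Proof.
move=> xb /andP[r0 r1] gx gb z01; have /andP[z0 z1] := z01.
apply/subr_cvg0.
pose B M := 2 * \sum_(l < k) x (M + l)%N * wint z ((1 - 'X) * 'X^(M + l))
  + (2 * \sum_(a < M) x a) * wint z ((1 - 'X) * 'X^M).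
have BE M : (1 - z) ^+ 2 * (\sum_(m < M) x (m + k)%N * z ^+ m.+1) * e z
    - \sum_(m < M) b m * wint z ((1 - 'X) ^+ 2 * 'X^m)
    - 2 * wint z ((1 - 'X) * \sum_(a < k) x a *: 'X^a) = - B M.
  have := congr1 (wint z) (adj_avg_rec k_gt0 M xb); rewrite wint_adj //.
  set A := \sum_(a < k) _ *: _; set B' := \sum_(l < k) _ *: _.
  set S := 2 * \sum_(a < M) x a; set T := \sum_(m < M) b m *: _.
  have -> : (1 - 'X) * (2 * A - 2 * B' - S *: 'X^M + (1 - 'X) * T) =
      2 *: ((1 - 'X) * A) - 2 *: ((1 - 'X) * B') - S *: ((1 - 'X) * 'X^M)
      + (1 - 'X) ^+ 2 * T.
    by rewrite -!mul_polyC polyC_natr; ring.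
  rewrite wintD !wintB !wintZ !wint_lin /B.
  rewrite !hornerM !horner_sum [X in _ - _ * X]big1; last first.
    by move=> m _; rewrite hornerZ hornerXn expr0n mulr0.
  rewrite mulr0 subr0 hornerD hornerN hornerC hornerX.
  under eq_bigr do rewrite hornerZ hornerXn.
  by move=> ->; rewrite -/S; ring.
under eq_fun do rewrite BE.
have r01 : 0 <= r < 1 by rewrite (ltW r0); lra.
have r2 : 0 <= 2 * r < 1 by rewrite mulr_ge0 ?(ltW r0) //; lra.
have w1 M : `|wint z ((1 - 'X) * 'X^M)| <= 1 * e 1.
  apply: wint_le => // y /andP[y0 yz].
  rewrite hornerM hornerD hornerN hornerC hornerX hornerXn normrM.
  have y1 : y <= 1 by apply: le_trans yz z1.
  rewrite -[leRHS]mulr1 ler_pM // ger0_norm ?exprn_ge0 ?subr_ge0 // ?exprn_ile1 //.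
  by rewrite gerBl.
suff : geo_bounded (2 * r) B.
  by move=> /(geo_boundedZ (-1)) /(geo_bounded_cvg0 r2); under eq_fun do rewrite mulN1r.
have geoM (u w : nat -> R) c q : geo_bounded q u -> (forall n, `|w n| <= c) ->
    geo_bounded q (fun n => u n * w n).
  move=> /geo_bounded_nonneg[C C0 HC] Hw; exists (C * c) => n.
  rewrite normrM mulrAC; apply: ler_pM => //; exact: HC.
apply: geo_boundedD.
  apply/geo_boundedZ/geo_bounded_sum => l.
  apply: (geoM _ _ _ _ _ (fun n => w1 (n + l)%N)).
  apply: (@geo_boundedW _ r); first by rewrite (ltW r0); lra.
  exact/geo_bounded_shift/gx/ltW.
apply: (geoM _ _ _ _ _ w1); apply: geo_boundedZ.
apply: avg_rec_geo_sum xb _ gx gb; rewrite r0; lra.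
Qed.

Lemma wint_affine z : 0 <= z ->
  2 * wint z ((1 - 'X) * \sum_(a < k) (a + k)%:R *: 'X^a) =
  z * (2 * k%:R * (1 - z) + z) * e z.
Proof.
move=> z0; rewrite -wintZ -[_ *: (_ * _)]mul_polyC polyC_natr mulrA -adj_affine // wint_adj //.
rewrite -!polyC_natr !(hornerM, hornerD, hornerN, hornerC, hornerX); ring.
Qed.

Lemma thetaE j : theta R k j * e 1 = 2 * wint 1 ((1 - 'X) * 'X^j).
Proof.
rewrite /theta mulrAC mulfVK ?gt_eqF ?e_gt0 //; congr (_ * _).
by apply: eq_Rintegral => y _; rewrite hornerM hornerD hornerN hornerC hornerX hornerXn.
Qed.

Lemma G_E j z : z < 1 ->
  G_ k j z * ((1 - z) ^+ 2 * e z) = 2 * wint z ((1 - 'X) * 'X^j).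
Proof.
move=> z1; have -> : wint z ((1 - 'X) * 'X^j) =
    \int[@lebesgue_measure R]_(y in `[0, z]) (y ^+ j * (1 - y) * e y).
  apply: eq_Rintegral => y _.
  by rewrite hornerM hornerD hornerN hornerC hornerX hornerXn [X in X * e _]mulrC.
rewrite /G_; set I := Rintegral _ _ _.
have w0 : 1 - z != 0 by rewrite subr_eq0 gt_eqF.
have e0 : e z != 0 by rewrite gt_eqF // e_gt0.
by field; rewrite w0 e0.
Qed.

Section mean_sequence.
Variables (x : nat -> R) (j : nat) (l r : R).
Hypothesis xb : avg_rec k x (fun=> 0).
Hypothesis jk : (j < k)%N.
Hypothesis x_small : forall a, (a < k)%N -> x a = (a == j)%:R.
Hypothesis r0 : 0 < r < 2^-1.
Let d n := x n - l * (n + k)%:R.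
Hypothesis gd : geo_bounded r d.

Let d_rec : avg_rec k d (fun=> 0).
Proof.
have := avg_recB xb (avg_rec_affine l).
by congr avg_rec; apply/funext => m; rewrite subrr.
Qed.

Let sum_init (p : {poly R}) : p * \sum_(a < k) x a *: 'X^a = p * 'X^j.
Proof.
congr (_ * _); rewrite (bigD1 (Ordinal jk)) //= x_small // eqxx scale1r.
rewrite big1 ?addr0 // => a /negbTE.
by rewrite x_small // -val_eqE /= => ->; rewrite scale0r.
Qed.

Let gen_cvg z : 0 <= z <= 1 ->
  (fun M => (1 - z) ^+ 2 * (\sum_(m < M) d (m + k)%N * z ^+ m.+1) * e z) @ \oo -->
  2 * wint z ((1 - 'X) * 'X^j) - l * (z * (2 * k%:R * (1 - z) + z) * e z).
Proof.
move=> z01; have g0 : geo_bounded r (fun=> 0 : R).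
  by exists 0 => n; rewrite normr0 mul0r.
have := avg_rec_wint d_rec r0 gd g0 z01.
have Z M : \sum_(m < M) 0 * wint z ((1 - 'X) ^+ 2 * 'X^m) = 0.
  by rewrite big1 // => m _; rewrite mul0r.
under eq_fun do rewrite Z subr0.
suff -> : 2 * wint z ((1 - 'X) * \sum_(a < k) d a *: 'X^a) =
  2 * wint z ((1 - 'X) * 'X^j) - l * (z * (2 * k%:R * (1 - z) + z) * e z) by [].
rewrite -wint_affine; last by case/andP: z01.
rewrite -sum_init !wint_lin mulrCA -mulrBr; congr (_ * _).
rewrite mulr_sumr -sumrB; apply: eq_bigr => a _.
by rewrite /d mulrBl mulrA.
Qed.

(** At [z = 1] the factor [(1 - z)^2] annihilates the generating function, so the right-hand side of
    [gen_cvg] must vanish, which is an equation for [l]. *)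
Lemma mean_limit : l = theta R k j.
Proof.
have z01 : 0 <= (1 : R) <= 1 by rewrite ler01 lexx.
have := gen_cvg z01; rewrite subrr expr0n /=.
under eq_fun do rewrite mul0r mul0r.
move=> H; have := cvg_unique _ H (cvg_cst (0 : R)); move/(_ (@norm_hausdorff _ R^o) _ _).
rewrite mulr0 add0r !mul1r -thetaE -mulrBl => /eqP.
by rewrite mulf_eq0 [e 1 == 0]gt_eqF ?e_gt0 // orbF subr_eq0 => /eqP.
Qed.

(** For [z < 1] the relation [gen_cvg] can be divided by [(1 - z)^2 e_ z], which produces [G_]. The
    subtracted term is [theta] times the generating function of [n + k]. *)
Lemma mean_generating z : 0 <= z < 1 ->
  (fun M => \sum_(n < M) d n * z ^+ n) @ \oo -->
  z ^+ j + z ^+ k.-1 * G_ k j z - theta R k j * (k%:R * (1 - z) + z) / (1 - z) ^+ 2.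
Proof.
move=> /andP[z0 z1]; have z01 : 0 <= z <= 1 by rewrite z0 ltW.
have w0 : 1 - z != 0 by rewrite subr_eq0 gt_eqF.
have e0 : e z != 0 by rewrite gt_eqF // e_gt0.
rewrite -(cvg_shiftn k).
have H := gen_cvg z01.
(* The sum in [gen_cvg] pairs [d (m + k)] with [z ^ (m + 1)], hence the factor [z ^ (k - 1)]. *)
pose c := (1 - z) ^- 2 * (e z)^-1 * z ^+ k.-1.
pose q := \sum_(a < k) d a * z ^+ a.
have cc : (fun M => q + c * ((1 - z) ^+ 2 * (\sum_(m < M) d (m + k)%N * z ^+ m.+1) * e z)) @ \oo -->
    q + c * (2 * wint z ((1 - 'X) * 'X^j) - l * (z * (2 * k%:R * (1 - z) + z) * e z)).
  by apply: cvgD; [exact: cvg_cst | apply: cvgM; [exact: cvg_cst | exact: H]].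
have -> : (fun M => \sum_(n < M + k) d n * z ^+ n) =
    (fun M => q + c * ((1 - z) ^+ 2 * (\sum_(m < M) d (m + k)%N * z ^+ m.+1) * e z)).
  apply/funext => M /=; rewrite addnC big_split_ord /=; congr (_ + _).
  rewrite /c.
  have -> : forall s, (1 - z) ^- 2 / e z * z ^+ k.-1 * ((1 - z) ^+ 2 * s * e z) = z ^+ k.-1 * s.
    by move=> s; field; rewrite e0 w0.
  rewrite mulr_sumr; apply: eq_bigr => m _; rewrite mulrCA addnC -exprD.
  by congr (_ * _ ^+ _); lia.
suff -> : z ^+ j + z ^+ k.-1 * G_ k j z - theta R k j * (k%:R * (1 - z) + z) / (1 - z) ^+ 2 =
   q + c * (2 * wint z ((1 - 'X) * 'X^j) - l * (z * (2 * k%:R * (1 - z) + z) * e z)) by exact: cc.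
rewrite -G_E // -mean_limit.
have -> : q = z ^+ j - l * (k%:R * (1 - z) + z - z ^+ k * ((k + k)%:R * (1 - z) + z)) / (1 - z) ^+ 2.
  have E := congr1 (fun p => p.[z]) (sum_affine_geo R k k).
  have E2 := congr1 (fun p : {poly R} => p.[z]) (sum_init 1).
  move: E E2; rewrite /= !mul1r.
  rewrite !(hornerM, hornerD, hornerN, hornerX, hornerXn, horner_sum) expr2 !(hornerM, hornerD, hornerN, hornerX, hornerC).
  rewrite -!polyC_natr !hornerC.
  under eq_bigr do rewrite hornerZ hornerXn.
  under [in X in _ -> X -> _]eq_bigr do rewrite hornerZ hornerXn.
  move=> E E2; rewrite /q /d.
  under eq_bigr do rewrite mulrBl -mulrA.
  rewrite sumrB -mulr_sumr E2 -E; field; exact: w0.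
rewrite /c; have -> : z ^+ k = z * z ^+ k.-1 by rewrite -exprS prednK.
rewrite natrD; field; rewrite e0 w0 //.
Qed.

End mean_sequence.
End limits.

Lemma triangle_sum (V : nmodType) (f : nat -> nat -> V) M :
  \sum_(m < M) \sum_(a < m.+1) f a (m - a)%N = \sum_(a < M) \sum_(b < M - a) f a b.
Proof.
elim: M => [|M IH]; first by rewrite !big_ord0.
rewrite [LHS]big_ord_recr /= IH [RHS]big_ord_recr /= [in LHS]big_ord_recr /=.
rewrite subSn // subnn big_ord1 addrA -big_split /=; congr (_ + _).
by apply: eq_bigr => a _; rewrite subSn 1?ltnW // big_ord_recr.
Qed.

(** * The covariance formula *)

Section sigma.
Variables (R : realType) (k : nat).
Hypothesis k_gt0 : (0 < k)%N.
Implicit Types (x b : nat -> R) (r z : R).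
Local Notation wint := (@wint R k).
Local Notation e := (@e_ R k).
Let mu := @lebesgue_measure R.

Lemma wint_dominated (P : nat -> {poly R}) (h : R -> R) (c : R) :
  (forall M (y : R), 0 <= y < 1 -> `|(P M).[y]| <= c) ->
  (forall y : R, 0 <= y < 1 -> (fun M => (P M).[y]) @ \oo --> h y) ->
  (fun M => wint 1 (P M)) @ \oo --> \int[mu]_(y in `[0, 1[) (h y * e y).
Proof.
move=> Pc Ph.
have c0 : 0 <= c by apply: le_trans (normr_ge0 _) (Pc 0%N 0 _); rewrite lexx ltr01.
have sub : (`[0, 1[ : set R) `<=` `[0, 1].
  by move=> y /=; rewrite !in_itv /= => /andP[-> /ltW].
have iI (f : R -> R) : continuous f -> mu.-integrable `[0, 1[ (EFin \o f).
  move=> cf; apply: (@integrableS _ _ R (@lebesgue_measure R) `[0, 1]) => //.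
  exact: integrable_cont.
have iP M : mu.-integrable `[0, 1[ (EFin \o (fun y => (P M).[y] * e y)).
  exact/iI/continuous_poly_e.
have iC : mu.-integrable `[0, 1[ (EFin \o cst (c * e 1)).
  by apply: iI => y; exact: cvg_cst.
have fg M (y : R) : `[0, 1[%classic y -> (`|((P M).[y] * e y)%:E| <= (EFin \o cst (c * e 1)%R) y)%E.
  rewrite /= in_itv /= => /andP[y0 y1]; rewrite lee_fin normrM.
  rewrite [`|e y|]gtr0_norm ?e_gt0 // ler_pM ?Pc ?y0 //; first exact/ltW/e_gt0.
  by apply: e_le1; rewrite y0 ltW.
have fc (y : R) : `[0, 1[%classic y -> (fun M => ((P M).[y] * e y)%:E) @ \oo --> (h y * e y)%:E.
  rewrite /= in_itv /= => y01; apply: cvg_EFin; first exact: nearW.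
  by apply: cvgM; [exact: Ph | exact: cvg_cst].
have mP M := measurable_int (@lebesgue_measure R) (iP M).
have m01 : measurable (`[0, 1[%classic : set (measurableTypeR R)) by [].
have mf := emeasurable_fun_cvg _ _ mP fc.
have [I _ H] := dominated_convergence m01 mP mf (aeW (@lebesgue_measure R) fc) iC (aeW (@lebesgue_measure R) (fun y M => @fg M y)).
have -> : (fun M => wint 1 (P M)) = (fun M => fine (\int[mu]_(y in `[0, 1[) ((P M).[y] * e y)%:E)).
  apply/funext => M; rewrite -[LHS]/(\int[mu]_(y in `[0, 1]) ((P M).[y] * e y)).
  by rewrite -Rintegral_itv_bndo_bndc //; exact: iP.
apply: fine_cvg; rewrite fineK; first exact: H.
exact: (integrable_fin_num _ I).
Qed.

Lemma reduced_poly_horner z : 0 <= z < 1 -> (reduced_poly R k).[z] =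
  ((k%:R * (1 - z) + z) ^+ 2 -
   (3 + (4 * k%:R - 5) * (1 - z) + 2 * (k%:R - 1) ^+ 2 * (1 - z) ^+ 2
       - 2 * k%:R ^+ 2 * (1 - z) ^+ 4
     - (2 + (4 * k%:R - 3) * (1 - z) + (2 * k%:R - 1) ^+ 2 * (1 - z) ^+ 2
          - 4 * k%:R ^+ 2 * (1 - z) ^+ 3) * z ^+ k)) / (1 - z) ^+ 2.
Proof.
move=> /andP[z0 z1]; have w0 : 1 - z != 0 by rewrite subr_eq0 gt_eqF.
have := congr1 (fun p : {poly R} => p.[z]) (reduced_polyE R k_gt0).
move: (reduced_poly R k) => q /=; rewrite /bracket_poly -!polyC_natr.
rewrite !(hornerD, hornerM, hornerN, hornerC, hornerX, hornerXn, horner_exp).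
by move=> <-; rewrite mulrC mulKf // expf_neq0.
Qed.

Section covariance.
Variables (x x' v : nat -> R) (i j : nat) (r s : R).
Hypothesis xb : avg_rec k x (fun=> 0).
Hypothesis x'b : avg_rec k x' (fun=> 0).
Hypothesis ik : (i < k)%N.
Hypothesis jk : (j < k)%N.
Hypothesis x_small : forall a, (a < k)%N -> x a = (a == i)%:R.
Hypothesis x'_small : forall a, (a < k)%N -> x' a = (a == j)%:R.
Hypothesis r0 : 0 < r < 4^-1.
Let d n := x n - theta R k i * (n + k)%:R.
Let d' n := x' n - theta R k j * (n + k)%:R.
Hypothesis gd : geo_bounded r d.
Hypothesis gd' : geo_bounded r d'.
Let b m := 2 * \sum_(a < m.+1) d a * d' (m - a)%N.
Hypothesis vb : avg_rec k v b.
Hypothesis v_small : forall a, (a < k)%N -> v a = d a * d' a.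
Hypothesis gv : geo_bounded (2 * r) (fun n => v n - s * (n + k)%:R).

Let th := theta R k i.
Let th' := theta R k j.

Let w n := wint 1 ((1 - 'X) * 'X^n).

Let D M : {poly R} := \sum_(n < M) d n *: 'X^n.
Let D' M : {poly R} := \sum_(n < M) d' n *: 'X^n.

Let rr0 : 0 <= r. Proof. by case/andP: r0 => /ltW. Qed.
Let r2 : 0 < r < 2^-1. Proof. by case/andP: r0 => -> /=; lra. Qed.
Let rr1 : 0 <= r < 1. Proof. by rewrite rr0; case/andP: r0; lra. Qed.

Let z01 : 0 <= (1 : R) <= 1. Proof. by rewrite ler01 lexx. Qed.

Let w_affine : 2 * \sum_(a < k) (a + k)%:R * w a = e 1.
Proof.
have := @wint_affine R k k_gt0 1 ler01; rewrite wint_lin => ->; ring.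
Qed.

(** The relation of [avg_rec_wint] at [z = 1] ties the slope [s] of the second moment to the
    integral of its inhomogeneity [b]. *)
Let s_cvg : (fun M => \sum_(m < M) b m * wint 1 ((1 - 'X) ^+ 2 * 'X^m)) @ \oo -->
  s * e 1 - 2 * \sum_(a < k) d a * d' a * w a.
Proof.
pose u n := v n - s * (n + k)%:R.
have ub : avg_rec k u b.
  have := avg_recB vb (avg_rec_affine k s).
  by congr avg_rec; apply/funext => m; rewrite subr0.
have gb : geo_bounded (2 * r) b by apply: geo_boundedZ; exact: geo_bounded_conv.
have r21 : 0 < 2 * r < 2^-1 by case/andP: r0; lra.
have := avg_rec_wint k_gt0 ub r21 gv gb z01.
rewrite subrr expr0n /=.
under eq_fun do rewrite !mul0r add0r.
move=> H; have -> : (fun M => \sum_(m < M) b m * wint 1 ((1 - 'X) ^+ 2 * 'X^m)) =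
    (fun M => - - \sum_(m < M) b m * wint 1 ((1 - 'X) ^+ 2 * 'X^m)).
  by apply/funext => M; rewrite opprK.
suff -> : s * e 1 - 2 * \sum_(a < k) d a * d' a * w a =
  - (2 * wint 1 ((1 - 'X) * \sum_(a < k) u a *: 'X^a)) by exact: cvgN.
apply/esym; rewrite wint_lin -w_affine mulrCA -mulrBr -mulrN; congr (_ * _).
rewrite mulr_sumr -sumrB -sumrN; apply: eq_bigr => a _.
by rewrite /u v_small // -/(w a); ring.
Qed.

Let onem_X2_le1 (y : R) : 0 <= y <= 1 -> 0 <= (1 - y) ^+ 2 <= 1.
Proof. by move=> /andP[y0 y1]; rewrite sqr_ge0 expr_le1 // ?subr_ge0 // gerBl. Qed.

Let conv_poly M : D M * D' M - \sum_(m < M) (b m / 2) *: 'X^m =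
  \sum_(a < M) \sum_(M - a <= c < M) (d a * d' c) *: 'X^(a + c).
Proof.
have -> : \sum_(m < M) (b m / 2) *: 'X^m =
    \sum_(m < M) \sum_(a < m.+1) (d a * d' (m - a)%N) *: 'X^(a + (m - a)) :> {poly R}.
  apply: eq_bigr => m _; rewrite /b mulrAC mulfV // mul1r scaler_suml.
  apply: eq_bigr => -[a am] _ /=; congr (_ *: 'X^_); lia.
rewrite (triangle_sum (fun a c => (d a * d' c) *: 'X^(a + c))).
rewrite /D mulr_suml -sumrB; apply: eq_bigr => -[a aM] _ /=.
rewrite /D' mulr_sumr.
rewrite -(big_mkord xpredT (fun c => d a *: 'X^a * (d' c *: 'X^c))).
rewrite -(big_mkord xpredT (fun c => (d a * d' c) *: 'X^(a + c))).
rewrite (@big_cat_nat _ _ _ (M - a)) //=; last by lia.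
rewrite addrAC [X in X + _ = _](_ : _ = 0) ?add0r.
  by apply: eq_bigr => c _; rewrite -scalerAl -scalerAr scalerA exprD.
apply/eqP; rewrite subr_eq0; apply/eqP.
by apply: eq_bigr => c _; rewrite -scalerAl -scalerAr scalerA exprD.
Qed.

(** [b / 2] lists the coefficients of the product of the two generating functions, so the error
    consists of terms of [D M * D' M] of degree at least [M]. There are at most [M ^ 2] of them,
    each of size [r ^ M]: the error is of order [(4 r) ^ M], which [r < 1/4] sends to 0. *)
Let conv_cvg : (fun M => wint 1 ((1 - 'X) ^+ 2 * (D M * D' M))) @ \oo -->
  s * e 1 / 2 - \sum_(a < k) d a * d' a * w a.
Proof.
have [C C0 HC] := geo_bounded_nonneg gd.
have [C' C'0 HC'] := geo_bounded_nonneg gd'.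
have -> : s * e 1 / 2 - \sum_(a < k) d a * d' a * w a =
    (s * e 1 - 2 * \sum_(a < k) d a * d' a * w a) / 2 + 0 by field.
have -> : (fun M => wint 1 ((1 - 'X) ^+ 2 * (D M * D' M))) =
  (fun M => (\sum_(m < M) b m * wint 1 ((1 - 'X) ^+ 2 * 'X^m)) / 2 +
     wint 1 ((1 - 'X) ^+ 2 * (D M * D' M - \sum_(m < M) (b m / 2) *: 'X^m))).
  apply/funext => M; rewrite mulrBr wintB wint_lin.
  have -> : \sum_(m < M) b m / 2 * wint 1 ((1 - 'X) ^+ 2 * 'X^m) =
      (\sum_(m < M) b m * wint 1 ((1 - 'X) ^+ 2 * 'X^m)) / 2.
    by rewrite mulr_suml; apply: eq_bigr => m _; rewrite mulrAC.
  ring.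
apply: cvgD; first by apply: cvgM; [exact: s_cvg | exact: cvg_cst].
suff : geo_bounded (2 * (2 * r)) (fun M => wint 1 ((1 - 'X) ^+ 2 * (D M * D' M - \sum_(m < M) (b m / 2) *: 'X^m))).
  by apply: geo_bounded_cvg0; rewrite !mulr_ge0 //; case/andP: r0; lra.
exists (C * C' * e 1) => M; rewrite conv_poly.
apply: le_trans (_ : C * C' * (M.+1%:R * (M.+1%:R * r ^+ M)) * e 1 <= _); last first.
  have M2 := succ_le_pow2 R M; have rM : 0 <= r ^+ M by exact: exprn_ge0.
  have C2 : 0 <= C * C' * e 1 by rewrite !mulr_ge0 // ltW // e_gt0.
  rewrite mulrAC !exprMn; apply: ler_wpM2l => //; apply: ler_pM => //.
    by rewrite mulr_ge0.
  exact: ler_wpM2r.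
apply: wint_le => // y y01; have /andP[y0 y1] := y01.
rewrite hornerM expr2 hornerM hornerD hornerN hornerC hornerX -expr2 normrM.
have /andP[q0 q1] := onem_X2_le1 y01; rewrite ger0_norm // -[leRHS]mul1r ler_pM //.
rewrite horner_sum; apply: le_trans (ler_norm_sum _ _ _) _.
have H a : (a < M)%N -> `|(\sum_(M - a <= c < M) (d a * d' c) *: 'X^(a + c)).[y]| <=
    C * C' * (M.+1%:R * r ^+ M).
  move=> aM; rewrite horner_sum; apply: le_trans (ler_norm_sum _ _ _) _.
  apply: (@le_trans _ _ (\sum_(M - a <= c < M) C * C' * r ^+ M)).
    rewrite big_nat [leRHS]big_nat; apply: ler_sum => c /andP[c1 c2].
    rewrite hornerZ hornerXn !normrM -[leRHS]mulr1 ler_pM ?mulr_ge0 //; last first.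
      by rewrite ger0_norm ?exprn_ge0 // exprn_ile1.
    apply: le_trans (ler_pM _ _ (HC a) (HC' c)) _ => //.
    have acM : (M <= a + c)%N by rewrite -leq_subLR.
    rewrite mulrACA -exprD; apply: ler_wpM2l; first exact: mulr_ge0.
    by apply: ler_wiXn2l => //; case/andP: rr1 => _ /ltW.
  rewrite sumr_const_nat -[_ *+ _]mulr_natl mulrCA ler_wpM2l ?mulr_ge0 //.
  by rewrite ler_wpM2r ?exprn_ge0 // ler_nat (leq_trans (leq_subr _ _)).
apply: (@le_trans _ _ (\sum_(a < M) C * C' * (M.+1%:R * r ^+ M))).
  by apply: ler_sum => -[a aM] _; exact: H.
rewrite sumr_const card_ord -[_ *+ _]mulr_natl mulrCA ler_wpM2l ?mulr_ge0 //.
by rewrite ler_wpM2r ?mulr_ge0 ?exprn_ge0 // ler_nat.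
Qed.

Let moment_cvg (y : nat -> R) : avg_rec k y (fun=> 0) -> geo_bounded r y ->
  (fun M => wint 1 ((k%:R * (1 - 'X) + 'X) * \sum_(n < M) y n *: 'X^n)) @ \oo -->
  \sum_(n < k) (k%:R - 1 - n%:R) * y n * w n.
Proof.
move=> yb gy; rewrite -[X in _ --> X]addr0.
pose T M := \sum_(l < k) ((M + l)%:R + 1 - k%:R) * y (M + l)%N * w (M + l) +
  (2 * \sum_(a < M) y a) * wint 1 ('X^(M + k)).
have -> : (fun M => wint 1 ((k%:R * (1 - 'X) + 'X) * \sum_(n < M) y n *: 'X^n)) =
  (fun M => \sum_(n < k) (k%:R - 1 - n%:R) * y n * w n + T M).
  apply/funext => M; have := congr1 (wint 1) (avg_rec_moment k_gt0 M yb).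
  rewrite 3!wintD wint_adj ?ler01 // !hornerM !hornerD !hornerN !hornerC !hornerX.
  rewrite subrr mulr0 !mul0r subrr add0r wintZ !wint_lin /T addrA -/w => <-.
  by rewrite wint_sum; apply: eq_bigr => n _; rewrite wintZ.
apply: cvgD; first exact: cvg_cst.
have w1 (p : {poly R}) : (forall t, 0 <= t <= 1 -> `|p.[t]| <= 1) -> `|wint 1 p| <= 1 * e 1.
  by move=> Hp; apply: wint_le.
have X1 n (t : R) : 0 <= t <= 1 -> `|('X^n : {poly R}).[t]| <= 1.
  by move=> /andP[t0 t1]; rewrite hornerXn ger0_norm ?exprn_ge0 // exprn_ile1.
suff : geo_bounded (2 * r) T by apply: geo_bounded_cvg0; rewrite mulr_ge0 //; case/andP: r0; lra.
have geoM (u q : nat -> R) c : geo_bounded (2 * r) u -> (forall n, `|q n| <= c) ->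
    geo_bounded (2 * r) (fun n => u n * q n).
  move=> /geo_bounded_nonneg[C C0 HC] Hw; exists (C * c) => n.
  rewrite normrM mulrAC; apply: ler_pM => //; exact: HC.
have g2 (u : nat -> R) : geo_bounded r u -> geo_bounded (2 * r) u.
  by apply: geo_boundedW; rewrite rr0 ler_peMl // ler1n.
apply: geo_boundedD.
  apply: geo_bounded_sum => l; apply: (geoM _ _ (1 * e 1)); last first.
    move=> n; apply: w1 => t t01; rewrite hornerM normrM -[leRHS]mulr1 ler_pM ?X1 //.
    rewrite hornerD hornerN hornerC hornerX ger0_norm ?subr_ge0; first by rewrite gerBl; case/andP: t01.
    by case/andP: t01.
  have gl := geo_bounded_shift l rr0 gy.
  have := geo_boundedB (geo_bounded_natmul rr0 gl) (g2 _ (geo_boundedZ (k%:R - l%:R) gl)).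
  congr geo_bounded; apply/funext => n; rewrite -natr1 natrD; ring.
apply: (geoM _ _ (1 * e 1)); last by move=> n; apply: w1 => t; exact: X1.
apply: geo_boundedZ; apply: (avg_rec_geo_sum yb _ gy).
  by case/andP: r0; lra.
by exists 0 => n; rewrite normr0 mul0r.
Qed.

(** The integrals of one polynomial sequence [P M] are computed twice. Pointwise [P M] tends to
    [H_ i j], by [mean_generating], and it is uniformly bounded on [0, 1[. Algebraically the
    recursions reduce the integral to initial values, and its limit is [s * e_ 1 / 2]. *)
Lemma sigma_limit : s = sigma R k i j.
Proof.
pose rd := @reduced_poly R k.
pose aff : {poly R} := k%:R * (1 - 'X) + 'X.
(* Obtained from [H_] by writing each [y^i + y^(k-1) G_i] as the limit of [D M] plus a polar part
   and expanding; the product of the polar parts, less the bracket of [H_], is [reduced_poly]. *)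
pose P M : {poly R} := (i == j)%:R *: ((1 - 'X) * 'X^i) + (1 - 'X) ^+ 2 * (D M * D' M)
  + th *: (aff * D' M) + th' *: (aff * D M) + (th * th') *: rd.
have rd1 : wint 1 rd = \sum_(n < k) (k + n)%:R * (3 * k%:R - 2 - n%:R) * w n
    - (2 * k%:R - 1) * e 1.
  rewrite /rd /reduced_poly wintD wint_adj ?ler01 // wint_lin addrC; congr (_ + _).
  rewrite /primitive_poly -!polyC_natr !expr2.
  rewrite !(hornerM, hornerD, hornerN, hornerC, hornerX); ring.
have L1 : (fun M => wint 1 (P M)) @ \oo --> \int[mu]_(y in `[0, 1[) (H_ k i j y * e y).
  have [C C0 HC] := geo_bounded_tail rr1 gd.
  have [C' C'0 HC'] := geo_bounded_tail rr1 gd'.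
  have yn (y : R) n : 0 <= y < 1 -> `|y ^+ n| <= 1.
    by move=> /andP[y0 y1]; rewrite ger0_norm ?exprn_ge0 // exprn_ile1 // ltW.
  have DE M y : (D M).[y] = \sum_(n < M) d n * y ^+ n.
    by rewrite horner_sum; apply: eq_bigr => n _; rewrite hornerZ hornerXn.
  have D'E M y : (D' M).[y] = \sum_(n < M) d' n * y ^+ n.
    by rewrite horner_sum; apply: eq_bigr => n _; rewrite hornerZ hornerXn.
  have DC M y : 0 <= y < 1 -> `|(D M).[y]| <= C.
    move=> y01; have := HC (fun n => y ^+ n) 0%N M (fun n => yn y n y01) (leq0n M).
    by rewrite big_ord0 subr0 expr0 mulr1 DE.
  have D'C M y : 0 <= y < 1 -> `|(D' M).[y]| <= C'.
    move=> y01; have := HC' (fun n => y ^+ n) 0%N M (fun n => yn y n y01) (leq0n M).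
    by rewrite big_ord0 subr0 expr0 mulr1 D'E.
  have PE M y : (P M).[y] = (i == j)%:R * ((1 - y) * y ^+ i)
      + (1 - y) ^+ 2 * ((D M).[y] * (D' M).[y])
      + th * ((k%:R * (1 - y) + y) * (D' M).[y])
      + th' * ((k%:R * (1 - y) + y) * (D M).[y]) + th * th' * rd.[y].
    rewrite /P /aff -polyC_natr !expr2.
    by rewrite !(hornerD, hornerZ, hornerM, hornerN, hornerC, hornerX, hornerXn).
  have rdC : exists B, forall y : R, 0 <= y < 1 -> `|rd.[y]| <= B.
    exists (\sum_(n < size rd) `|rd`_n|) => y y01; rewrite horner_coef.
    apply: le_trans (ler_norm_sum _ _ _) _; apply: ler_sum => n _.
    by rewrite normrM -[leRHS]mulr1 ler_pM // yn.
  have [B HB] := rdC.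
  apply: (@wint_dominated _ _ (1 + C * C' + `|th| * ((k%:R + 1) * C') + `|th'| * ((k%:R + 1) * C) + `|th * th'| * B)).
    move=> M y y01; have /andP[y0 y1] := y01; rewrite PE.
    have a1 : `|k%:R * (1 - y) + y| <= k%:R + 1.
      have ky : 0 <= k%:R * (1 - y) by rewrite mulr_ge0 ?subr_ge0 ?(ltW y1).
      rewrite ger0_norm ?addr_ge0 //; apply: lerD; last exact: ltW.
      by rewrite ler_piMr // gerBl.
    have q1 : `|(1 - y) ^+ 2| <= 1.
      have /andP[q0 q1] : 0 <= (1 - y) ^+ 2 <= 1 by apply: onem_X2_le1; rewrite y0 ltW.
      by rewrite ger0_norm.
    apply: le_trans (ler_normD _ _) _; apply: lerD; last by rewrite normrM ler_wpM2l // HB.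
    apply: le_trans (ler_normD _ _) _; apply: lerD; last first.
      by rewrite normrM ler_wpM2l // normrM ler_pM // DC.
    apply: le_trans (ler_normD _ _) _; apply: lerD; last first.
      by rewrite normrM ler_wpM2l // normrM ler_pM // D'C.
    apply: le_trans (ler_normD _ _) _; apply: lerD; last first.
      rewrite normrM -[leRHS]mul1r ler_pM // normrM ler_pM // ?DC ?D'C //.
    rewrite !normrM -[leRHS]mulr1 ler_pM ?mulr_ge0 //.
      by case: (i == j); rewrite ?normr1 ?normr0.
    rewrite -[leRHS]mulr1 ler_pM ?yn // ger0_norm ?gerBl // subr_ge0 ltW //.
  move=> y y01; have /andP[y0 y1] := y01.
  have w0 : 1 - y != 0 by rewrite subr_eq0 gt_eqF.
  have G1 := mean_generating k_gt0 xb ik x_small r2 gd y01.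
  have G2 := mean_generating k_gt0 x'b jk x'_small r2 gd' y01.
  under eq_fun do rewrite PE DE D'E.
  have RE := reduced_poly_horner y01.
  suff -> : H_ k i j y = (i == j)%:R * ((1 - y) * y ^+ i)
      + (1 - y) ^+ 2 * ((y ^+ i + y ^+ k.-1 * G_ k i y - th * (k%:R * (1 - y) + y) / (1 - y) ^+ 2)
          * (y ^+ j + y ^+ k.-1 * G_ k j y - th' * (k%:R * (1 - y) + y) / (1 - y) ^+ 2))
      + th * ((k%:R * (1 - y) + y) * (y ^+ j + y ^+ k.-1 * G_ k j y - th' * (k%:R * (1 - y) + y) / (1 - y) ^+ 2))
      + th' * ((k%:R * (1 - y) + y) * (y ^+ i + y ^+ k.-1 * G_ k i y - th * (k%:R * (1 - y) + y) / (1 - y) ^+ 2))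
      + th * th' * rd.[y].
    apply: cvgD; last exact: cvg_cst.
    apply: cvgD; last by apply: cvgM; [exact: cvg_cst | apply: cvgM; [exact: cvg_cst | exact: G1]].
    apply: cvgD; last by apply: cvgM; [exact: cvg_cst | apply: cvgM; [exact: cvg_cst | exact: G2]].
    apply: cvgD; first exact: cvg_cst.
    by apply: cvgM; [exact: cvg_cst | apply: cvgM; [exact: G1 | exact: G2]].
  by rewrite RE /H_ -/th -/th'; field.
have L2 : (fun M => wint 1 (P M)) @ \oo --> s * e 1 / 2.
  have -> : s * e 1 / 2 = (i == j)%:R * w i
     + (s * e 1 / 2 - \sum_(a < k) d a * d' a * w a)
     + th * (\sum_(n < k) (k%:R - 1 - n%:R) * d' n * w n)
     + th' * (\sum_(n < k) (k%:R - 1 - n%:R) * d n * w n)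
     + th * th' * wint 1 rd.
    have wi : th * e 1 = 2 * w i by exact: thetaE.
    have wj : th' * e 1 = 2 * w j by exact: thetaE.
    have pick q (F : nat -> R) : (q < k)%N -> F q = \sum_(n < k) (n == q :> nat)%:R * F n.
      move=> qk; rewrite (bigD1 (Ordinal qk)) //= eqxx mul1r big1 ?addr0 // => a.
      by rewrite -val_eqE /= => /negbTE ->; rewrite mul0r.
    (* Comparison of the coefficients of [w n]: those of [th * th'] cancel, and the linear ones add
       up through [(n + k) + (k - 1 - n) = 2 k - 1]. The left side is what the value of
       [primitive_poly] at 1 removes. *)
    have E : (2 * k%:R - 1) * (th * th' * e 1) =
      (i == j)%:R * w i - (\sum_(a < k) d a * d' a * w a)
     + th * (\sum_(n < k) (k%:R - 1 - n%:R) * d' n * w n)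
     + th' * (\sum_(n < k) (k%:R - 1 - n%:R) * d n * w n)
     + th * th' * (\sum_(n < k) (k + n)%:R * (3 * k%:R - 2 - n%:R) * w n).
      have -> : (2 * k%:R - 1) * (th * th' * e 1) =
          (2 * k%:R - 1) * (th * w j + th' * w i).
        move: wi wj; set a := w i; set c := w j; set f := e 1 => wi wj.
        have h1 : th * th' * f = th' * (2 * a) by rewrite -wi; ring.
        have h2 : th * th' * f = th * (2 * c) by rewrite -wj; ring.
        by congr (_ * _); lra.
      rewrite (pick i (fun n => (n == j)%:R * w n) ik) (pick i w ik) (pick j w jk).
      rewrite !mulr_sumr -big_split /= mulr_sumr -sumrB -!big_split /=.
      apply: eq_bigr => n _; rewrite /d /d' x_small // x'_small // -/th -/th' !natrD.
      by ring.
    by rewrite rd1 mulrBr [th * th' * (_ * e 1)]mulrCA E; ring.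
  under eq_fun do rewrite !wintD !wintZ.
  apply: cvgD; last exact: cvg_cst.
  have rec_B (y : nat -> R) t : avg_rec k y (fun=> 0) -> avg_rec k (fun n => y n - t * (n + k)%:R) (fun=> 0).
    move=> yb; have := avg_recB yb (avg_rec_affine k t).
    by congr avg_rec; apply/funext => m; rewrite subrr.
  apply: cvgD; last first.
    by apply: cvgM; [exact: cvg_cst | apply: moment_cvg => //; exact: rec_B].
  apply: cvgD; last first.
    by apply: cvgM; [exact: cvg_cst | apply: moment_cvg => //; exact: rec_B].
  by apply: cvgD; [exact: cvg_cst | exact: conv_cvg].
have E := cvg_unique (@norm_hausdorff _ R^o) L1 L2.
have e1 : e 1 != 0 by rewrite gt_eqF // e_gt0.
by rewrite /sigma [\int[_]_(_ in _) _]E; field.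
Qed.

End covariance.

End sigma.

(** * Taylor bounds and the characteristic function of the spacings *)

Section taylor_bounds.
Variable R : realType.
Implicit Types x y : R.

(** Integrates an inequality: starting from [cos <= 1], it yields the alternating Taylor bounds of
    sine and cosine one order at a time. *)
Lemma derive_ge0_ge0 (f f' : R -> R) : (forall x, is_derive x 1 f (f' x)) ->
  (forall x, 0 <= x -> 0 <= f' x) -> f 0 = 0 -> forall x, 0 <= x -> 0 <= f x.
Proof.
move=> df f'0 f0 x; rewrite le_eqVlt => /predU1P[<-|x0]; first by rewrite f0.
have cf : {within `[0, x], continuous f}.
  apply: derivable_within_continuous => y _; exact: ex_derive.
have [c] := @MVT R f f' 0 x x0 (fun y _ => df y) cf.
rewrite in_itv /= f0 subr0 => /andP[c0 _] ->.
by rewrite subr0 mulr_ge0 ?f'0 ?ltW.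
Qed.

Let is_derive_eq (f : R -> R) x d d' : is_derive x 1 f d -> d = d' -> is_derive x 1 f d'.
Proof. by move=> H <-. Qed.

Lemma sin_le x : 0 <= x -> sin x <= x.
Proof.
rewrite -[_ <= x]subr_ge0.
have D y : is_derive y 1 (fun t => t - sin t : R) (1 - cos y).
  by apply: is_derive_eq.
have P y : 0 <= y -> 0 <= 1 - cos y.
  by rewrite subr_ge0 cos_le1.
by apply: (derive_ge0_ge0 D P); rewrite sin0 subrr.
Qed.

Lemma norm_sin_le x : `|sin x| <= `|x|.
Proof.
wlog x0 : x / 0 <= x => [H|].
  case: (leP 0 x) => [/H//|/ltW x0].
  by rewrite -normrN -sinN -[leRHS]normrN H // oppr_ge0.
rewrite [`|x|]ger0_norm // ler_norml sin_le // andbT.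
suff : 0 <= sin x + x by lra.
have D y : is_derive y 1 (fun t => sin t + t : R) (cos y + 1) by apply: is_derive_eq.
have P y : 0 <= y -> 0 <= cos y + 1 by have := cos_geN1 y; lra.
by apply: (derive_ge0_ge0 D P) => //; rewrite sin0 addr0.
Qed.

Lemma cos_ge_quad x : 0 <= x -> 0 <= cos x - 1 + x ^+ 2 / 2.
Proof.
have D y : is_derive y 1 (fun t => cos t - 1 + t ^+ 2 / 2 : R) (y - sin y).
  by apply: is_derive_eq; rewrite /GRing.scale /=; field.
have P y : 0 <= y -> 0 <= y - sin y.
  by move=> y0; rewrite subr_ge0 sin_le.
by apply: (derive_ge0_ge0 D P); rewrite cos0 expr0n mul0r addr0 subrr.
Qed.

Lemma sin_ge_cubic x : 0 <= x -> 0 <= sin x - x + x ^+ 3 / 6.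
Proof.
have D y : is_derive y 1 (fun t => sin t - t + t ^+ 3 / 6 : R) (cos y - 1 + y ^+ 2 / 2).
  by apply: is_derive_eq; rewrite /GRing.scale /=; field.
have P y : 0 <= y -> 0 <= cos y - 1 + y ^+ 2 / 2.
  by exact: cos_ge_quad.
by apply: (derive_ge0_ge0 D P); rewrite sin0 expr0n mul0r addr0 subrr.
Qed.

Lemma cos_le_quartic x : 0 <= x -> 0 <= 1 - x ^+ 2 / 2 + x ^+ 4 / 24 - cos x.
Proof.
have D y : is_derive y 1 (fun t => 1 - t ^+ 2 / 2 + t ^+ 4 / 24 - cos t : R) (sin y - y + y ^+ 3 / 6).
  by apply: is_derive_eq; rewrite /GRing.scale /=; field.
have P y : 0 <= y -> 0 <= sin y - y + y ^+ 3 / 6.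
  by exact: sin_ge_cubic.
by apply: (derive_ge0_ge0 D P); rewrite cos0 !expr0n !mul0r addr0 subr0 subrr.
Qed.

Lemma sin_taylor x : `|sin x - x| <= `|x| ^+ 3.
Proof.
wlog x0 : x / 0 <= x => [H|].
  case: (leP 0 x) => [/H//|/ltW x0].
  by have := H (- x); rewrite oppr_ge0 sinN -opprD !normrN => /(_ x0).
have := sin_ge_cubic x0; have := sin_le x0; rewrite [`|x|]ger0_norm // => h1 h2.
have x3 : 0 <= x ^+ 3 by rewrite exprn_ge0.
by rewrite ler_norml; apply/andP; split; lra.
Qed.

Lemma cos_taylor x : `|cos x - 1 + x ^+ 2 / 2| <= x ^+ 4.
Proof.
wlog x0 : x / 0 <= x => [H|].
  case: (leP 0 x) => [/H//|/ltW x0].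
  have e4 : (- x) ^+ 4 = x ^+ 4 by ring.
  by have := H (- x); rewrite oppr_ge0 cosN sqrrN e4 => /(_ x0).
have := cos_ge_quad x0; have := cos_le_quartic x0 => h1 h2.
have x4 : 0 <= x ^+ 4 by rewrite exprn_ge0.
by rewrite ler_norml; apply/andP; split; lra.
Qed.

Lemma expR_taylor x : `|expR x - 1 - x| <= x ^+ 2 * expR `|x|.
Proof.
have e1 := expR_ge1Dx x.
have eN : expR x * (1 - x) <= 1.
  have := expR_ge1Dx (- x); rewrite expRN => h.
  by rewrite mulrC -ler_pdivlMr ?expR_gt0 // mul1r.
rewrite ger0_norm; last by lra.
have [x0|x0] := leP 0 x.
  rewrite ger0_norm //.
  have : expR x - 1 <= x * expR x by move: eN; set e := expR x; lra.
  move=> h; have := ler_wpM2l x0 h; move: eN; rewrite expr2; set e := expR x; lra.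
have e2 : 1 <= expR `|x| by have := expR_ge1Dx `|x|; have := normr_ge0 x; lra.
have := ler_wpM2l (sqr_ge0 x) e2; rewrite mulr1; apply: le_trans.
have : 0 <= - x * (expR x - 1 - x) by rewrite mulr_ge0 //; lra.
move: eN; rewrite expr2; set e := expR x; lra.
Qed.

(** With [eps] and [eta] bounded by [E] and [u <= 1], every product of order at least three in [u]
    is at most a constant times [u ^ 3]; the angle is expanded around [al] by the addition
    formula. *)
Lemma characteristic_step (E : R) : 0 <= E -> exists2 A, 0 <= A &
  forall u al eps eta, 0 <= u <= 1 -> `|eps| <= E -> `|eta| <= E ->
  `|expR (- (eta * u ^+ 2 / 2)) * cos (u * eps + al) - cos al
    + u * eps * sin al + (eta + eps ^+ 2) * u ^+ 2 / 2 * cos al| <= A * u ^+ 3.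
Proof.
move=> E0.
pose K := E ^+ 2 * expR E.
have K0 : 0 <= K by rewrite mulr_ge0 ?sqr_ge0 ?expR_ge0.
exists (K + (E + K) * E + E ^+ 3 + K + expR E * E ^+ 4 + (E + K) * E ^+ 2 ).
  by rewrite !addr_ge0 ?mulr_ge0 ?addr_ge0 ?exprn_ge0 ?expR_ge0.
move=> u al eps eta /andP[u0 u1] epsE etaE.
pose x := - (eta * u ^+ 2 / 2); pose y := u * eps.
have u2 : 0 <= u ^+ 2 by exact: sqr_ge0.
have u3 : 0 <= u ^+ 3 by exact: exprn_ge0.
have u21 : u ^+ 2 <= 1 by rewrite expr_le1.
have u43 : u ^+ 4 <= u ^+ 3 by rewrite exprS ler_piMl.
have u32 : u ^+ 3 <= u ^+ 2 by rewrite exprS ler_piMl.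
have xE : `|x| <= E * u ^+ 2.
  rewrite /x normrN -mulrA normrM [`|_ / 2|]ger0_norm ?divr_ge0 //.
  by apply: ler_pM => //; [rewrite divr_ge0 | lra].
have x1 : `|x| <= E by apply: le_trans xE _; rewrite ler_piMr.
have yE : `|y| <= E * u by rewrite normrM ger0_norm // mulrC ler_wpM2r.
have y2 : y ^+ 2 <= E ^+ 2 * u ^+ 2.
  by rewrite -[y ^+ 2]ger0_norm ?sqr_ge0 // normrX -exprMn lerXn2r // nnegrE ?mulr_ge0.
have y4 : y ^+ 4 <= E ^+ 4 * u ^+ 3.
  apply: le_trans (_ : E ^+ 4 * u ^+ 4 <= _); last by rewrite ler_wpM2l ?exprn_ge0.
  rewrite -exprMn -[y ^+ 4]ger0_norm; last by rewrite (exprM y 2 2) sqr_ge0.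
  by rewrite normrX lerXn2r // nnegrE ?mulr_ge0.
have y3 : `|y| ^+ 3 <= E ^+ 3 * u ^+ 3 by rewrite -exprMn lerXn2r // nnegrE ?mulr_ge0.
have eE : expR `|x| <= expR E by rewrite ler_expR.
have h1 : `|expR x - 1 - x| <= K * u ^+ 3.
  apply: le_trans (expR_taylor x) _.
  have x2 : x ^+ 2 <= E ^+ 2 * u ^+ 3.
    apply: le_trans (_ : E ^+ 2 * u ^+ 4 <= _); last by rewrite ler_wpM2l ?sqr_ge0.
    rewrite (exprM u 2 2) -exprMn -[x ^+ 2]ger0_norm ?sqr_ge0 // normrX.
    by rewrite lerXn2r // nnegrE ?mulr_ge0.
  by rewrite /K [leRHS]mulrAC; apply: ler_pM; rewrite ?sqr_ge0 ?expR_ge0.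
have h2 : `|expR x - 1| <= (E + K) * u ^+ 2.
  have -> : expR x - 1 = (expR x - 1 - x) + x by ring.
  apply: le_trans (ler_normD _ _) _; have := ler_wpM2l K0 u32.
  move: h1 xE; lra.
have h3 := cos_taylor y; have h4 := sin_taylor y.
have px : expR x <= expR E by rewrite ler_expR (le_trans (ler_norm _)).
have uu : u ^+ 2 * u = u ^+ 3 by rewrite -exprSr.
have EK : 0 <= E + K by rewrite addr_ge0.
have C1 : `|expR x * cos y - 1 - x + y ^+ 2 / 2| <=
    (K + expR E * E ^+ 4 + (E + K) * E ^+ 2) * u ^+ 3.
  have -> : expR x * cos y - 1 - x + y ^+ 2 / 2 = (expR x - 1 - x)
    + expR x * (cos y - 1 + y ^+ 2 / 2) - (expR x - 1) * (y ^+ 2 / 2) by ring.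
  apply: le_trans (ler_normB _ _) _; rewrite [leRHS]mulrDl; apply: lerD; last first.
    rewrite normrM -mulrA; apply: le_trans (_ : (E + K) * u ^+ 2 * (E ^+ 2 * u) <= _).
      apply: ler_pM => //; rewrite ger0_norm ?divr_ge0 ?sqr_ge0 //.
      have := ler_wpM2l (sqr_ge0 E) u1; have : E ^+ 2 * u ^+ 2 <= E ^+ 2 * u.
        by rewrite ler_wpM2l ?sqr_ge0 // expr2 ler_piMl.
      have := mulr_ge0 (sqr_ge0 E) u0; move: y2; lra.
    by rewrite -uu; lra.
  apply: le_trans (ler_normD _ _) _; rewrite [leRHS]mulrDl; apply: lerD => //.
  rewrite normrM [`|expR x|]ger0_norm ?expR_ge0 // -mulrA ler_pM ?expR_ge0 //.
  exact: le_trans h3 y4.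
have C2 : `|expR x * sin y - y| <= ((E + K) * E + E ^+ 3) * u ^+ 3.
  have -> : expR x * sin y - y = (expR x - 1) * sin y + (sin y - y) by ring.
  apply: le_trans (ler_normD _ _) _; rewrite [leRHS]mulrDl; apply: lerD; last exact: le_trans h4 y3.
  rewrite normrM; apply: le_trans (_ : (E + K) * u ^+ 2 * (E * u) <= _).
    by apply: ler_pM => //; apply: le_trans (norm_sin_le y) yE.
  by rewrite -uu; lra.
have -> : expR x * cos (u * eps + al) - cos al + u * eps * sin al
    + (eta + eps ^+ 2) * u ^+ 2 / 2 * cos al =
    (expR x * cos y - 1 - x + y ^+ 2 / 2) * cos al - (expR x * sin y - y) * sin al.
  by rewrite cosD -/y /x /y; field.
apply: le_trans (ler_normB _ _) _; rewrite !normrM.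
have D1 := ler_pM (normr_ge0 _) (normr_ge0 _) C1 (cos_max al).
have D2 := ler_pM (normr_ge0 _) (normr_ge0 _) C2 (sin_max al).
apply: le_trans (lerD D1 D2) _.
have : 0 <= K * u ^+ 3 by rewrite mulr_ge0.
lra.
Qed.
End taylor_bounds.

(** * Moment recursions and the central limit theorem for additive functionals *)

Section law_moments.
Variables (R : realType) (V : zmodType) (k : nat) (v0 : nat -> V).
Hypothesis k_gt0 : (0 < k)%N.
Local Notation lw := (@law R V k v0).
Implicit Types (g h : V -> R) (f : V -> R).

Lemma law_conv m f : m.+1%:R * lw (m + k) f =
  \sum_(a < m.+1) lw a (fun x => lw (m - a) (fun y => f (x + y))).
Proof. by have := law_sum v0 k_gt0 f (leq_addl m k); rewrite addnK => ->. Qed.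

Lemma sum_rev m (F : nat -> R) : \sum_(a < m.+1) F (m - a)%N = \sum_(a < m.+1) F a.
Proof.
rewrite (reindex_inj rev_ord_inj) /=; apply: eq_bigr => -[a am] _ /=.
by congr F; lia.
Qed.

Definition law_mean g n := lw n g.
Definition law_prod g h n := lw n (fun x => g x * h x).
Definition law_var g n := lw n (fun x => (g x - law_mean g n) ^+ 2).

Section additive_functionals.
Variables g h : V -> R.
Hypothesis gD : forall x y, g (x + y) = g x + g y.
Hypothesis hD : forall x y, h (x + y) = h x + h y.

Lemma law_meanE m : m.+1%:R * law_mean g (m + k) =
  \sum_(a < m.+1) (law_mean g a + law_mean g (m - a)).
Proof.
rewrite /law_mean law_conv; apply: eq_bigr => a _.
under eq_fun do under eq_fun do rewrite gD.
under eq_fun do rewrite lawD // law_cst //.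
by rewrite lawD // law_cst.
Qed.

Lemma law_mean_rec : avg_rec k (law_mean g) (fun=> 0).
Proof. by move=> m; rewrite law_meanE big_split /= sum_rev addr0; ring. Qed.

Lemma law_prodE m : m.+1%:R * law_prod g h (m + k) =
  \sum_(a < m.+1) (law_prod g h a + law_prod g h (m - a)
    + law_mean g a * law_mean h (m - a) + law_mean g (m - a) * law_mean h a).
Proof.
rewrite /law_prod law_conv; apply: eq_bigr => a _.
have E x y : g (x + y) * h (x + y) = (g x * h x + g x * h y) + (h x * g y + g y * h y).
  by rewrite gD hD; ring.
under eq_fun do under eq_fun do rewrite E.
under eq_fun do rewrite !lawD // law_cst // !lawZ //.
rewrite !lawD // law_cst //.
rewrite (_ : (fun x => g x * lw (m - a) h) = (fun x => lw (m - a) h * g x)); last first.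
  by apply/funext => x; rewrite mulrC.
rewrite (_ : (fun x => h x * lw (m - a) g) = (fun x => lw (m - a) g * h x)); last first.
  by apply/funext => x; rewrite mulrC.
by rewrite !lawZ // /law_mean; ring.
Qed.

Lemma law_centered p q n :
  lw n (fun x => (g x - p) * (h x - q)) =
  law_prod g h n - p * law_mean h n - q * law_mean g n + p * q.
Proof.
have E x : (g x - p) * (h x - q) = g x * h x + (- p * h x + (- q * g x + p * q)) by ring.
under eq_fun do rewrite E.
by rewrite !lawD // !lawZ // law_cst // /law_prod /law_mean; ring.
Qed.

End additive_functionals.

(** The centring is additive along the split, so the inhomogeneity consists only of products of the
    deviations of the means; in the application these are exponentially small. *)
Lemma law_centered_rec g h l l' :
  (forall x y, g (x + y) = g x + g y) -> (forall x y, h (x + y) = h x + h y) ->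
  let d n := law_mean g n - l * (n + k)%:R in
  let d' n := law_mean h n - l' * (n + k)%:R in
  avg_rec k (fun n => lw n (fun x => (g x - l * (n + k)%:R) * (h x - l' * (n + k)%:R)))
    (fun m => 2 * \sum_(a < m.+1) d a * d' (m - a)%N).
Proof.
move=> gD hD d d' m.
pose W n := lw n (fun x => (g x - l * (n + k)%:R) * (h x - l' * (n + k)%:R)).
rewrite -[LHS]/(m.+1%:R * W (m + k)%N) -[\sum_(a < m.+1) lw a _]/(\sum_(a < m.+1) W a).
transitivity (\sum_(a < m.+1) (W a + W (m - a)%N +
    (d a * d' (m - a)%N + d (m - a)%N * d' a))).
  rewrite /W law_centered mulrDr !mulrBr law_prodE //.
  rewrite [m.+1%:R * (_ * law_mean h _)]mulrCA [m.+1%:R * (_ * law_mean g _)]mulrCA.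
  rewrite (law_meanE gD) (law_meanE hD) mulr_natl -[in X in _ + X = _](card_ord m.+1) -sumr_const.
  rewrite !mulr_sumr -!sumrB -big_split /=; apply: eq_bigr => -[a am] _ /=.
  rewrite !law_centered /d /d'.
  have -> : (m + k + k)%:R = (a + k)%:R + (m - a + k)%:R :> R.
    by rewrite -natrD; congr _%:R; lia.
  by ring.
rewrite !big_split /= !sum_rev.
have -> : \sum_(a < m.+1) d (m - a)%N * d' a = \sum_(a < m.+1) d a * d' (m - a)%N.
  rewrite -(sum_rev m (fun a => d a * d' (m - a)%N)).
  by apply: eq_bigr => -[a am] _ /=; rewrite subKn.
by ring.
Qed.

Lemma law_varE g n : law_var g n = law_prod g g n - law_mean g n ^+ 2.
Proof.
rewrite /law_var; under eq_fun do rewrite expr2.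
by rewrite law_centered; ring.
Qed.

Lemma law_var_ge0 g n : 0 <= law_var g n.
Proof. by apply: law_ge0 => // x; exact: sqr_ge0. Qed.

(** Decomposition of the variance by conditioning on the first unit: the two rows contribute their
    variances, the random place [a] the squared deviation of the conditional mean. *)
Lemma law_var_rec g m : (forall x y, g (x + y) = g x + g y) ->
  m.+1%:R * law_var g (m + k) =
  \sum_(a < m.+1) (law_var g a + law_var g (m - a)
     + (law_mean g a + law_mean g (m - a) - law_mean g (m + k)) ^+ 2).
Proof.
move=> gD; set M := law_mean g (m + k).
rewrite law_varE mulrBr law_prodE // -/M.
have -> : m.+1%:R * M ^+ 2 = \sum_(a < m.+1)
    (2 * M * (law_mean g a + law_mean g (m - a)) - M ^+ 2).
  rewrite sumrB -mulr_sumr -law_meanE // sumr_const card_ord -/M -mulr_natl; ring.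
rewrite -sumrB; apply: eq_bigr => a _; rewrite !law_varE; ring.
Qed.

Section central_limit.
Variable g : V -> R.
Hypothesis gD : forall x y, g (x + y) = g x + g y.
Variables (l s C : R).
Hypothesis mean_bound : forall n, `|law_mean g n - l * (n + k)%:R| <= C.
Hypothesis var_bound : forall n, `|law_var g n - s * (n + k)%:R| <= C.

Let mean := law_mean g.
Let var := law_var g.

(* On average over a, eps_a = m_a + m_(n-k-a) - m_n and eta_a + eps_a ^ 2, with
   eta_a = v_a + v_(n-k-a) - v_n, both vanish: this cancels the terms of order
   one and two of [characteristic_step]. *)
Lemma law_cos_bound : exists2 A, 0 <= A & forall n u al, 0 <= u <= 1 ->
  `|lw n (fun x => cos (u * (g x - mean n) + al))
    - expR (- (var n * u ^+ 2 / 2)) * cos al| <= A * u ^+ 3 * (n + k).-1%:R.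
Proof.
have C0 : 0 <= C by apply: le_trans (mean_bound 0%N).
have [A A0 HA] := @characteristic_step R (3 * C) ltac:(by rewrite mulr_ge0).
exists A => // n; have [N] := ubnP n; elim: N n => // N IH n nN u al u01.
have /andP[u0 u1] := u01.
have u3 : 0 <= u ^+ 3 by exact: exprn_ge0.
(* A row shorter than [k] is deterministic: the error is 0, which anchors the induction. *)
have [nk|kn] := ltnP n k.
  rewrite /mean /var /law_var /law_mean !law_small // subrr mulr0 add0r.
  rewrite expr0n /= mul0r mul0r oppr0 expR0 mul1r subrr normr0.
  by rewrite !mulr_ge0.
have [m nE] : exists m, n = (m + k)%N by exists (n - k)%N; lia.
rewrite nE in nN *; have m0 : (0 : R) < m.+1%:R by [].
pose eps a := mean a + mean (m - a)%N - mean (m + k)%N.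
pose eta a := var a + var (m - a)%N - var (m + k)%N.
have split_n a : (a <= m)%N -> (m + k + k)%:R = (a + k)%:R + (m - a + k)%:R :> R.
  by move=> am; rewrite -natrD; congr _%:R; lia.
have epsE a : (a <= m)%N -> `|eps a| <= 3 * C.
  move=> am; have := mean_bound a; have := mean_bound (m - a)%N.
  have := mean_bound (m + k)%N; rewrite (split_n a am) /eps -/mean.
  by rewrite !ler_norml => /andP[? ?] /andP[? ?] /andP[? ?]; apply/andP; split; lra.
have etaE a : (a <= m)%N -> `|eta a| <= 3 * C.
  move=> am; have := var_bound a; have := var_bound (m - a)%N.
  have := var_bound (m + k)%N; rewrite (split_n a am) /eta -/var.
  by rewrite !ler_norml => /andP[? ?] /andP[? ?] /andP[? ?]; apply/andP; split; lra.
have sum_eps : \sum_(a < m.+1) eps a = 0.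
  by rewrite sumrB -law_meanE // sumr_const card_ord mulr_natl subrr.
have sum_eta : \sum_(a < m.+1) (eta a + eps a ^+ 2) = 0.
  have := law_var_rec m gD; rewrite -/var -/mean => E.
  rewrite (eq_bigr (fun a : 'I_m.+1 => (var a + var (m - a)%N + (mean a + mean (m - a)%N - mean (m + k)%N) ^+ 2) - var (m + k)%N)); last first.
    by move=> a _; rewrite /eta /eps; ring.
  by rewrite sumrB -E sumr_const card_ord mulr_natl subrr.
pose q a := expR (- (var a * u ^+ 2 / 2)).
have q0 a : 0 <= q a by exact: expR_ge0.
have q1 a : q a <= 1.
  by rewrite -expR0 ler_expR oppr_le0 divr_ge0 // mulr_ge0 ?sqr_ge0 // law_var_ge0.
rewrite -(ler_pM2l m0) -[X in X * `|_|](gtr0_norm m0) -normrM mulrBr law_conv.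
pose T a := q a * q (m - a)%N * cos (u * eps a + al).
have Hin a : (a <= m)%N ->
  `|lw a (fun x => lw (m - a) (fun y => cos (u * (g (x + y) - mean (m + k)) + al))) - T a|
   <= A * u ^+ 3 * ((a + k).-1%:R + (m - a + k).-1%:R).
  move=> am.
  (* Given the outcome [x] of the first row, its whole contribution becomes the phase [be x] of the
     second; hence the induction over all phases at once. *)
  pose be x := u * (g x - mean a) + (u * eps a + al).
  have -> : (fun x => lw (m - a) (fun y => cos (u * (g (x + y) - mean (m + k)) + al))) =
      (fun x => lw (m - a) (fun y => cos (u * (g y - mean (m - a)%N) + be x))).
    apply/funext => x; congr law; apply/funext => y; congr cos.
    by rewrite gD /be /eps; ring.
  set L := lw a (fun x => lw _ _); set X := lw a (fun x => cos (be x)).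
  have -> : L - T a = q (m - a)%N * (X - q a * cos (u * eps a + al)) + (L - q (m - a)%N * X).
    by rewrite /T; ring.
  apply: le_trans (ler_normD _ _) _; rewrite [leRHS]mulrDr; apply: lerD.
    rewrite normrM [`|q _|]ger0_norm //.
    have := IH a ltac:(lia) u (u * eps a + al) u01 => H.
    by apply: le_trans H; rewrite ler_piMl.
  rewrite /L /X -lawZ // -lawB //; apply: le_trans (ler_norm_law _ _ _ _) _ => //.
  rewrite -[leRHS](law_cst v0 k_gt0 a); apply: ler_law => // x.
  by apply: IH => //; lia.
have -> : m.+1%:R * (expR (- (var (m + k) * u ^+ 2 / 2)) * cos al) =
    \sum_(a < m.+1) (q (m + k)%N * (cos al - u * eps a * sin al
       - (eta a + eps a ^+ 2) * u ^+ 2 / 2 * cos al)).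
  rewrite -mulr_sumr 2!sumrB sumr_const card_ord.
  rewrite -mulr_suml -mulr_sumr sum_eps mulr0 mul0r subr0.
  rewrite -!mulr_suml sum_eta !mul0r subr0 -[cos al *+ _]mulr_natl; rewrite /q; ring.
rewrite -sumrB.
apply: le_trans (ler_norm_sum _ _ _) _.
apply: (@le_trans _ _ (\sum_(a < m.+1) A * u ^+ 3 * (m + k + k).-1%:R)); last first.
  by rewrite sumr_const card_ord mulr_natl.
apply: ler_sum => -[a am] _ /=.
(* The weight [(n + k) - 1] grows by exactly 1 when a unit joins two rows; this surplus pays for one
   error of [characteristic_step]. *)
have -> : A * u ^+ 3 * (m + k + k).-1%:R = A * u ^+ 3 * ((a + k).-1%:R + (m - a + k).-1%:R) + A * u ^+ 3 * 1.
  by rewrite -mulrDr -natrD natr1; congr (_ * _%:R); lia.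
have am' : (a <= m)%N by lia.
have Ha := Hin a am'; move: Ha; set L := lw a _ => Ha; set Q := q (m + k)%N * _.
have -> : L - Q = (L - T a) + (T a - Q) by ring.
apply: le_trans (ler_normD _ _) _; apply: lerD => //; rewrite /Q.
have -> : T a = q (m + k)%N * (expR (- (eta a * u ^+ 2 / 2)) * cos (u * eps a + al)).
  by rewrite /T /q mulrA -!expRD; congr (expR _ * _); rewrite /eta; ring.
rewrite -mulrBr normrM ger0_norm // mulr1.
have := HA u al (eps a) (eta a) u01 (epsE a am') (etaE a am') => H.
apply: le_trans (_ : 1 * (A * u ^+ 3) <= _); last by rewrite mul1r.
apply: ler_pM => //; apply: le_trans H; rewrite le_eqVlt; apply/orP; left.
by apply/eqP; congr `|_|; ring.
Qed.

Lemma cvg_sqrtV : (fun n => (Num.sqrt n%:R)^-1 : R) @ \oo --> 0.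
Proof.
rewrite -cvg_shiftS /=.
have -> : (fun n => (Num.sqrt n.+1%:R)^-1 : R) = (fun n => Num.sqrt (harmonic n)).
  by apply/funext => n; rewrite /harmonic sqrtrV.
suff : (fun n => Num.sqrt (harmonic n)) @ \oo --> Num.sqrt (0 : R) by rewrite sqrtr0.
by apply: cvg_comp; [exact: cvg_harmonic | exact: sqrt_continuous].
Qed.

Lemma sqr_sqrtV n : ((Num.sqrt n%:R)^-1 : R) ^+ 2 = n%:R^-1.
Proof. by rewrite exprVn sqr_sqrtr. Qed.

Lemma law_var_cvg : (fun n => var n / n%:R) @ \oo --> s.
Proof.
rewrite -cvg_shiftS /=.
have -> : (fun n => var n.+1 / n.+1%:R) = (fun n => s + (var n.+1 - s * n.+1%:R) / n.+1%:R).
  by apply/funext => n; rewrite mulrBl mulfK // addrC subrK.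
rewrite -[X in _ --> (X : R)]addr0; apply: cvgD; first exact: cvg_cst.
apply/cvgr0Pnorm_lt => eps eps0.
have H : (fun n => (C + `|s| * k%:R) * harmonic n) @ \oo --> 0.
  by rewrite -(mulr0 (C + `|s| * k%:R)); apply: cvgM; [exact: cvg_cst | exact: cvg_harmonic].
have C0 : 0 <= C by apply: le_trans (mean_bound 0%N).
move/cvgr0Pnorm_lt : H => /(_ _ eps0); apply: filterS => n; apply: le_lt_trans.
rewrite !normrM [`|harmonic n|]ger0_norm ?invr_ge0 //.
rewrite ler_wpM2r ?invr_ge0 //.
rewrite [leRHS]ger0_norm ?addr_ge0 ?mulr_ge0 //.
have := var_bound n.+1; rewrite -/var natrD mulrDr => H.
have -> : var n.+1 - s * n.+1%:R = (var n.+1 - (s * n.+1%:R + s * k%:R)) + s * k%:R by ring.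
apply: le_trans (ler_normD _ _) _; rewrite lerD // normrM ler_wpM2l //.
by rewrite ger0_norm.
Qed.

Lemma law_var_limit_ge0 : 0 <= s.
Proof.
apply: (cvgr_to_ge law_var_cvg); apply: nearW => n.
by rewrite divr_ge0 // law_var_ge0.
Qed.

(** For [u = n^(-1/2)] the error [u ^ 3 (n + k - 1)] is at most [(1 + k) u]. *)
Lemma law_cos_cvg al :
  (fun n => lw n (fun x => cos ((Num.sqrt n%:R)^-1 * (g x - mean n) + al))) @ \oo
  --> expR (- (s / 2)) * cos al.
Proof.
have [A A0 HA] := law_cos_bound.
pose u n : R := (Num.sqrt n%:R)^-1.
have -> : (fun n => lw n (fun x => cos ((Num.sqrt n%:R)^-1 * (g x - mean n) + al))) =
  (fun n => expR (- (var n / n%:R / 2)) * cos al +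
    (lw n (fun x => cos (u n * (g x - mean n) + al)) - expR (- (var n * u n ^+ 2 / 2)) * cos al)).
  by apply/funext => n; rewrite /u sqr_sqrtV addrC subrK.
rewrite -[X in _ --> (X : R)]addr0; apply: cvgD.
  apply: cvgM; last exact: cvg_cst.
  apply: (@cvg_comp _ _ _ (fun n => - (var n / n%:R / 2)) expR _ (nbhs (- (s / 2)))); last exact: continuous_expR.
  by apply: cvgN; apply: cvgM; [exact: law_var_cvg | exact: cvg_cst].
apply/cvgr0Pnorm_lt => eps eps0.
have H : (fun n => A * (1 + k%:R) * u n) @ \oo --> (0 : R).
  by rewrite -(mulr0 (A * (1 + k%:R))); apply: cvgM; [exact: cvg_cst | exact: cvg_sqrtV].
move/cvgr0Pnorm_lt : H => /(_ _ eps0) H.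
have n1 : \forall n \near \oo, (0 < n)%N by exists 1%N.
apply: filterS2 H n1 => n + n0; apply: le_lt_trans.
have u0 : 0 <= u n by rewrite invr_ge0 sqrtr_ge0.
have u1 : u n <= 1.
  by rewrite -(@expr_le1 _ 2 (u n)) // sqr_sqrtV invf_le1 ?ltr0n // ler1n.
apply: le_trans (HA n (u n) al _) _; first by rewrite u0.
rewrite [leRHS]ger0_norm ?mulr_ge0 ?addr_ge0 // -[leLHS]mulrA -[A * _ * u n]mulrA.
apply: ler_wpM2l => //.
have h : n%:R^-1 * (n + k).-1%:R <= 1 + k%:R :> R.
  rewrite ler_pdivrMl ?ltr0n // -[1]/(1%:R) -natrD -natrM ler_nat.
  by clear -n0; nia.
have -> : u n ^+ 3 * (n + k).-1%:R = u n * (u n ^+ 2 * (n + k).-1%:R) by ring.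
by rewrite sqr_sqrtV [leRHS]mulrC ler_wpM2l.
Qed.

End central_limit.

End law_moments.

(** * Trigonometric approximation and weak convergence *)

Section bernstein.
Variable R : realType.
Implicit Types (u c : R) (g h : nat -> R).

(** Mean of [g] at a binomial variable of parameters [n] and [u], by conditioning on one trial. In
    this form affinity, monotonicity and variance follow by direct inductions, free of binomial
    coefficients. *)
Fixpoint bern n u g : R :=
  if n is n'.+1 then u * bern n' u (g \o succn) + (1 - u) * bern n' u g else g 0%N.

Lemma bern_affine n u a c g : bern n u (fun j => a * g j + c) = a * bern n u g + c.
Proof.
elim: n g => [|n IH] g //=; rewrite [bern n u (_ \o succn)](IH (g \o succn)) IH; ring.
Qed.

Lemma ler_bern n u g h : 0 <= u <= 1 -> (forall j, (j <= n)%N -> g j <= h j) ->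
  bern n u g <= bern n u h.
Proof.
move=> /andP[u0 u1]; elim: n g h => [|n IH] g h gh /=; first exact: gh.
apply: lerD; apply: ler_wpM2l; rewrite ?subr_ge0 //; apply: IH => j jn /=.
  exact: gh.
by apply: gh; apply: leq_trans jn _.
Qed.

Lemma ler_norm_bern n u c g h : 0 <= u <= 1 ->
  (forall j, (j <= n)%N -> `|g j - c| <= h j) -> `|bern n u g - c| <= bern n u h.
Proof.
move=> u01 gh; rewrite ler_norml; apply/andP; split.
  have : bern n u (fun j => (-1) * h j + c) <= bern n u g.
    apply: ler_bern => // j /gh; rewrite ler_norml => /andP[+ _]; lra.
  by rewrite bern_affine; lra.
have : bern n u g <= bern n u (fun j => 1 * h j + c).
  apply: ler_bern => // j /gh; rewrite ler_norml => /andP[_]; lra.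
by rewrite bern_affine; lra.
Qed.

Lemma bern_sqr n u c :
  bern n u (fun j => (j%:R - c) ^+ 2) = n%:R * (u * (1 - u)) + (n%:R * u - c) ^+ 2.
Proof.
elim: n c => [|n IH] c /=; first by rewrite mulr0n; ring.
have -> : (fun j => (j%:R - c) ^+ 2) \o succn = fun j => (j%:R - (c - 1)) ^+ 2.
  by apply/funext => j /=; rewrite -natr1; congr (_ ^+ 2); ring.
by rewrite !IH -natr1; ring.
Qed.

(** For [p] the half sum and [q] the half difference, [|p| + q <= pi / 2], so the factor [cos p] is
    at least [sin q]. The derivative of the sine vanishes at the ends of the interval, whence the
    square. *)
Lemma sin_separation (a b eta : R) : a \in `[- (pi / 2), pi / 2] ->
  b \in `[- (pi / 2), pi / 2] -> 0 < eta <= pi / 2 -> 2 * eta <= `|a - b| ->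
  2 * sin eta ^+ 2 <= `|sin a - sin b|.
Proof.
move=> ha hb /andP[e0 e1].
wlog ab : a b ha hb / b <= a.
  move=> H; have [|ab] := leP b a; first exact: H.
  by rewrite distrC [`|sin a - _|]distrC; apply: H => //; apply: ltW.
rewrite ger0_norm ?subr_ge0 // => hab.
move: ha hb; rewrite !in_itv /= => /andP[a0 a1] /andP[b0 b1].
pose p := (a + b) / 2; pose q := (a - b) / 2.
have -> : sin a - sin b = 2 * (cos p * sin q).
  have -> : a = p + q by rewrite /p /q; field.
  have -> : b = p - q by rewrite /p /q; field.
  rewrite sinD sinB; ring.
have qe : eta <= q by rewrite /q; lra.
have q1 : q <= pi / 2 by rewrite /q; lra.
have sq : sin eta <= sin q.
  by rewrite leNgt ltr_sin -?leNgt // in_itv /=; apply/andP; split; lra.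
have s0 : 0 <= sin eta by rewrite sin_ge0_pi //; apply/andP; split; lra.
have cp : sin q <= cos p.
  rewrite -[cos p]cos_norm -cosBpihalf -cosN opprB.
  rewrite leNgt ltr_cos -?leNgt ?in_itv /= ?normr_ge0 /=.
  - by rewrite ler_norml; apply/andP; split; rewrite /p /q; lra.
  - by apply/andP; split; lra.
  - by rewrite ler_norml; apply/andP; split; rewrite /p; lra.
have : sin eta ^+ 2 <= cos p * sin q.
  by rewrite expr2; apply: ler_pM => //; apply: le_trans cp.
by move=> ?; apply: le_trans (ler_norm _); lra.
Qed.

End bernstein.

(** * Linear forms and boxes *)

Section vectors.
Variables (R : realType) (m : nat).
Local Notation V := 'cV[R]_m.
Implicit Types (x t : V) (i j : 'I_m).

Definition lin t x : R := (t^T *m x) 0 0.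

Lemma linE t x : lin t x = \sum_i t i 0 * x i 0.
Proof. by rewrite /lin mxE; apply: eq_bigr => i _; rewrite mxE. Qed.

Lemma linD t x y : lin t (x + y) = lin t x + lin t y.
Proof. by rewrite /lin mulmxDr mxE. Qed.

Lemma lin_addl t s x : lin (t + s) x = lin t x + lin s x.
Proof. by rewrite /lin linearD mulmxDl mxE. Qed.

Lemma lin_oppl t x : lin (- t) x = - lin t x.
Proof. by rewrite /lin linearN mulNmx mxE. Qed.

Lemma lin_scalel a t x : lin (a *: t) x = a * lin t x.
Proof. by rewrite /lin linearZ -scalemxAl mxE. Qed.

Lemma lin_scaler a t x : lin t (a *: x) = a * lin t x.
Proof. by rewrite /lin -scalemxAr mxE. Qed.

Lemma lin0 x : lin 0 x = 0.
Proof. by rewrite /lin trmx0 mul0mx mxE. Qed.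

Lemma lin_delta i x : lin (delta_mx i 0) x = x i 0.
Proof.
rewrite linE (bigD1 i) //= mxE !eqxx mul1r big1 ?addr0 //.
by move=> j /negbTE ji; rewrite mxE ji mul0r.
Qed.

Lemma lin_continuous t : continuous (lin t : V -> R).
Proof.
have -> : (lin t : V -> R) = \sum_i (fun x : V => t i 0 * x i 0).
  by apply/funext => x; rewrite linE fct_sumE.
elim/big_ind: _ => [x|f g cf cg x|i _ x].
- exact: cst_continuous.
- exact: (continuousD (cf x) (cg x)).
- exact: (continuousM (@cst_continuous _ _ (t i 0) x) (@coord_continuous R m 1 i 0 x)).
Qed.

Definition box (L : R) : set V := [set x | forall i, `|x i 0| <= L].

Lemma compact_box L : compact (box L).
Proof.
have -> : box L = trmx @` [set v : 'rV[R]_m | forall i, `[(- L), L]%classic (v ord0 i)].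
  apply/seteqP; split => [x xL|_ [v vL <-] i]; last first.
    by rewrite mxE ler_norml; have := vL i; rewrite /= in_itv.
  exists x^T; last by rewrite trmxK.
  by move=> i /=; rewrite mxE in_itv /= -ler_norml.
apply: continuous_compact.
  apply: continuous_subspaceT => v A /= /nbhs_ballP[e e0 eA].
  apply/nbhs_ballP; exists e => // w [_ vw]; apply: eA; split=> // i j.
  by rewrite !mxE; exact: vw.
apply: (@rV_compact _ _ (fun=> `[(- L), L]%classic)) => i.
exact: segment_compact.
Qed.

Lemma continuous_uniform_box (f : V -> R) L eps : continuous f -> 0 < eps ->
  exists2 delta, 0 < delta &
  forall x z, box L x -> ball x delta z -> `|f z - f x| <= eps.
Proof.
move=> cf eps0; have := @compact_box L; rewrite compact_near_coveringP.
pose P d (x : V) := forall z, ball x d z -> `|f z - f x| <= eps.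
move=> /(_ _ (0 : R)^'+ P _) [|d /= d0 Hd].
  move=> x _; have e20 : 0 < eps / 2 by rewrite divr_gt0.
  have /cvgr_dist_lt /(_ _ e20) := cf x.
  move=> /nbhs_ballP[r /= r0 Hr].
  exists (ball x (r / 2), [set d : R | d <= r / 2]); first split.
  - by apply: nbhsx_ballx; rewrite divr_gt0.
  - by near=> d; near: d; apply: nbhs_right_le; rewrite divr_gt0.
  move=> [x' d] [/= xx' dr] z xz.
  have h1 : `|f x - f x'| < eps / 2 by apply: Hr; apply: le_ball xx'; lra.
  have h2 : `|f x - f z| < eps / 2.
    apply: Hr; rewrite (splitr r); apply: ball_triangle xx' _.
    exact: le_ball dr _ xz.
  have -> : f z - f x' = (f x - f x') - (f x - f z) by ring.
  by apply: le_trans (ler_normB _ _) _; lra.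
exists (d / 2); first by rewrite divr_gt0.
by move=> x z xL; apply: (Hd (d / 2)) => //=; 
  [rewrite sub0r normrN gtr0_norm; lra | lra].
Unshelve. all: by end_near. Qed.

Definition upd x i (y : R) : V := \col_j (if j == i then y else x j 0).

Lemma upd_ball x i y d : `|x i 0 - y| < d -> ball x d (upd x i y).
Proof.
move=> h; split; first exact: le_lt_trans (normr_ge0 _) h.
move=> j l; rewrite mxE ord1; case: eqP => [->|_] //.
by apply: ballxx; apply: le_lt_trans (normr_ge0 _) h.
Qed.

Lemma upd_box L x i y : box L x -> `|y| <= L -> box L (upd x i y).
Proof. by move=> xL yL j; rewrite mxE; case: eqP. Qed.

Lemma lin_upd t x i y : lin t (upd x i y) = lin (upd t i 0) x + t i 0 * y.
Proof.
rewrite !linE (bigD1 i) //= [in RHS](bigD1 i) //= !mxE eqxx mul0r add0r addrC.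
by congr (_ + _); apply: eq_bigr => j /negbTE ji; rewrite !mxE ji.
Qed.

End vectors.

Section trigonometric.
Variables (R : realType) (m : nat).
Local Notation V := 'cV[R]_m.
Implicit Types (x t : V) (i j : 'I_m) (s : seq 'I_m) (f p q : V -> R).

(* Trigonometric polynomials in the coordinates of index in [s], with arbitrary
   functions of the other coordinates as coefficients. *)
Inductive trig s : (V -> R) -> Prop :=
| trig_term (c : V -> R) t al :
    (forall x y : V, (forall i, i \notin s -> x i 0 = y i 0) -> c x = c y) ->
    trig s (fun x => c x * cos (lin t x + al))
| trig_add p q : trig s p -> trig s q -> trig s (fun x => p x + q x).

Lemma trig_scale s a p : trig s p -> trig s (fun x => a * p x).
Proof.
elim=> [c t al hc|{}p q _ hp _ hq].
  have -> : (fun x => a * (c x * cos (lin t x + al))) =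
    fun x => (a * c x) * cos (lin t x + al) by apply/funext => x; rewrite mulrA.
  by apply: trig_term => x y /hc ->.
have -> : (fun x => a * (p x + q x)) = fun x => a * p x + a * q x.
  by apply/funext => x; rewrite mulrDr.
exact: trig_add.
Qed.

Lemma trig_cos s p t al : trig s p -> trig s (fun x => cos (lin t x + al) * p x).
Proof.
elim=> [c u be hc|{}p q _ hp _ hq].
  have -> : (fun x => cos (lin t x + al) * (c x * cos (lin u x + be))) =
    fun x => (c x / 2) * cos (lin (t + u) x + (al + be)) +
             (c x / 2) * cos (lin (t - u) x + (al - be)).
    apply/funext => x; rewrite !lin_addl lin_oppl.
    have -> : lin t x + lin u x + (al + be) = (lin t x + al) + (lin u x + be) by ring.
    have -> : lin t x - lin u x + (al - be) = (lin t x + al) - (lin u x + be) by ring.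
    rewrite (cosD (lin t x + al)) (cosB (lin t x + al)); by field.
  by apply: trig_add; apply: trig_term => x y /hc ->.
have -> : (fun x => cos (lin t x + al) * (p x + q x)) =
    fun x => cos (lin t x + al) * p x + cos (lin t x + al) * q x.
  by apply/funext => x; rewrite mulrDr.
exact: trig_add.
Qed.

(** Once coordinate [i] is frozen, the coefficients no longer depend on it, so it may join the list
    of trigonometric coordinates. *)
Lemma trig_upd s p i y : trig s p -> trig (i :: s) (fun x => p (upd x i y)).
Proof.
elim=> [c t al hc|{}p q _ hp _ hq]; last exact: trig_add.
have -> : (fun x => c (upd x i y) * cos (lin t (upd x i y) + al)) =
    fun x => c (upd x i y) * cos (lin (upd t i 0) x + (t i 0 * y + al)).
  by apply/funext => x; rewrite lin_upd addrA.
apply: trig_term => x z xz; apply: hc => j js; rewrite !mxE; case: eqP => // /eqP ji.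
by apply: xz; rewrite inE negb_or ji.
Qed.

Definition sine_coord (b : R) i x : R := (1 + sin (b * x i 0)) / 2.

Lemma sine_coord01 b i x : 0 <= sine_coord b i x <= 1.
Proof.
by rewrite /sine_coord; have := sin_geN1 (b * x i 0); have := sin_le1 (b * x i 0); lra.
Qed.

Lemma trig_bern s b i n (g : nat -> V -> R) : (forall l, trig s (g l)) ->
  trig s (fun x => bern n (sine_coord b i x) (fun l => g l x)).
Proof.
elim: n g => [|n IH] g hg //=.
have h1 := IH (fun l => g l.+1) (fun l => hg l.+1).
have h2 := IH g hg.
have E p u : (u = 1 \/ u = -1) -> trig s p ->
    trig s (fun x => (1 + u * sin (b * x i 0)) / 2 * p x).
  move=> hu hp.
  have -> : (fun x => (1 + u * sin (b * x i 0)) / 2 * p x) = fun x =>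
      2^-1 * p x + u / 2 * (cos (lin (b *: delta_mx i 0) x + - (pi / 2)) * p x).
    by apply/funext => x; rewrite lin_scalel lin_delta cosBpihalf; field.
  by apply: trig_add; apply: trig_scale => //; apply: trig_cos.
apply: trig_add; first by move: (E _ 1 (or_introl erefl) h1); congr trig;
  apply/funext => x; rewrite mul1r.
move: (E _ (-1) (or_intror erefl) h2); congr trig; apply/funext => x.
by rewrite /sine_coord; field.
Qed.

Section approximation.
Variables (f : V -> R) (M L : R).
Hypotheses (cf : continuous f) (fM : forall x, `|f x| <= M) (L0 : 0 < L).

(* With this frequency, sin (b x) is strictly increasing on [-L, L] and the
   nodes are the preimages of the Bernstein nodes j / n. *)
Let b := pi / (2 * L).
Let node n (j : nat) := b^-1 * asin (2 * (j%:R / n%:R) - 1).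

Let b0 : 0 < b. Proof. by rewrite divr_gt0 ?pi_gt0 // mulr_gt0. Qed.

(** Bernstein operator in coordinate [i]. Its variable [(1 + sin (b x_i)) / 2] lies in [0, 1] for
    every real [x_i], so a bound on [g] is preserved on the whole space and not only on the box. *)
Let step n i (g : V -> R) x := bern n (sine_coord b i x) (fun l : nat => g (upd x i (node n l))).

Let ratio01 n (j : nat) : (j <= n)%N -> -1 <= 2 * (j%:R / n%:R : R) - 1 <= 1.
Proof.
case: n => [|n] jn; first by rewrite invr0 !mulr0; apply/andP; split; lra.
have : 0 <= (j%:R / n.+1%:R : R) <= 1.
  by rewrite divr_ge0 //= ler_pdivrMr // mul1r ler_nat.
by move: (_ / _) => r; lra.
Qed.

Let node_le n (j : nat) : (j <= n)%N -> `|node n j| <= L.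
Proof.
move=> jn; have h := ratio01 jn.
rewrite normrM gtr0_norm ?invr_gt0 // ler_pdivrMl //.
have -> : b * L = pi / 2 by rewrite /b; field; rewrite gt_eqF.
by rewrite ler_norml asin_geNpi2 // asin_lepi2.
Qed.

Let b_box x i : box L x -> b * x i 0 \in `[- (pi / 2), pi / 2].
Proof.
move=> xL; have := xL i; rewrite in_itv /= -ler_norml normrM (gtr0_norm b0) => h.
apply: le_trans (ler_wpM2l (ltW b0) h) _.
by rewrite le_eqVlt; apply/orP; left; apply/eqP; rewrite /b; field; rewrite gt_eqF.
Qed.

Lemma step_bound n i g : (forall x, `|g x| <= M) -> forall x, `|step n i g x| <= M.
Proof.
move=> gM x; rewrite /step -[X in `|X|]subr0.
apply: le_trans (ler_norm_bern (h := fun l => 0 * l%:R + M) (sine_coord01 b i x) _) _.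
  by move=> j _; rewrite subr0 mul0r add0r.
by rewrite bern_affine mul0r add0r.
Qed.

Lemma step_contract n i g h e : (forall x, box L x -> `|g x - h x| <= e) ->
  forall x, box L x -> `|step n i g x - step n i h x| <= e.
Proof.
move=> gh x xL.
have -> : step n i g x - step n i h x = bern n (sine_coord b i x)
    (fun l : nat => g (upd x i (node n l)) - h (upd x i (node n l))) - 0.
  rewrite subr0 /step.
  elim: n (node n) => [|n' IH] nd //=; rewrite /comp.
  by rewrite -(IH (fun l => nd l.+1)) -IH; ring.
apply: le_trans (ler_norm_bern (h := fun l => 0 * l%:R + e) (sine_coord01 b i x) _) _.
  by move=> j jn; rewrite subr0 mul0r add0r; apply/gh/upd_box/node_le.
by rewrite bern_affine mul0r add0r.
Qed.

Lemma step_approx i eps : 0 < eps ->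
  exists n, forall x, box L x -> `|step n i f x - f x| <= eps.
Proof.
move=> e0; have e20 : 0 < eps / 2 by rewrite divr_gt0.
have [d d0 Hd] := continuous_uniform_box L cf e20.
have M0 : 0 <= M by apply: le_trans (normr_ge0 _) (fM 0).
pose eta := Num.min (b * d / 2) (pi / 2).
have eta0 : 0 < eta by rewrite lt_min !divr_gt0 ?pi_gt0 // mulr_gt0.
have etapi : eta <= pi / 2 by rewrite ge_min lexx orbT.
have etad : 2 * eta <= b * d by have : eta <= b * d / 2 by [rewrite ge_min lexx]; lra.
pose kap := sin eta ^+ 2.
have kap0 : 0 < kap.
  rewrite exprn_gt0 // sin_gt0_pi // eta0 /=; apply: le_lt_trans etapi _.
  by have := pi_gt0 R; lra.
(* A node at distance at least [d] from [x_i] has [|u - j / n| >= kap], so [D (u - j / n) ^ 2]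
   exceeds the trivial bound [2 M]; by the binomial variance these terms average to at most
   [D / n]. *)
pose D := 2 * M / kap ^+ 2.
have D0 : 0 <= D by apply: divr_ge0; [exact: mulr_ge0 | exact: sqr_ge0].
have [n n0 Hn] : exists2 n, (0 < n)%N & D / n%:R <= eps / 2.
  exists (Num.truncn (D / (eps / 2))).+1 => //.
  rewrite ler_pdivrMr // mulrC -ler_pdivrMr //.
  by apply: ltW; apply: truncnS_gt.
exists n => x xL; have nR : 0 < n%:R :> R by rewrite ltr0n.
set u := sine_coord b i x.
have H (j : nat) : (j <= n)%N -> `|f (upd x i (node n j)) - f x| <=
    D / n%:R ^+ 2 * (j%:R - n%:R * u) ^+ 2 + eps / 2.
  move=> jn; have [near_x|far_x] := ltP `|x i 0 - node n j| d.
    apply: le_trans (Hd _ _ xL (upd_ball near_x)) _.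
    by rewrite lerDr mulr_ge0 ?sqr_ge0 // divr_ge0 ?sqr_ge0.
  apply: le_trans (ler_normB _ _) _.
  apply: le_trans (lerD (fM _) (fM _)) _.
  have h : 2 * eta <= `|b * x i 0 - asin (2 * (j%:R / n%:R) - 1)|.
    have -> : asin (2 * (j%:R / n%:R) - 1) = b * node n j.
      by rewrite [RHS]mulrA divff ?mul1r // gt_eqF.
    rewrite -mulrBr normrM gtr0_norm //; apply: le_trans etad _.
    by rewrite ler_pM2l.
  have hj : asin (2 * (j%:R / n%:R) - 1) \in `[- (pi / 2), pi / 2 : R].
    by rewrite in_itv /= asin_geNpi2 ?asin_lepi2 // ratio01.
  have := sin_separation (b_box i xL) hj _ h; rewrite eta0 etapi => /(_ isT).
  rewrite asinK ?in_itv ?ratio01 //.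
  have -> : sin (b * x i 0) - (2 * (j%:R / n%:R) - 1) = 2 * (u - j%:R / n%:R).
    by rewrite /u /sine_coord; field; rewrite gt_eqF.
  rewrite normrM ger0_norm // ler_pM2l // -/kap => hk.
  have h2 : kap ^+ 2 <= (u - j%:R / n%:R) ^+ 2.
    by rewrite -[leRHS]real_normK ?num_real // !expr2; apply: ler_pM => //; apply: ltW.
  have -> : D / n%:R ^+ 2 * (j%:R - n%:R * u) ^+ 2 = D * (u - j%:R / n%:R) ^+ 2.
    by field; rewrite gt_eqF.
  have : D * kap ^+ 2 <= D * (u - j%:R / n%:R) ^+ 2 by rewrite ler_wpM2l.
  have -> : D * kap ^+ 2 = M + M by rewrite /D; field; rewrite gt_eqF.
  by lra.
apply: le_trans (ler_norm_bern (sine_coord01 b i x) H) _.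
rewrite bern_affine bern_sqr subrr expr0n /= addr0 -/u.
have -> : D / n%:R ^+ 2 * (n%:R * (u * (1 - u))) = D / n%:R * (u * (1 - u)).
  by field; rewrite gt_eqF.
have u1 : u * (1 - u) <= 1 by have := sqr_ge0 (u - 2^-1); nra.
have : D / n%:R * (u * (1 - u)) <= D / n%:R by rewrite ler_piMr // divr_ge0.
lra.
Qed.

(* The coordinates are treated one after the other; the operators [step] contract
   the sup norm on the box, so the errors add up. *)
Lemma trig_approx_seq s eps : 0 < eps -> exists p, [/\ trig s p,
  forall x, `|p x| <= M & forall x, box L x -> `|p x - f x| <= eps *+ size s].
Proof.
move=> e0; elim: s => [|i s [p [tp pM pf]]].
  exists f; split=> //; last by move=> x _; rewrite subrr normr0.
  have -> : f = fun x => f x * cos (lin 0 x + 0).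
    by apply/funext => x; rewrite lin0 addr0 cos0 mulr1.
  apply: trig_term => x y xy; congr f; apply/colP => i; exact: xy.
have [n Hn] := step_approx i e0.
exists (step n i p); split.
- by apply: trig_bern => l; apply: trig_upd.
- exact: step_bound.
- move=> x xL /=; rewrite mulrS.
  have -> : step n i p x - f x = (step n i f x - f x) + (step n i p x - step n i f x) by ring.
  apply: le_trans (ler_normD _ _) _; apply: lerD; first exact: Hn.
  exact: step_contract.
Qed.

End approximation.

Lemma trig_approx f M L eps : continuous f -> (forall x, `|f x| <= M) ->
  0 < L -> 0 < eps -> exists p, [/\ trig (enum 'I_m) p,
  forall x, `|p x| <= M & forall x, box L x -> `|p x - f x| <= eps].
Proof.
move=> cf fM L0 e0; have e'0 : 0 < eps / m.+1%:R by rewrite divr_gt0.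
have [p [tp pM pf]] := trig_approx_seq cf fM L0 (enum 'I_m) e'0.
exists p; split=> // x /pf; move/le_trans; apply.
rewrite size_enum_ord -[_ *+ m]mulr_natr mulrAC ler_pdivrMr // ler_pM2l //.
by rewrite ler_nat.
Qed.

End trigonometric.

(** * Weak convergence from trigonometric test functions and tightness *)

Section weak_convergence.
Variables (R : realType) (m : nat).
Local Notation V := 'cV[R]_m.
Implicit Types (f g : V -> R) (E : (V -> R) -> R).

Definition bounded_continuous f := continuous f /\ exists M, forall x, `|f x| <= M.

(** A common notion for integrals against a measure and for the functionals [law], which are defined
    by recursion. *)
Definition expectation_like E := [/\
  forall f g, bounded_continuous f -> bounded_continuous g ->
    E (fun x => f x + g x) = E f + E g,
  forall a f, bounded_continuous f -> E (fun x => a * f x) = a * E f,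
  forall f g, bounded_continuous f -> bounded_continuous g ->
    (forall x, f x <= g x) -> E f <= E g &
  E (fun=> 1) = 1].

(** Phrased with continuous functions vanishing on a box instead of the probability of its
    complement, so that it makes sense for functionals. *)
Definition tight (E : nat -> (V -> R) -> R) := forall eps, 0 < eps ->
  exists2 L, 0 < L & forall n h, bounded_continuous h ->
    (forall x, 0 <= h x <= 1) -> (forall x, box L x -> h x = 0) -> E n h <= eps.

Lemma bounded_continuousD f g : bounded_continuous f -> bounded_continuous g ->
  bounded_continuous (fun x => f x + g x).
Proof.
move=> [cf [M fM]] [cg [N gN]]; split.
  by move=> x; exact: (continuousD (cf x) (cg x)).
by exists (M + N) => x; apply: le_trans (ler_normD _ _) _; apply: lerD.
Qed.

Lemma bounded_continuousZ a f : bounded_continuous f ->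
  bounded_continuous (fun x => a * f x).
Proof.
move=> [cf [M fM]]; split.
  by move=> x; exact: (continuousM (@cst_continuous _ _ a x) (cf x)).
by exists (`|a| * M) => x; rewrite normrM ler_wpM2l.
Qed.

Lemma bounded_continuous_cst a : bounded_continuous (fun=> a).
Proof. by split; [exact: cst_continuous | exists `|a|]. Qed.

Lemma bounded_continuous_cos t al :
  bounded_continuous (fun x : V => cos (lin t x + al)).
Proof.
split; last by exists 1 => x; exact: cos_max.
move=> x; apply: (@continuous_comp _ _ _ (fun x : V => lin t x + al) cos).
  exact: (continuousD (@lin_continuous R m t x) (@cst_continuous _ _ al x)).
exact: continuous_cos.
Qed.

Lemma bounded_continuous_trig p : trig (enum 'I_m) p -> bounded_continuous p.
Proof.
elim=> [c t al hc|{}p q _ hp _ hq]; last exact: bounded_continuousD.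
have -> : (fun x => c x * cos (lin t x + al)) = fun x => c 0 * cos (lin t x + al).
  by apply/funext => x; rewrite (hc x 0) // => i; rewrite mem_enum.
exact/bounded_continuousZ/bounded_continuous_cos.
Qed.

Lemma expectation_like_cst E a : expectation_like E -> E (fun=> a) = a.
Proof.
case=> _ EZ _ E1; rewrite -[RHS]mulr1 -E1 -EZ; last exact: bounded_continuous_cst.
by congr E; apply/funext => x; rewrite mulr1.
Qed.

Lemma expectation_like_close E f g h eps c : expectation_like E ->
  bounded_continuous f -> bounded_continuous g -> bounded_continuous h ->
  (forall x, `|f x - g x| <= eps + c * h x) -> `|E f - E g| <= eps + c * E h.
Proof.
move=> hE bf bg bh fgh; have [ED EZ Ele E1] := hE.
have bch := bounded_continuousZ c bh.
have be := bounded_continuous_cst eps.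
have F u v : bounded_continuous u -> bounded_continuous v ->
    (forall x, u x <= v x + (eps + c * h x)) -> E u <= E v + (eps + c * E h).
  move=> bu bv uv.
  rewrite -EZ // -[X in _ <= _ + (X + _)](expectation_like_cst eps hE) -!ED //.
    by apply: Ele => //; do 2![apply: bounded_continuousD => //].
  exact: bounded_continuousD.
rewrite ler_norml; apply/andP; split.
  suff : E g <= E f + (eps + c * E h) by lra.
  by apply: F => // x; have := fgh x; rewrite ler_norml => /andP[]; lra.
suff : E f <= E g + (eps + c * E h) by lra.
by apply: F => // x; have := fgh x; rewrite ler_norml => /andP[_]; lra.
Qed.

Lemma weak_convergence (E : nat -> (V -> R) -> R) E' : (forall n, expectation_like (E n)) ->
  expectation_like E' -> tight E -> tight (fun=> E') ->
  (forall t al, (E ^~ (fun x => cos (lin t x + al))) @ \oo -->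
     E' (fun x => cos (lin t x + al))) ->
  forall f, bounded_continuous f -> (E ^~ f) @ \oo --> E' f.
Proof.
move=> hE hE' tE tE' cE f bf; have [cf [M fM]] := bf.
have M0 : 0 <= M by apply: le_trans (normr_ge0 _) (fM 0).
apply/cvgrPdist_le => eps e0.
(* Replacing [f] by [p] then costs at most [d + (1 + 2 M) d = eps / 3] under either expectation. *)
pose d := eps / (3 * (2 + 2 * M)).
have M2 : 0 < 3 * (2 + 2 * M) by lra.
have d0 : 0 < d by rewrite divr_gt0.
have [L1 L10 HL1] := tE _ d0; have [L2 L20 HL2] := tE' _ d0.
pose L := Num.max L1 L2.
have L0 : 0 < L by rewrite lt_max L10.
have [p [tp pM pf]] := trig_approx cf fM L0 d0.
have bp := bounded_continuous_trig tp.
(* The excess of [|f - p|] over [d], scaled into [0, 1] thanks to the global bound on [p]; it is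
   continuous and vanishes on the box, hence is controlled by tightness. *)
pose h x := Num.max 0 (`|f x - p x| - d) / (1 + 2 * M).
have N0 : 0 < 1 + 2 * M by lra.
have h01 x : 0 <= h x <= 1.
  apply/andP; split; first by rewrite divr_ge0 ?le_max ?lexx // ltW.
  rewrite ler_pdivrMr // mul1r ge_max (ltW N0) /=.
  have := ler_normB (f x) (p x); have := fM x; have := pM x; lra.
have bh : bounded_continuous h.
  split; last by exists 1 => x; rewrite ger0_norm; case/andP: (h01 x).
  have cd x : {for x, continuous (fun x => `|f x - p x| - d)}.
    have [cp _] := bp.
    apply: (@continuousB _ _ _ (fun x => `|f x - p x|) (cst d)) (@cst_continuous _ _ d x).
    apply: (@continuous_comp _ _ _ (fun x => f x - p x) Num.norm).
      exact: (continuousB (cf x) (cp x)).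
    exact: norm_continuous.
  move=> x.
  apply: (@continuousM _ _ (fun x => Num.max 0 (`|f x - p x| - d)) (cst (1 + 2 * M)^-1)) (@cst_continuous _ _ _ x).
  exact: (continuous_max (@cst_continuous _ _ 0 x) (cd x)).
have hL x : box L x -> h x = 0.
  move=> /pf; rewrite distrC => hx; rewrite /h max_l ?mul0r //; lra.
have fph x : `|f x - p x| <= d + (1 + 2 * M) * h x.
  rewrite /h mulrC divfK ?gt_eqF //.
  have : `|f x - p x| - d <= Num.max 0 (`|f x - p x| - d) by rewrite le_max lexx orbT.
  lra.
have close F : expectation_like F -> F h <= d -> `|F f - F p| <= d * (2 + 2 * M).
  move=> hF Fh; have := expectation_like_close hF bf bp bh fph.
  move/le_trans; apply; have : (1 + 2 * M) * F h <= (1 + 2 * M) * d by rewrite ler_wpM2l // ltW.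
  lra.
have subL L' : L' <= L -> forall x, box L' x -> box L x.
  by move=> LL x xL i; apply: le_trans (xL i) LL.
have cp : (E ^~ p) @ \oo --> E' p.
  elim: tp => [c t al hc|p1 p2 tp1 hp1 tp2 hp2].
    have -> : (fun x => c x * cos (lin t x + al)) = fun x => c 0 * cos (lin t x + al).
      by apply/funext => x; rewrite (hc x 0) // => i; rewrite mem_enum.
    have bc := bounded_continuous_cos t al.
    have [_ EZ' _ _] := hE'; rewrite EZ' //.
    under eq_fun => n do rewrite (let: And4 _ EZ _ _ := hE n in EZ) //.
    by apply: cvgM; [exact: cvg_cst | exact: cE].
  have [ED' _ _ _] := hE'.
  have bp1 := bounded_continuous_trig tp1; have bp2 := bounded_continuous_trig tp2.
  rewrite ED' //; under eq_fun => n do rewrite (let: And4 ED _ _ _ := hE n in ED) //.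
  exact: cvgD.
have e30 : 0 < eps / 3 by lra.
have dE : d * (2 + 2 * M) = eps / 3 by rewrite /d; field; lra.
move/cvgrPdist_le: cp => /(_ _ e30); apply: filterS => n hn.
have h1 : `|E' f - E' p| <= eps / 3.
  rewrite -dE; apply: close => //; apply: (HL2 0%N) => // x xL.
  by apply: hL; apply: subL xL; rewrite le_max lexx orbT.
have h2 : `|E n f - E n p| <= eps / 3.
  rewrite -dE; apply: close => //; apply: HL1 => // x xL.
  by apply: hL; apply: subL xL; rewrite le_max lexx.
have -> : E' f - E n f = (E' f - E' p) + (E' p - E n p) - (E n f - E n p) by ring.
apply: le_trans (ler_normB _ _) _; apply: le_trans (lerD (ler_normD _ _) (lexx _)) _.
lra.
Qed.

End weak_convergence.

(** * Moments of the spacing vector *)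

Section spacing_moments.
Variables (R : realType) (k : nat).
Hypothesis k_gt0 : (0 < k)%N.
Local Notation V := 'cV[R]_k.-1.
Local Notation lw := (@law R V k (gap_value R k)).
Implicit Types (i j : 'I_k.-1) (t : V).

Definition entry i (x : V) : R := x i 0.
Definition mean_entry i n := law_mean k (gap_value R k) (entry i) n.
Definition defect i n := mean_entry i n - theta R k i.+1 * (n + k)%:R.

Let entryD i x y : entry i (x + y) = entry i x + entry i y.
Proof. by rewrite /entry mxE. Qed.

Let ordlt i : (i.+1 < k)%N. Proof. by case: i => i /=; lia. Qed.

Let mean_rec i : avg_rec k (mean_entry i) (fun=> 0).
Proof. exact: law_mean_rec. Qed.

Let mean_small i a : (a < k)%N -> mean_entry i a = (a == i.+1)%:R.
Proof. by move=> ak; rewrite /mean_entry /law_mean law_small // /entry mxE eq_sym. Qed.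

(** The recursion being homogeneous, any starting rate is available. From 1/64 the doublings lead to
    1/32 here, 1/16 for the convolution and 1/8 for the second moments, within the range required by
    [sigma_limit]. *)
Lemma defect_geo i : geo_bounded (1 / 32) (defect i).
Proof.
have g0 : geo_bounded (1 / 64) (fun=> 0 : R) by exists 0 => n; rewrite normr0 mul0r.
have r64 : 0 < (1 / 64 : R) < 1 by apply/andP; split; lra.
have r32 : 0 < (1 / 32 : R) < 2^-1 by apply/andP; split; lra.
have [l] := avg_rec_geo k_gt0 (mean_rec i) r64 g0.
have -> : 2 * (1 / 64) = 1 / 32 :> R by field.
move=> gl.
by rewrite /defect -(mean_limit k_gt0 (mean_rec i) (ordlt i) (mean_small i) r32 gl).
Qed.

Definition moment2 i j n := lw n (fun x =>
  (entry i x - theta R k i.+1 * (n + k)%:R) * (entry j x - theta R k j.+1 * (n + k)%:R)).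

Lemma moment2_geo i j :
  geo_bounded (1 / 8) (fun n => moment2 i j n - sigma R k i.+1 j.+1 * (n + k)%:R).
Proof.
pose b m : R := 2 * \sum_(a < m.+1) defect i a * defect j (m - a)%N.
have vb : avg_rec k (moment2 i j) b by exact: law_centered_rec.
have gb : geo_bounded (1 / 16) b.
  apply: geo_boundedZ; have -> : 1 / 16 = 2 * (1 / 32) :> R by field.
  by apply: geo_bounded_conv; [lra | exact: defect_geo | exact: defect_geo].
have r16 : 0 < (1 / 16 : R) < 1 by apply/andP; split; lra.
have [s] := avg_rec_geo k_gt0 vb r16 gb.
have -> : 2 * (1 / 16) = 1 / 8 :> R by field.
move=> gs.
have gd l : geo_bounded (1 / 16) (defect l).
  by apply: geo_boundedW (defect_geo l); apply/andP; split; lra.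
have gs' : geo_bounded (2 * (1 / 16)) (fun n => moment2 i j n - s * (n + k)%:R).
  by move: gs; congr geo_bounded; field.
have v_small a : (a < k)%N -> moment2 i j a = defect i a * defect j a.
  by move=> ak; rewrite /moment2 /defect /mean_entry /law_mean !law_small.
have r0 : 0 < (1 / 16 : R) < 4^-1 by apply/andP; split; lra.
have <- := sigma_limit k_gt0 (mean_rec i) (mean_rec j) (ordlt i) (ordlt j)
  (mean_small i) (mean_small j) r0 (gd i) (gd j) vb v_small gs'.
exact: gs.
Qed.

Lemma law_mean_lin t n : law_mean k (gap_value R k) (lin t) n = \sum_i t i 0 * mean_entry i n.
Proof.
rewrite /law_mean /mean_entry /law_mean -law_lin //.
by congr law; apply/funext => x; rewrite linE.
Qed.

Lemma law_var_lin t n : law_var k (gap_value R k) (lin t) n =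
  \sum_i \sum_j t i 0 * (t j 0 * (moment2 i j n - defect i n * defect j n)).
Proof.
rewrite /law_var law_mean_lin.
have E x : (lin t x - \sum_i t i 0 * mean_entry i n) ^+ 2 =
    \sum_i t i 0 * (\sum_j t j 0 * ((entry i x - mean_entry i n) * (entry j x - mean_entry j n))).
  rewrite linE -sumrB expr2 mulr_suml; apply: eq_bigr => i _.
  rewrite !mulr_sumr; apply: eq_bigr => j _; rewrite /entry; ring.
under eq_fun do rewrite E.
rewrite law_lin //; apply: eq_bigr => i _.
rewrite law_lin // mulr_sumr; apply: eq_bigr => j _.
congr (_ * (_ * _)); rewrite /moment2 !law_centered // /defect /mean_entry; ring.
Qed.

Lemma lin_mean_bound t : exists C, forall n,
  `|law_mean k (gap_value R k) (lin t) n - (\sum_i t i 0 * theta R k i.+1) * (n + k)%:R| <= C.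
Proof.
have : geo_bounded 1 (fun n => \sum_i t i 0 * defect i n).
  apply: geo_bounded_sum => i; apply: geo_boundedZ.
  by apply: geo_boundedW (defect_geo i); apply/andP; split; lra.
move=> [C HC]; exists C => n; have := HC n; rewrite expr1n mulr1; apply: le_trans.
rewrite le_eqVlt; apply/orP; left; apply/eqP; congr `|_|.
by rewrite law_mean_lin mulr_suml -sumrB; apply: eq_bigr => i _; rewrite /defect; ring.
Qed.

Lemma lin_var_bound t : exists C, forall n,
  `|law_var k (gap_value R k) (lin t) n - (t^T *m Sigma_mx R k *m t) 0 0 * (n + k)%:R| <= C.
Proof.
have H : geo_bounded 1 (fun n => \sum_i \sum_j t i 0 * (t j 0 *
    ((moment2 i j n - sigma R k i.+1 j.+1 * (n + k)%:R) - defect i n * defect j n))).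
  apply: geo_bounded_sum => i; apply: geo_bounded_sum => j; do 2!apply: geo_boundedZ.
  apply: geo_boundedB.
    by apply: geo_boundedW (moment2_geo i j); apply/andP; split; lra.
  have g1 l : geo_bounded 1 (defect l).
    by apply: geo_boundedW (defect_geo l); apply/andP; split; lra.
  have [C C0 HC] := geo_bounded_nonneg (g1 i).
  have [C' C'0 HC'] := geo_bounded_nonneg (g1 j).
  exists (C * C') => n; have := HC n; have := HC' n; rewrite !expr1n !mulr1 normrM => h h'.
  exact: ler_pM.
move: H => [C HC]; exists C => n; have := HC n; rewrite expr1n mulr1; apply: le_trans.
rewrite le_eqVlt; apply/orP; left; apply/eqP; congr `|_|.
rewrite law_var_lin -mulmxA mxE mulr_suml -sumrB; apply: eq_bigr => i _.
rewrite [(Sigma_mx R k *m t) _ _]mxE [t^T _ _]mxE mulr_sumr mulr_suml -sumrB; apply: eq_bigr => j _.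
rewrite mxE; ring.
Qed.

(** Nonnegativity is not visible in the formula for [sigma]; it holds because the form is the limit
    of the variances of [lin t] divided by [n]. *)
Lemma Sigma_form_ge0 t : 0 <= (t^T *m Sigma_mx R k *m t) 0 0.
Proof.
have [C HC] := lin_mean_bound t; have [C' HC'] := lin_var_bound t.
have h : forall n, `|law_mean k (gap_value R k) (lin t) n -
    (\sum_i t i 0 * theta R k i.+1) * (n + k)%:R| <= C + C'.
  by move=> n; apply: le_trans (HC n) _; rewrite lerDl; apply: le_trans (normr_ge0 _) (HC' 0%N).
apply: (law_var_limit_ge0 k_gt0 h) => n.
by apply: le_trans (HC' n) _; rewrite lerDr; apply: le_trans (normr_ge0 _) (HC 0%N).
Qed.

Lemma lin_cos_cvg t al :
  (fun n => lw n (fun x => cos ((Num.sqrt n%:R)^-1 *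
     (lin t x - law_mean k (gap_value R k) (lin t) n) + al))) @ \oo
  --> expR (- ((t^T *m Sigma_mx R k *m t) 0 0 / 2)) * cos al.
Proof.
have [C HC] := lin_mean_bound t; have [C' HC'] := lin_var_bound t.
apply: (@law_cos_cvg R V k (gap_value R k) k_gt0 (lin t) (@linD R k.-1 t)
  (\sum_i t i 0 * theta R k i.+1) _ (C + C')) => n.
  by apply: le_trans (HC n) _; rewrite lerDl; apply: le_trans (normr_ge0 _) (HC' 0%N).
by apply: le_trans (HC' n) _; rewrite lerDr; apply: le_trans (normr_ge0 _) (HC 0%N).
Qed.

Lemma entry_lin i : entry i = lin (delta_mx i 0).
Proof. by apply/funext => x; rewrite lin_delta. Qed.

Lemma entry_second_moment i : exists C, forall n,
  lw n (fun x => ((Num.sqrt n%:R)^-1 * (entry i x - mean_entry i n)) ^+ 2) <= C.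
Proof.
have [C HC] := lin_var_bound (delta_mx i 0).
set s := (_ *m _) 0 0 in HC.
exists (C + `|s| * (1 + k%:R)) => n.
have C0 : 0 <= C by apply: le_trans (normr_ge0 _) (HC 0%N).
have -> : lw n (fun x => ((Num.sqrt n%:R)^-1 * (entry i x - mean_entry i n)) ^+ 2) =
    n%:R^-1 * law_var k (gap_value R k) (lin (delta_mx i 0)) n.
  rewrite -sqr_sqrtV /law_var -lawZ // -entry_lin; congr law; apply/funext => x.
  by rewrite exprMn.
case: n => [|n]; first by rewrite invr0 mul0r addr_ge0 // mulr_ge0 // addr_ge0.
rewrite ler_pdivrMl //; have := HC n.+1; rewrite ler_norml => /andP[_].
have h1 : C <= n.+1%:R * C by rewrite ler_peMl // ler1n.
have h2 : s * (n.+1 + k)%:R <= `|s| * (n.+1 + k)%:R by rewrite ler_wpM2r // ler_norm.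
have h3 : `|s| * (n.+1 + k)%:R <= `|s| * (n.+1%:R * (1 + k%:R)).
  rewrite ler_wpM2l // -[1]/(1%:R) -natrD -natrM ler_nat; nia.
by lra.
Qed.

End spacing_moments.

(** * Random vectors *)

Lemma Rintegral_dominated d (T : measurableType d) (R : realType)
    (mu : {measure set T -> \bar R}) (D : set T) (f_ : nat -> T -> R) (f g : T -> R) :
  measurable D -> (forall n, measurable_fun D (f_ n)) ->
  (forall x, D x -> f_ ^~ x @ \oo --> f x) -> mu.-integrable D (EFin \o g) ->
  (forall n x, D x -> `|f_ n x| <= g x) ->
  (fun n => \int[mu]_(x in D) f_ n x) @ \oo --> \int[mu]_(x in D) f x.
Proof.
move=> mD mf ff ig fg.
have mE n : measurable_fun D (EFin \o f_ n) by apply/measurable_EFinP.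
have cE x : D x -> (fun n => (EFin \o f_ n) x) @ \oo --> (EFin \o f) x.
  by move=> Dx; apply: cvg_EFin; [exact: nearW | exact: ff].
have gE x n : D x -> (`|(EFin \o f_ n) x| <= (EFin \o g) x)%E.
  by move=> Dx; rewrite lee_fin; exact: fg.
have mf' := emeasurable_fun_cvg _ _ mE cE.
have [I _ H] := dominated_convergence mD mE mf' (aeW mu cE) ig (aeW mu gE).
apply: fine_cvg; rewrite fineK; first exact: H.
exact: (integrable_fin_num mD I).
Qed.

Lemma continuous_borel_cV_measurable (R : realType) m (f : 'cV[R]_m -> R) :
  continuous f -> measurable_fun setT (f : borel_cV R m -> R).
Proof.
move=> cf; apply: (measurability (@RGenInftyO.G R)).
  exact: RGenInftyO.measurableE.
move=> _ [_ [a ->] <-]; rewrite setTI; apply: sub_sigma_algebra.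
by apply: open_comp; [move=> x _; exact: cf | exact: interval_open].
Qed.

Section random_vectors.
Variables (R : realType) (m : nat).
Local Notation V := 'cV[R]_m.
Variables (d : measure_display) (T : measurableType d).
Variable X : T -> V.
Hypothesis mX : forall i, measurable_fun setT (fun w => X w i 0).

(** An open set is the union of the rational cubes that it contains. These have countably many
    indices, and their preimages are finite intersections of conditions on single coordinates. *)
Lemma open_preimage_measurable (O : set V) : open O -> measurable (X @^-1` O).
Proof.
move=> oO.
pose B (q : 'cV[rat]_m * nat) : set V :=
  [set x | forall i, `|x i 0 - ratr (q.1 i 0)| < q.2.+1%:R^-1].
have -> : X @^-1` O = \bigcup_q (if `[< B q `<=` O >] then X @^-1` (B q) else set0).
  apply/seteqP; split => [w Ow|w [q _]]; last by case: asboolP => // h; apply: h.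
  move: oO; rewrite openE => /(_ _ Ow) /nbhs_ballP[r /= r0 Hr].
  pose n := Num.truncn (2 / r); have n0 : 0 < n.+1%:R^-1 :> R by rewrite invr_gt0.
  have nr : n.+1%:R^-1 + n.+1%:R^-1 < r :> R.
    have : 2 / r < n.+1%:R by apply: truncnS_gt.
    rewrite ltr_pdivrMr // mulrC -ltr_pdivrMr // => h.
    by rewrite (_ : _ + _ = 2 / n.+1%:R); last by field.
  have ex i : exists q : rat, `|X w i 0 - ratr q| < n.+1%:R^-1.
    have /rat_in_itvoo[q] : X w i 0 - n.+1%:R^-1 < X w i 0 + n.+1%:R^-1.
      by rewrite ltrD2l; apply: lt_trans n0; rewrite oppr_lt0.
    by rewrite in_itv /= => h; exists q; rewrite distrC ltr_distl.
  have /choice[q Hq] := ex.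
  exists (\col_i q i, n) => //; case: asboolP => [_ i|]; first by rewrite mxE; exact: Hq.
  case=> x Bx; apply: Hr; split=> // i j; rewrite ord1.
  have := Bx i; rewrite /= mxE => h; rewrite /ball /=.
  have -> : X w i 0 - x i 0 = (X w i 0 - ratr (q i)) - (x i 0 - ratr (q i)) by ring.
  apply: le_lt_trans (ler_normB _ _) _; apply: lt_trans nr.
  exact: ltrD.
apply: countable_bigcupT_measurable => // q; case: ifP => // _.
have -> : X @^-1` (B q) = \bigcap_(i in [set: 'I_m])
    ((fun w => X w i 0) @^-1` [set y | `|y - ratr (q.1 i 0)| < q.2.+1%:R^-1]).
  by apply/seteqP; split => w Bw i; [move=> _ | ]; exact: Bw.
apply: fin_bigcap_measurable => // i _.
rewrite -[X in measurable X]setTI; apply: (mX i) => //.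
have -> : [set y : R | `|y - ratr (q.1 i 0)| < q.2.+1%:R^-1] =
    ball (ratr (q.1 i 0) : R) q.2.+1%:R^-1.
  by apply/seteqP; split => y; rewrite /ball /= distrC.
exact: measurable_ball.
Qed.

Lemma measurable_random_vector : measurable_fun setT (X : T -> borel_cV R m).
Proof.
apply: (@measurability _ _ T (borel_cV R m) setT X (@open V)); first by [].
move=> _ [U oU <-].
by rewrite setTI; exact: open_preimage_measurable.
Qed.

Lemma measurable_continuous_comp (f : V -> R) : continuous f ->
  measurable_fun setT (f \o X).
Proof.
move=> cf.
exact: (measurableT_comp (continuous_borel_cV_measurable cf) measurable_random_vector).
Qed.

Variable P : probability T R.

Lemma integrable_bounded_comp (f : V -> R) : bounded_continuous f ->
  P.-integrable setT (EFin \o (f \o X)).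
Proof.
move=> [cf [M fM]].
apply: (@le_integrable _ _ _ P _ measurableT _ (EFin \o cst M)).
- by apply/measurable_EFinP; exact: measurable_continuous_comp.
- by move=> w _; rewrite /= lee_fin; apply: le_trans (fM _) (ler_norm _).
- exact: finite_measure_integrable_cst.
Qed.

Definition rv_expect (f : V -> R) : R := \int[P]_w f (X w).

Lemma rv_expectation_like : expectation_like rv_expect.
Proof.
split.
- by move=> f g bf bg; apply: RintegralD => //; exact: integrable_bounded_comp.
- by move=> a f bf; apply: RintegralZl => //; exact: integrable_bounded_comp.
- by move=> f g bf bg fg; apply: le_Rintegral => //; exact: integrable_bounded_comp.
- rewrite /rv_expect Rintegral_cst //. rewrite mul1r; exact: (congr1 fine (probability_setT P)).
Qed.

(** [g n] tends to 0 pointwise and is at most 1, so its mean falls below [eps]; it equals 1 outside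
    the box of radius [n + 1], hence dominates every admissible [h]. *)
Lemma rv_tight : tight (fun=> rv_expect).
Proof.
move=> eps e0.
pose S (x : V) := \sum_i `|x i 0|.
have S0 x : 0 <= S x by apply: sumr_ge0.
pose g (n : nat) x := Num.min 1 (n.+1%:R^-1 * S x).
have cS : continuous S.
  have -> : S = \sum_i (fun x : V => `|x i 0|).
    by apply/funext => x; rewrite fct_sumE.
  elim/big_ind: _ => [|f1 g1 cf cg x|i _ x]; first exact: cst_continuous.
    exact: (continuousD (cf x) (cg x)).
  apply: (@continuous_comp _ _ _ (fun x : V => x i 0) Num.norm).
    exact: coord_continuous.
  exact: norm_continuous.
have g01 n x : 0 <= g n x <= 1.
  by rewrite /g ge_min lexx le_min ler01 /= andbT mulr_ge0.
have bg n : bounded_continuous (g n).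
  split; last by exists 1 => x; rewrite ger0_norm; case/andP: (g01 n x).
  have cZ : continuous (fun x => n.+1%:R^-1 * S x).
    by move=> x; exact: (continuousM (@cst_continuous _ _ (n.+1%:R^-1 : R) x) (cS x)).
  by move=> x; exact: (continuous_min (@cst_continuous _ _ (1 : R) x) (cZ x)).
have : (fun n => \int[P]_w (g n (X w))) @ \oo --> \int[P]_(w in setT) (cst 0 w : R).
  apply: (@Rintegral_dominated _ _ _ P setT _ _ (cst 1)) => //.
  - by move=> n; apply: measurable_continuous_comp; case: (bg n).
  - move=> w _; apply/cvgr0Pnorm_le => e e0'.
    near=> n; have /andP[h0 h1] := g01 n (X w); rewrite ger0_norm //.
    rewrite ge_min; apply/orP; right; rewrite ler_pdivrMl //.
    near: n; exists (Num.truncn (S (X w) / e)) => // n /= hn.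
    rewrite -ler_pdivrMr //; apply: le_trans (ltW (truncnS_gt _)) _.
    by rewrite ler_nat.
  - exact: finite_measure_integrable_cst.
  - by move=> n w _; have /andP[h0 h1] := g01 n (X w); rewrite ger0_norm.
rewrite Rintegral_cst // mul0r => /cvgr0Pnorm_le /(_ _ e0) [n _ Hn].
exists n.+1%:R => // _ h bh h01 hL.
have [_ _ Ele _] := rv_expectation_like.
apply: (@le_trans _ _ (rv_expect (g n))); last first.
  by apply: le_trans (ler_norm _) _; apply: Hn => /=.
apply: Ele => // x; have [xL|xL] := pselect (box n.+1%:R x).
  by rewrite hL //; case/andP: (g01 n x).
have [i Hi] : exists i, ~ `|x i 0| <= n.+1%:R by apply/existsNP.
have : 1 <= n.+1%:R^-1 * S x.
  rewrite ler_pdivlMl // mulr1 /S (bigD1 i) //=.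
  move/negP: Hi; rewrite -ltNge => /ltW; move/le_trans; apply.
  by rewrite lerDl sumr_ge0.
by rewrite /g => /min_l ->; case/andP: (h01 x).
Unshelve. all: by end_near. Qed.

End random_vectors.

(** * A real law is determined by its characteristic function *)

Section characteristic_uniqueness.
Variable R : realType.

Let step a n (y : R) : R := Num.min 1 (Num.max 0 (n%:R * (a - y))).

Let step01 a n y : 0 <= step a n y <= 1.
Proof. by rewrite /step ge_min lexx le_min ler01 /= andbT le_max lexx. Qed.

Let step_continuous a n : continuous (step a n).
Proof.
have c1 : continuous (fun y : R => n%:R * (a - y)).
  move=> y; apply: (continuousM (@cst_continuous _ _ (n%:R : R) y)).
  exact: (cvgB (@cst_continuous _ _ a y) (@cvg_id _ (nbhs y))).
have c2 : continuous (fun y : R => Num.max 0 (n%:R * (a - y))).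
  by move=> y; exact: (continuous_max (@cst_continuous _ _ (0 : R) y) (c1 y)).
by move=> y; exact: (continuous_min (@cst_continuous _ _ (1 : R) y) (c2 y)).
Qed.

Let step_cvg a y : step a ^~ y @ \oo --> (\1_(`]-oo, a[%classic) y : R).
Proof.
rewrite indicE; have [ya|ay] := ltP y a.
  rewrite mem_set /=; last by rewrite in_itv.
  apply/cvgrPdist_le => e e0; near=> n.
  suff h : 1 <= n%:R * (a - y).
    by rewrite /step min_l ?subrr ?normr0 ?(ltW e0) // le_max h orbT.
  rewrite -ler_pdivrMr ?subr_gt0 // mul1r.
  near: n; exists (Num.truncn (a - y)^-1).+1 => // n /= hn.
  by apply: le_trans (ltW (truncnS_gt _)) _; rewrite ler_nat.
rewrite memNset /=; last by rewrite in_itv /= ltNge ay.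
apply: cvg_near_cst; near=> n; rewrite /step max_l ?min_r //.
by rewrite mulr_ge0_le0 // subr_le0.
Unshelve. all: by end_near. Qed.

Let step_limit d (T : measurableType d) (P : probability T R) (Y : T -> R) a :
  measurable_fun setT Y ->
  (fun n => \int[P]_w step a n (Y w)) @ \oo --> fine (P (Y @^-1` `]-oo, a[)).
Proof.
move=> mY.
have mA : measurable (Y @^-1` `]-oo, a[).
  by rewrite -[X in measurable X]setTI; exact: mY.
have -> : fine (P (Y @^-1` `]-oo, a[)) = \int[P]_w (\1_(`]-oo, a[%classic) (Y w)).
  rewrite /Rintegral -[LHS]/(fine (P (Y @^-1` `]-oo, a[))) -[Y @^-1` _ in LHS]setIT.
  by rewrite -integral_indic.
apply: (@Rintegral_dominated _ _ _ P setT _ _ (cst 1)) => //.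
- move=> n; apply: (measurableT_comp _ mY).
  exact: (continuous_measurable_fun (@step_continuous a n)).
- exact: finite_measure_integrable_cst.
- by move=> n w _; have /andP[h0 h1] := step01 a n (Y w); rewrite ger0_norm.
Qed.

(** [weak_convergence] for a constant sequence extends the equality from cosines to bounded
    continuous functions; the ramps [step a n] carry it to open half-lines, a generating class
    closed under intersection. *)
Lemma characteristic_unique d (T : measurableType d) (P : probability T R)
    (Y : T -> R) (Q : probability (measurableTypeR R) R) :
  measurable_fun setT Y ->
  (forall t al, \int[P]_w cos (t * Y w + al) = \int[Q]_y cos (t * y + al)) ->
  forall A : set (measurableTypeR R), measurable A -> P (Y @^-1` A) = Q A.
Proof.
move=> mY PQ.
pose X w : 'cV[R]_1 := const_mx (Y w).
pose Z (y : measurableTypeR R) : 'cV[R]_1 := const_mx y.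
have mX i : measurable_fun setT (fun w => X w i 0).
  by apply: eq_measurable_fun mY => w _; rewrite mxE.
have mZ i : measurable_fun setT (fun y => Z y i 0).
  by apply: eq_measurable_fun (@measurable_id _ _ _) => w _; rewrite mxE.
have E (t : 'cV[R]_1) al y : cos (lin t (const_mx y) + al) = cos (t 0 0 * y + al).
  by rewrite linE big_ord_recl big_ord0 addr0 mxE.
have cE (t : 'cV[R]_1) al : rv_expect X P (fun x => cos (lin t x + al)) =
    rv_expect Z Q (fun x => cos (lin t x + al)).
  rewrite /rv_expect; under eq_Rintegral do rewrite E.
  by under [RHS]eq_Rintegral do rewrite E.
have bdd (f : 'cV[R]_1 -> R) : bounded_continuous f -> rv_expect X P f = rv_expect Z Q f.
  move=> bf; apply: (cvg_unique _ (cvg_cst (rv_expect X P f) : _ @ \oo --> _)) => //.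
  apply: (@weak_convergence R 1 (fun=> rv_expect X P) (rv_expect Z Q)) => //.
  - by move=> _; exact: rv_expectation_like.
  - exact: rv_expectation_like.
  - exact: rv_tight.
  - exact: rv_tight.
  - by move=> t al; rewrite -cE; exact: cvg_cst.
have half a : P (Y @^-1` `]-oo, a[) = Q `]-oo, a[%classic.
  have fP : P (Y @^-1` `]-oo, a[) \is a fin_num.
    by apply: fin_num_measure; rewrite -[X in measurable X]setTI; exact: mY.
  have fQ : Q `]-oo, a[%classic \is a fin_num by exact: fin_num_measure.
  rewrite -(fineK fP) -(fineK fQ); congr EFin.
  have sE n : \int[P]_w step a n (Y w) = \int[Q]_y step a n y.
    have bf : bounded_continuous (fun x : 'cV[R]_1 => step a n (x 0 0)).
      split; last by exists 1 => x; rewrite ger0_norm; case/andP: (step01 a n (x 0 0)).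
      move=> x; apply: (@continuous_comp _ _ _ (fun x : 'cV[R]_1 => x 0 0) (step a n)).
        exact: coord_continuous.
      exact: step_continuous.
    have := bdd _ bf; rewrite /rv_expect.
    under eq_Rintegral do rewrite mxE.
    by move=> ->; apply: eq_Rintegral => y _; rewrite mxE.
  have h1 := @step_limit _ _ P Y a mY; have h2 := @step_limit _ _ Q id a (@measurable_id _ _ setT).
  have e : (fun n => \int[P]_w step a n (Y w)) = (fun n => \int[Q]_y step a n y).
    by apply/funext.
  by rewrite e in h1; apply: (cvg_unique _ h1 h2).
move=> A mA.
pose X' : {mfun T >-> measurableTypeR R} := 
  MeasurableFun.Pack (MeasurableFun.Class (isMeasurableFun.Build _ _ T (measurableTypeR R) Y mY)).
apply: (@measure_unique _ R (measurableTypeR R) (@RGenInftyO.G R) (fun n => `]-oo, n%:R[%classic)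
  (RGenInftyO.measurableE R) _ _ _ (distribution P X') Q) => //.
- move=> _ _ [x ->] [y ->]; exists (Num.min x y).
  by apply/seteqP; split => z; rewrite /= !in_itv /= lt_min => /andP.
- by move=> n; exists n%:R.
- apply/seteqP; split => // y _; exists (Num.truncn y).+1 => //=.
  by rewrite in_itv /= truncnS_gt.
- by move=> _ [a ->]; exact: half.
- by move=> n; rewrite -ge0_fin_numE //; exact: fin_num_measure.
Qed.

End characteristic_uniqueness.

(** * Gaussian laws *)

Section normal_characteristic.
Variables (R : realType) (s : R).
Hypothesis s0 : s != 0.
Local Notation mu := (@lebesgue_measure R).
Local Notation p := (normal_pdf 0 s).
Implicit Types (t al x : R).

Lemma Rintegral_normal_prob (f : R -> R) M : measurable_fun setT f ->
  (forall x, `|f x| <= M) ->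
  \int[normal_prob 0 s]_x f x = \int[mu]_x (f x * p x).
Proof.
move=> mf fM.
pose nu : {finite_measure set (measurableTypeR R) -> \bar R} := normal_prob 0 s.
have numu : nu `<< mu by exact: normal_prob_dominates.
have If : nu.-integrable setT (EFin \o f).
  apply: (@le_integrable _ _ _ nu _ measurableT _ (EFin \o cst M)).
  - exact/measurable_EFinP.
  - by move=> x _; rewrite /= lee_fin; apply: le_trans (fM _) (ler_norm _).
  - exact: finite_measure_integrable_cst.
have mp : measurable_fun setT (EFin \o p).
  by apply/measurable_EFinP; exact: measurable_normal_pdf.
rewrite /Rintegral; congr fine.
rewrite -(Radon_Nikodym_change_of_variables numu) //.
apply: ae_eq_integral => //.
- apply: emeasurable_funM; first exact/measurable_EFinP.
  by apply: measurable_int; exact: Radon_Nikodym_integrable.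
- by apply/measurable_EFinP/measurable_funM => //; exact/measurable_EFinP.
have : ae_eq mu setT (EFin \o p) (Radon_Nikodym (charge_of_finite_measure nu) mu).
  apply: integral_ae_eq => //; first exact: integrable_normal_pdf.
  by move=> E _ mE; rewrite -Radon_Nikodym_integral.
apply: filterS => x /= h hx; rewrite EFinM; congr (_ * _)%E.
by rewrite -(h hx).
Qed.

Lemma normal_pdf0E x : p x = normal_peak s * expR (- (x ^+ 2 / (s ^+ 2 *+ 2))).
Proof. by rewrite normal_pdfE // /normal_fun subr0 mulNr. Qed.

Lemma is_derive_normal_pdf x : is_derive x (1 : R) p (- (x / s ^+ 2) * p x).
Proof.
have -> : p = normal_peak s \*: (expR \o (fun x : R => - (x ^+ 2 / (s ^+ 2 *+ 2)))).
  by apply/funext => y; rewrite normal_pdf0E.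
have d1 : is_derive x (1 : R) (fun x : R => - (x ^+ 2 / (s ^+ 2 *+ 2))) (- (x / s ^+ 2)).
  have -> : (fun x : R => - (x ^+ 2 / (s ^+ 2 *+ 2))) =
      (fun x : R => - (s ^+ 2 *+ 2)^-1 *: (x ^+ 2)).
    by apply/funext => y; rewrite scaleNr [in RHS]/GRing.scale /= mulrC.
  apply: is_derive_eq; rewrite /GRing.scale /= mulr1 -mulr_natr.
  by field.
apply: is_derive_eq.
rewrite -[LHS]/(normal_peak s * (expR (- (x ^+ 2 / (s ^+ 2 *+ 2))) * - (x / s ^+ 2))).
rewrite -[X in _ = _ * X]/(normal_peak s * expR (- (x ^+ 2 / (s ^+ 2 *+ 2)))).
ring.
Qed.

(** Gives integrability of [x * p x] without computing a moment. With [y = x^2 / (8 s^2)] the two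
    densities carry [exp (- 4 y)] and [exp (- y)]; the spare [exp (- 3 y)] absorbs
    [1 + |x| <= 2 + 8 s^2 y]. *)
Lemma normal_pdf_domination x : (1 + `|x|) * p x <=
  2 * (1 + 4 * s ^+ 2) * normal_peak s / normal_peak (2 * s) * normal_pdf 0 (2 * s) x.
Proof.
have s20 : 2 * s != 0 by rewrite mulf_neq0.
have ss : 0 < s ^+ 2 by rewrite exprn_even_gt0.
rewrite normal_pdf0E normal_pdfE // /normal_fun subr0 mulNr.
rewrite [leRHS]mulrA divfK ?gt_eqF ?normal_peak_gt0 //.
set A := normal_peak s; have A0 : 0 < A by exact: normal_peak_gt0.
pose y := x ^+ 2 / (8 * s ^+ 2).
have -> : x ^+ 2 / ((2 * s) ^+ 2 *+ 2) = y.
  by rewrite /y exprMn -[(_ * _) *+ 2]mulr_natr; congr (_ / _); ring.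
have -> : x ^+ 2 / (s ^+ 2 *+ 2) = 3 * y + y.
  by rewrite /y -[(_ ^+ 2) *+ 2]mulr_natr; field.
rewrite opprD expRD.
have -> : (1 + `|x|) * (A * (expR (- (3 * y)) * expR (- y))) =
  ((1 + `|x|) * expR (- (3 * y))) * (A * expR (- y)) by ring.
have -> : 2 * (1 + 4 * s ^+ 2) * A * expR (- y) =
  (2 * (1 + 4 * s ^+ 2)) * (A * expR (- y)) by ring.
rewrite ler_pM2r ?mulr_gt0 ?expR_gt0 //.
rewrite expRN ler_pdivrMr ?expR_gt0 //.
have y0 : 0 <= y by rewrite divr_ge0 ?sqr_ge0 // mulr_ge0 // ltW.
have h1 : 1 + 3 * y <= expR (3 * y) by apply: expR_ge1Dx.
have h2 : 2 * (1 + 4 * s ^+ 2) * (1 + 3 * y) <= 2 * (1 + 4 * s ^+ 2) * expR (3 * y).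
  by rewrite ler_pM2l //; lra.
apply: le_trans h2.
have xy : x ^+ 2 = 8 * s ^+ 2 * y by rewrite /y; field.
have h3 : `|x| <= 1 + x ^+ 2.
  rewrite -[x ^+ 2]real_normK ?num_real //.
  by have := sqr_ge0 (`|x| - 1); have := normr_ge0 x; nra.
have h4 : 0 <= s ^+ 2 * y by rewrite mulr_ge0 // ltW.
by rewrite xy in h3; nra.
Qed.

Let G x := (1 + `|x|) * p x.

Let p0 x : 0 <= p x. Proof. exact: normal_pdf_ge0. Qed.

Let mp : measurable_fun setT p. Proof. exact: measurable_normal_pdf. Qed.

Let iG : mu.-integrable setT (EFin \o G).
Proof.
pose K := 2 * (1 + 4 * s ^+ 2) * normal_peak s / normal_peak (2 * s).
apply: (@le_integrable _ _ _ mu _ measurableT _ (EFin \o (fun x => K * normal_pdf 0 (2 * s) x))).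
- apply/measurable_EFinP/measurable_funM => //; exact: measurable_funD.
- move=> x _; rewrite /= lee_fin ger0_norm; last by rewrite mulr_ge0 // addr_ge0.
  by apply: le_trans (normal_pdf_domination x) (ler_norm _).
- have -> : EFin \o (fun x => K * normal_pdf 0 (2 * s) x) =
    (fun x => K%:E * (normal_pdf 0 (2 * s) x)%:E)%E by apply/funext => x; rewrite EFinM.
  by apply: integrableZl => //; exact: integrable_normal_pdf.
Qed.

Let iGbound (f : R -> R) M : measurable_fun setT f ->
  (forall x, `|f x| <= M * G x) -> mu.-integrable setT (EFin \o f).
Proof.
move=> mf fG.
apply: (@le_integrable _ _ _ mu _ measurableT _ (EFin \o (fun x => M * G x))).
- exact/measurable_EFinP.
- by move=> x _; rewrite /= lee_fin; apply: le_trans (fG x) (ler_norm _).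
- have -> : EFin \o (fun x => M * G x) = (fun x => M%:E * (G x)%:E)%E.
    by apply/funext => x; rewrite EFinM.
  exact: integrableZl.
Qed.

Let p_decay : exists C, forall x, (1 + `|x|) * p x <= C.
Proof.
have s20 : 2 * s != 0 by rewrite mulf_neq0.
exists (2 * (1 + 4 * s ^+ 2) * normal_peak s / normal_peak (2 * s) * normal_peak (2 * s)) => x.
apply: le_trans (normal_pdf_domination x) _; rewrite ler_wpM2l ?normal_pdf_ub //.
rewrite divr_ge0 ?normal_peak_ge0 // mulr_ge0 ?normal_peak_ge0 // mulr_ge0 //.
by rewrite addr_ge0 // mulr_ge0 // sqr_ge0.
Qed.

Let affine_continuous t al : continuous (fun x : R => t * x + al).
Proof.
by move=> x; apply: cvgD; [apply: cvgM; [exact: cvg_cst | exact: cvg_id] | exact: cvg_cst].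
Qed.

Let p_continuous : continuous p. Proof. exact: continuous_normal_pdf. Qed.

Let cos_continuous t al : continuous (fun x : R => cos (t * x + al)).
Proof.
move=> x; apply: (@continuous_comp _ _ _ (fun x : R => t * x + al) cos).
  exact: affine_continuous.
exact: continuous_cos.
Qed.

Let sin_continuous t al : continuous (fun x : R => sin (t * x + al)).
Proof.
move=> x; apply: (@continuous_comp _ _ _ (fun x : R => t * x + al) sin).
  exact: affine_continuous.
exact: continuous_sin.
Qed.

Let cosp t al x := cos (t * x + al) * p x.
Let xsinp t al x := x * sin (t * x + al) * p x.

Let cosp_continuous t al : continuous (cosp t al).
Proof. by move=> x; apply: cvgM; [exact: cos_continuous | exact: p_continuous]. Qed.

Let xsinp_continuous t al : continuous (xsinp t al).
Proof.
move=> x; apply: cvgM; last exact: p_continuous.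
by apply: cvgM; [exact: cvg_id | exact: sin_continuous].
Qed.

Let cosp_le t al x : `|cosp t al x| <= 1 * G x.
Proof.
rewrite mul1r normrM (ger0_norm (p0 x)) ler_wpM2r //.
by apply: le_trans (cos_max _) _; rewrite lerDl.
Qed.

Let xsinp_le t al x : `|xsinp t al x| <= 1 * G x.
Proof.
rewrite mul1r 2!normrM (ger0_norm (p0 x)) ler_wpM2r //.
rewrite -[leRHS]mulr1 ler_pM ?sin_max //; by rewrite lerDr.
Qed.

Let icosp t al : mu.-integrable setT (EFin \o cosp t al).
Proof.
apply: iGbound (cosp_le t al).
exact: (continuous_measurable_fun (@cosp_continuous t al)).
Qed.

Let ixsinp t al : mu.-integrable setT (EFin \o xsinp t al).
Proof.
apply: iGbound (xsinp_le t al).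
exact: (continuous_measurable_fun (@xsinp_continuous t al)).
Qed.

(** Gaussian integration by parts: as [p' = - x p / s^2], the vanishing integral of the derivative
    of [flux] links the integrals of [xsinp] and [cosp]. *)
Let flux t al x := sin (t * x + al) * p x.
Let dflux t al x := t * cosp t al x - (s ^+ 2)^-1 * xsinp t al x.

Let is_derive_flux t al x : is_derive x (1 : R) (flux t al) (dflux t al x).
Proof.
have d1 : is_derive x (1 : R) (fun x : R => t * x + al) t.
  by apply: is_derive_eq; rewrite /GRing.scale /= mulr1 addr0 ?mulr0 ?addr0.
have d2 : is_derive x (1 : R) (fun x : R => sin (t * x + al)) (t * cos (t * x + al)).
  apply: (@is_derive_eq _ _ _ _ _ _ _ _ (@is_derive1_comp _ sin (fun x => t * x + al) _ _ _ _ d1)).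
  by rewrite mulrC.
have d3 := is_derive_normal_pdf x.
apply: is_derive_eq.
by rewrite /GRing.scale /= /dflux /cosp /xsinp; ring.
Qed.

Let dflux_continuous t al : continuous (dflux t al).
Proof.
move=> x; apply: cvgB; apply: cvgM; try exact: cvg_cst.
  exact: cosp_continuous.
exact: xsinp_continuous.
Qed.

Let idflux t al : mu.-integrable setT (EFin \o dflux t al).
Proof.
apply: (@iGbound _ (`|t| + (s ^+ 2)^-1)).
  exact: (continuous_measurable_fun (@dflux_continuous t al)).
move=> x; have ss : 0 <= (s ^+ 2)^-1 by rewrite invr_ge0 sqr_ge0.
apply: le_trans (ler_normB _ _) _; rewrite mulrDl normrM [`|_ * xsinp _ _ _|]normrM (ger0_norm ss).
have := cosp_le t al x; have := xsinp_le t al x; rewrite !mul1r => h1 h2.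
by apply: lerD; apply: ler_wpM2l.
Qed.

Let integral_dflux t al : \int[mu]_x dflux t al x = 0.
Proof.
have FTC (n : nat) : \int[mu]_(x in `[- n.+1%:R, n.+1%:R]) dflux t al x =
    flux t al n.+1%:R - flux t al (- n.+1%:R).
  have nn : - n.+1%:R < n.+1%:R :> R by apply: lt_trans (_ : 0 < _); rewrite ?oppr_lt0.
  have cf x : {for x, continuous (flux t al)}.
    by apply/differentiable_continuous/derivable1_diffP; have [] := is_derive_flux t al x.
  rewrite /Rintegral (@continuous_FTC2 _ (dflux t al) (flux t al)) //.
  - by apply: continuous_subspaceT => x; exact: dflux_continuous.
  - split; first by move=> x _; have [] := is_derive_flux t al x.
    + by apply: cvg_at_right_filter; exact: cf.
    + by apply: cvg_at_left_filter; exact: cf.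
  - by move=> x _; rewrite derive1E; have [] := is_derive_flux t al x.
have lim0 : (fun n => flux t al n.+1%:R - flux t al (- n.+1%:R)) @ \oo --> (0 : R).
  have [C HC] := p_decay.
  have fb x : `|flux t al x| <= C / (1 + `|x|).
    rewrite ler_pdivlMr; last by apply: ltr_pwDl.
    rewrite normrM (ger0_norm (p0 x)) -mulrA [p x * _]mulrC.
    apply: le_trans (HC x); rewrite ler_piMl ?sin_max // mulr_ge0 //.
  apply/cvgr0Pnorm_le => e e0; near=> n.
  apply: le_trans (ler_normB _ _) _; apply: le_trans (lerD (fb _) (fb _)) _.
  rewrite normrN normr_nat -mulrDl ler_pdivrMr; last by apply: ltr_pwDl.
  rewrite mulrC -ler_pdivrMr //.
  near: n; exists (Num.truncn ((C + C) / e)) => // n /= hn.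
  apply: le_trans (ltW (truncnS_gt _)) _; rewrite -[1]/(1%:R) -natrD ler_nat.
  by apply: leq_trans (leqnSn _).
have H : (fun n : nat => \int[mu]_x (dflux t al \_ `[- n.+1%:R, n.+1%:R]) x) @ \oo -->
    \int[mu]_x dflux t al x.
  apply: (@Rintegral_dominated _ _ _ mu setT _ _ (fun x => `|dflux t al x|)) => //.
  - move=> n; apply/(measurable_restrictT _ _).1 => //.
    apply: measurable_funTS.
    exact: (continuous_measurable_fun (@dflux_continuous t al)).
  - move=> x _; apply: cvg_near_cst; near=> n; rewrite patchE mem_set //=.
    rewrite in_itv /= -ler_norml; near: n.
    exists (Num.truncn `|x|) => // n /= hn.
    by apply: le_trans (ltW (truncnS_gt _)) _; rewrite ler_nat.
  - exact: (integrable_abse (idflux t al)).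
  - by move=> n x _; rewrite patchE; case: ifP; rewrite ?normr0.
move: H; under eq_fun do rewrite -Rintegral_mkcond FTC.
by move=> H; apply: (cvg_unique _ H lim0).
Unshelve. all: by end_near. Qed.

Let phi al t := \int[mu]_x cosp t al x.

Let integral_xsinp t al : \int[mu]_x xsinp t al x = s ^+ 2 * (t * phi al t).
Proof.
have := integral_dflux t al; rewrite /dflux RintegralB //; last 2 first.
- have -> : EFin \o (fun x => t * cosp t al x) = (fun x => t%:E * (cosp t al x)%:E)%E.
    by apply/funext => x; rewrite EFinM.
  by apply: integrableZl => //; exact: icosp.
- have -> : EFin \o (fun x => (s ^+ 2)^-1 * xsinp t al x) =
      (fun x => ((s ^+ 2)^-1)%:E * (xsinp t al x)%:E)%E.
    by apply/funext => x; rewrite EFinM.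
  by apply: integrableZl => //; exact: ixsinp.
rewrite !RintegralZl //.
move/eqP; rewrite subr_eq0 => /eqP ->.
by rewrite mulrA divff ?mul1r // sqrf_eq0.
Qed.

(** Differentiation under the integral gives [- xsinp], which integration by parts turns back into
    [phi]: a linear equation of first order. *)
Let is_derive_phi al t : is_derive t (1 : R) (phi al) (- (s ^+ 2 * t) * phi al t).
Proof.
have dc (u x : R) : is_derive u (1 : R) (fun u => cosp u al x) (- xsinp u al x).
  have d1 : is_derive u (1 : R) (fun u : R => u * x + al) x.
    by apply: is_derive_eq; rewrite /GRing.scale /= mulr1 ?mulr0 ?addr0 ?add0r.
  have d2 : is_derive u (1 : R) (fun u : R => cos (u * x + al)) (x * - sin (u * x + al)).
    apply: (@is_derive_eq _ _ _ _ _ _ _ _ (@is_derive1_comp _ cos (fun u => u * x + al) _ _ _ _ d1)).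
    by rewrite mulrC.
  apply: is_derive_eq; rewrite /GRing.scale /= /xsinp; ring.
have It : `]t - 1, t + 1[%classic t by rewrite /= in_itv /=; apply/andP; split; lra.
have i1 u : `]t - 1, t + 1[%classic u -> mu.-integrable setT (EFin \o cosp u al).
  by move=> _; exact: icosp.
have i2 u x : `]t - 1, t + 1[%classic u -> setT x -> derivable ((fun u => cosp u al) ^~ x) u 1.
  by move=> _ _; have [] := dc u x.
have G0 x : 0 <= G x by rewrite mulr_ge0 // addr_ge0.
have i3 u x : `]t - 1, t + 1[%classic u -> setT x ->
    `|partial1of2 (fun u => cosp u al) u x| <= G x.
  move=> _ _; rewrite partial1of2E; have [_ ->] := dc u x.
  by rewrite normrN; have := xsinp_le u al x; rewrite mul1r.
split; first exact: (derivable_under_integral measurableT It i1 i2 G0 iG i3).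
rewrite -derive1E (differentiation_under_integral measurableT It i1 i2 G0 iG i3).
transitivity (\int[mu]_x (-1 * xsinp t al x)).
  by apply: eq_Rintegral => x _; rewrite partial1of2E mulN1r; have [_ ->] := dc t x.
rewrite RintegralZl //.
by rewrite integral_xsinp; ring.
Qed.

Lemma normal_characteristic t al :
  \int[normal_prob 0 s]_x cos (t * x + al) = expR (- (s ^+ 2 * t ^+ 2 / 2)) * cos al.
Proof.
rewrite (@Rintegral_normal_prob _ 1); last 2 first.
- exact: (continuous_measurable_fun (@cos_continuous t al)).
- by move=> x; exact: cos_max.
pose psi u := expR (s ^+ 2 * u ^+ 2 / 2) * phi al u.
have dpsi u : is_derive u (1 : R) psi 0.
  have d1 : is_derive u (1 : R) (fun u : R => s ^+ 2 * u ^+ 2 / 2) (s ^+ 2 * u).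
    have -> : (fun u : R => s ^+ 2 * u ^+ 2 / 2) = (fun u : R => (s ^+ 2 / 2) *: (u ^+ 2)).
      by apply/funext => v; rewrite [in RHS]/GRing.scale /= mulrAC.
    by apply: is_derive_eq; rewrite /GRing.scale /=; field.
  have d2 : is_derive u (1 : R) (fun u : R => expR (s ^+ 2 * u ^+ 2 / 2))
      ((s ^+ 2 * u) * expR (s ^+ 2 * u ^+ 2 / 2)).
    apply: (@is_derive_eq _ _ _ _ _ _ _ _ (@is_derive1_comp _ expR (fun u => s ^+ 2 * u ^+ 2 / 2) _ _ _ _ d1)).
    by rewrite mulrC.
  have d3 := is_derive_phi al u.
  by apply: is_derive_eq; rewrite /GRing.scale /=; ring.
have := is_derive_0_is_cst t 0 dpsi.
rewrite /psi expr0n /= mulr0 mul0r expR0 mul1r.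
have -> : phi al 0 = cos al.
  rewrite /phi /cosp.
  transitivity (\int[mu]_x (cos al * p x)).
    by apply: eq_Rintegral => x _; rewrite mul0r add0r.
  rewrite RintegralZl //; last exact: integrable_normal_pdf.
  by rewrite /Rintegral integral_normal_pdf mulr1.
by move=> <-; rewrite expRN mulrA mulVf ?mul1r // gt_eqF // expR_gt0.
Qed.

End normal_characteristic.

(** * Quadratic forms and Schur complements *)

Definition quad_form (R : realType) m (S : 'M[R]_m) (t : 'cV[R]_m) : R :=
  (t^T *m S *m t) 0 0.

Section quadratic_forms.
Variables (R : realType) (m : nat).
Implicit Types (t v c : 'cV[R]_m) (S D : 'M[R]_m).

Lemma quad_formB S D t : quad_form (S - D) t = quad_form S t - quad_form D t.
Proof. by rewrite /quad_form mulmxBr mulmxBl !mxE. Qed.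

Lemma quad_formZ a S t : quad_form (a *: S) t = a * quad_form S t.
Proof. by rewrite /quad_form -scalemxAr -scalemxAl mxE. Qed.

Lemma quad_form_scale a S t : quad_form S (a *: t) = quad_form S t * a ^+ 2.
Proof.
by rewrite /quad_form [(a *: t)^T]linearZ -scalemxAr -!scalemxAl !mxE; ring.
Qed.

Lemma quad_form_dyad c t : quad_form (c *m c^T) t = lin t c ^+ 2.
Proof.
rewrite /quad_form mulmxA -mulmxA mxE big_ord_recl big_ord0 addr0 expr2.
congr (_ * _); rewrite -[c^T *m t]trmxK mxE trmx_mul trmxK.
by [].
Qed.

Lemma linC t v : lin t v = lin v t.
Proof. by rewrite !linE; apply: eq_bigr => i _; rewrite mulrC. Qed.

Lemma lin_block u v y (x : 'cV[R]_m) :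
  lin (col_mx u%:M v) (col_mx y%:M x) = u * y + lin v x.
Proof.
rewrite /lin tr_col_mx mul_row_col mxE; congr (_ + _).
by rewrite tr_scalar_mx -scalar_mxM mxE eqxx.
Qed.

Lemma quad_form_block a c D u v :
  quad_form (block_mx a%:M c^T c D) (col_mx u%:M v) =
  a * u ^+ 2 + 2 * u * lin v c + quad_form D v.
Proof.
rewrite /quad_form tr_col_mx mul_row_block mul_row_col !mulmxDl !tr_scalar_mx.
rewrite -!scalar_mxM !mul_scalar_mx !mul_mx_scalar !mxE eqxx mulr1n.
have -> : \sum_j v^T 0 j * c j 0 = lin v c.
  by rewrite linE; apply: eq_bigr => j _; rewrite mxE.
have -> : \sum_j (u *: c^T) 0 j * v j 0 = u * lin v c.
  by rewrite linC linE mulr_sumr; apply: eq_bigr => j _; rewrite !mxE mulrA.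
by ring.
Qed.

End quadratic_forms.

Section schur_complement.
Variables (R : realType) (m : nat) (S : 'M[R]_(1 + m)).
Hypotheses (S_sym : S^T = S) (S_ge0 : forall t, 0 <= quad_form S t).

Let a := S (lshift m 0) (lshift m 0).
Let c : 'cV[R]_m := dlsubmx S.
Let D : 'M[R]_m := drsubmx S.

(* If the pivot a is 0 then so is c, and 0^-1 = 0 makes the formulas below
   valid in this case as well. *)
Definition schur_vector : 'cV[R]_m := a^-1 *: c.
Definition schur_complement : 'M[R]_m := D - a^-1 *: (c *m c^T).

Let S_block : S = block_mx a%:M c^T c D.
Proof.
rewrite -[LHS]submxK; congr block_mx.
  by rewrite [LHS]mx11_scalar; congr (_%:M); rewrite !mxE.
by rewrite -[in LHS]S_sym -trmx_dlsub.
Qed.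

Let D_ge0 u v : 0 <= a * u ^+ 2 + 2 * u * lin v c + quad_form D v.
Proof. by have := S_ge0 (col_mx u%:M v); rewrite S_block quad_form_block. Qed.

Lemma schur_pivot_ge0 : 0 <= a.
Proof. by have := D_ge0 1 0; rewrite lin0 /quad_form mulmx0 mxE; lra. Qed.

Let cE : c = a *: schur_vector.
Proof.
rewrite /schur_vector scalerA; have [a0|a0] := eqVneq a 0; last by rewrite mulfV ?scale1r.
rewrite a0 mul0r scale0r; apply/colP => i; rewrite [RHS]mxE.
set q := quad_form D (delta_mx i 0).
have h u : 0 <= 2 * u * c i 0 + q by have := D_ge0 u (delta_mx i 0); rewrite a0 lin_delta mul0r add0r.
apply/eqP; apply: contraT => ci0.
(* With zero pivot the form is affine in [u]; this [u] would give it the value -1. *)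
have := h (- (q + 1) / (2 * c i 0)).
have -> : 2 * (- (q + 1) / (2 * c i 0)) * c i 0 = - (q + 1) by field.
by lra.
Qed.

(** Completion of the square in the first variable. *)
Lemma schur_quad_form u v : quad_form S (col_mx u%:M v) =
  a * (u + lin v schur_vector) ^+ 2 + quad_form schur_complement v.
Proof.
rewrite {1}S_block quad_form_block /schur_complement quad_formB quad_formZ quad_form_dyad.
rewrite cE lin_scaler.
have [->|a0] := eqVneq a 0; first by rewrite invr0; ring.
by field.
Qed.

Lemma schur_complement_sym : schur_complement^T = schur_complement.
Proof.
rewrite /schur_complement linearB linearZ /= trmx_mul trmxK; congr (_ - _).
by rewrite /D -[in RHS]S_sym trmx_drsub.
Qed.

Lemma schur_complement_ge0 v : 0 <= quad_form schur_complement v.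
Proof.
have := S_ge0 (col_mx (- lin v schur_vector)%:M v).
by rewrite schur_quad_form addNr expr0n /= mulr0 add0r.
Qed.

End schur_complement.

Section gaussian_vectors.
Variable R : realType.
Local Notation gauss := (normal_prob (0 : R) 1).

Lemma gaussian_average u al :
  \int[gauss]_x cos (u * x + al) = expR (- (u ^+ 2 / 2)) * cos al.
Proof. by rewrite normal_characteristic ?oner_eq0 // expr1n mul1r. Qed.

Lemma integrable_cos d (T : measurableType d) (P : probability T R) (Y : T -> R) :
  measurable_fun setT Y -> P.-integrable setT (EFin \o (fun w => cos (Y w))).
Proof.
move=> mY; apply: (@le_integrable _ _ _ P _ measurableT _ (EFin \o cst 1)).
- apply/measurable_EFinP.
  exact: (measurableT_comp (continuous_measurable_fun (@continuous_cos R)) mY).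
- by move=> z _; rewrite /= lee_fin normr1; exact: cos_max.
- exact: finite_measure_integrable_cst.
Qed.

Lemma gaussian_fubini d (T : measurableType d) (P : probability T R)
    (Y : T -> R) u al : measurable_fun setT Y ->
  \int[(P \x gauss)%E]_z cos (u * z.2 + Y z.1 + al) =
  expR (- (u ^+ 2 / 2)) * \int[P]_w cos (Y w + al).
Proof.
move=> mY.
have mf : measurable_fun [set: T * measurableTypeR R] (fun z => u * z.2 + Y z.1 + al).
  apply: measurable_funD => //; apply: measurable_funD.
    by apply: measurable_funM => //; exact: measurable_snd.
  by apply: measurableT_comp => //; exact: measurable_fst.
have If := integrable_cos ((P \x gauss)%E : probability _ R) mf.
rewrite /Rintegral -(integral12_prod_meas1 If) /fubini_F.
have -> : (fun w => \int[gauss]_y ((EFin \o (fun z : T * R => cos (u * z.2 + Y z.1 + al))) (w, y)))%E =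
    (fun w => (expR (- (u ^+ 2 / 2)))%:E * (cos (Y w + al))%:E)%E.
  apply/funext => w /=; rewrite -EFinM -gaussian_average /Rintegral fineK.
    by apply: eq_integral => y _; rewrite addrA.
  apply: (@integrable_fin_num _ _ _ gauss setT) => //.
  apply: integrable_cos.
  by apply: measurable_funD => //; apply: measurable_funM.
have IY : P.-integrable setT (EFin \o (fun w => cos (Y w + al))).
  by apply: integrable_cos; exact: measurable_funD.
rewrite integralZl // fineM //.
exact: (@integrable_fin_num _ _ _ P setT).
Qed.

(** A new independent standard Gaussian, scaled by the root of the pivot [a], becomes the first
    coordinate; its multiple along [schur_vector] is added to a vector whose covariance is the Schur
    complement. Degenerate [S] is covered: [a = 0] makes the new part vanish. *)
Theorem gaussian_vector m (S : 'M[R]_m) : S^T = S ->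
  (forall t, 0 <= quad_form S t) ->
  exists d (T : measurableType d) (P : probability T R) (X : T -> 'cV[R]_m),
    (forall i, measurable_fun setT (fun w => X w i 0)) /\
    forall t al, \int[P]_w cos (lin t (X w) + al) = expR (- (quad_form S t / 2)) * cos al.
Proof.
elim: m S => [|m IH] S S_sym S_ge0.
  exists _, (measurableTypeR R), gauss, (fun=> 0); split=> [[]//|t al].
  have E x : lin t x = 0 by rewrite linE big_ord0.
  have -> : quad_form S t = 0 by rewrite /quad_form mxE big_ord0.
  transitivity (\int[gauss]_x cos (0 * x + al)).
    by apply: eq_Rintegral => x _; rewrite E mul0r.
  by rewrite gaussian_average expr0n.
move: S S_sym S_ge0; change m.+1 with (1 + m)%N => S S_sym S_ge0.
have [d [T [P [Y [mY HY]]]]] :=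
  IH _ (schur_complement_sym S_sym) (schur_complement_ge0 S_sym S_ge0).
pose a := S (lshift m 0) (lshift m 0); pose b := schur_vector S.
have a0 : 0 <= a by apply: schur_pivot_ge0.
pose X (z : T * measurableTypeR R) : 'cV[R]_(1 + m) :=
  col_mx (Num.sqrt a * z.2)%:M (Y z.1 + (Num.sqrt a * z.2) *: b).
exists _, (T * measurableTypeR R)%type, (P \x gauss)%E, X; split.
  move=> i; case: (split_ordP i) => j ->.
    rewrite [j]ord1; under eq_fun do rewrite col_mxEu mxE eqxx mulr1n.
    by apply: measurable_funM => //; exact: measurable_snd.
  under eq_fun do rewrite col_mxEd !mxE.
  apply: measurable_funD; first by apply: (measurableT_comp (mY j)); exact: measurable_fst.
  apply: measurable_funM => //.
  by apply: measurable_funM => //; exact: measurable_snd.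
move=> t al; rewrite -[t]vsubmxK; set v := dsubmx t.
rewrite [usubmx t]mx11_scalar; set u := usubmx t 0 0.
have E z : lin (col_mx u%:M v) (X z) + al =
    (Num.sqrt a * (u + lin v b)) * z.2 + lin v (Y z.1) + al.
  by rewrite lin_block linD lin_scaler; ring.
under eq_Rintegral do rewrite E.
have mvY : measurable_fun setT (fun w => lin v (Y w)).
  have -> : (fun w => lin v (Y w)) = (fun w => \sum_i v i 0 * Y w i 0).
    by apply/funext => w; rewrite linE.
  by apply: measurable_sum => i; exact: measurable_funM.
apply: etrans (gaussian_fubini P (Num.sqrt a * (u + lin v b)) al mvY) _.
rewrite HY mulrA -expRD schur_quad_form // exprMn sqr_sqrtr //.
by congr (expR _ * _); rewrite -/a -/b; field.
Qed.

End gaussian_vectors.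

(** * The limit theorems *)

Lemma Sigma_mx_sym (R : realType) k : (Sigma_mx R k)^T = Sigma_mx R k.
Proof.
apply/matrixP => i j; rewrite !mxE /sigma; congr (_ * _).
apply: eq_Rintegral => y _; congr (_ * _).
have [->|ij] := eqVneq (i : nat) j; first by [].
rewrite /H_ eqSS eq_sym eqSS (negbTE ij) !mulr0 !add0r mulrAC.
by rewrite [theta R k j.+1 * _]mulrC.
Qed.

(** The characteristic function is recorded beside the definition because the convergence proof uses
    it; the laws of the linear forms follow from it by [characteristic_unique]. *)
Lemma mvnormal_exists (R : realType) m (S : 'M[R]_m) : S^T = S ->
  (forall t, 0 <= quad_form S t) ->
  exists mu : probability (borel_cV R m) R, is_centered_mvnormal mu S /\
    forall t al, \int[mu]_x cos (lin t x + al) = expR (- (quad_form S t / 2)) * cos al.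
Proof.
move=> S_sym S_ge0; have [d [T [P [X [mX HX]]]]] := gaussian_vector S_sym S_ge0.
have mX' := measurable_random_vector mX.
pose X' : {mfun T >-> borel_cV R m} :=
  MeasurableFun.Pack (MeasurableFun.Class (isMeasurableFun.Build _ _ T (borel_cV R m) X mX')).
pose mu : probability (borel_cV R m) R := distribution P X'.
have mlin a : measurable_fun setT (lin a \o X).
  by apply: measurable_continuous_comp => //; exact: lin_continuous.
have E t a al : \int[P]_w cos (t * lin a (X w) + al) =
    expR (- (quad_form S a * t ^+ 2 / 2)) * cos al.
  under eq_Rintegral do rewrite -lin_scalel.
  rewrite HX; congr (expR (- (_ / 2)) * _).
  exact: quad_form_scale.
exists mu; split; last first.
  move=> t al; rewrite -HX /Rintegral; congr fine.
  have [cc _] := bounded_continuous_cos t al.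
  have mc : measurable_fun setT (EFin \o ((fun x => cos (lin t x + al)) : borel_cV R m -> R)).
    by apply/measurable_EFinP; exact: continuous_borel_cV_measurable.
  have ic := integrable_bounded_comp mX P (bounded_continuous_cos t al).
  exact: (integral_distribution (P := P) (X := X') mc ic).
split=> // a; split; first exact: S_ge0.
move=> A mA; rewrite -/(quad_form S a).
rewrite -[LHS]/(P ((lin a \o X) @^-1` A)).
case: eqVneq => [v0|v0].
  pose Q : probability (measurableTypeR R) R := \d_(0 : measurableTypeR R).
  suff H t al : \int[P]_w cos (t * lin a (X w) + al) = \int[Q]_y cos (t * y + al).
    exact: (characteristic_unique (mlin a) H mA).
  rewrite E v0 !mul0r oppr0 expR0 mul1r.
  have mc : measurable_fun setT (EFin \o (fun y : measurableTypeR R => cos (t * y + al))).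
    apply/measurable_EFinP/(measurableT_comp (continuous_measurable_fun (@continuous_cos R))).
    by apply: measurable_funD => //; apply: measurable_funM.
  rewrite /Rintegral (integral_dirac _ measurableT mc) diracT mul1e /=.
  by rewrite mulr0 add0r.
have s0 : Num.sqrt (quad_form S a) != 0 by rewrite sqrtr_eq0 -ltNge lt_def v0 S_ge0.
pose Q : probability (measurableTypeR R) R := normal_prob 0 (Num.sqrt (quad_form S a)).
suff H t al : \int[P]_w cos (t * lin a (X w) + al) = \int[Q]_y cos (t * y + al).
  exact: (characteristic_unique (mlin a) H mA).
by rewrite E normal_characteristic // sqr_sqrtr.
Qed.

Section spacings_limits.
Variables (R : realType) (k : nat).
Hypothesis k_gt0 : (0 < k)%N.
Local Notation V := 'cV[R]_k.-1.
Local Notation lw := (@law R V k (gap_value R k)).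

Lemma mean_spacingsE n i : mean_spacings R k n i 0 = @mean_entry R k i n.
Proof.
rewrite /mean_entry /law_mean -final_law // /mean_spacings /final_expect summxE.
by apply: eq_bigr => c _; rewrite /entry !mxE.
Qed.

Lemma normalized_expectE n (f : V -> R) :
  final_expect k (fun c : {set 'I_n} => f (normalized_spacings R k c) : R^o) =
  lw n (fun x => f ((Num.sqrt n%:R)^-1 *: (x - mean_spacings R k n))).
Proof. by rewrite -final_law. Qed.

Let E n (f : V -> R) := lw n (fun x => f ((Num.sqrt n%:R)^-1 *: (x - mean_spacings R k n))).

Let E_expectation_like n : expectation_like (E n).
Proof.
split.
- by move=> f g _ _; rewrite /E lawD.
- by move=> a f _; rewrite /E lawZ.
- by move=> f g _ _ fg; apply: ler_law.
- by rewrite /E law_cst.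
Qed.

Let E_tight : tight E.
Proof.
move=> eps e0; have /choice[C HC] := @entry_second_moment R k k_gt0.
have C0 i : 0 <= C i.
  by apply: le_trans (HC i 0%N); apply: law_ge0 => // x; exact: sqr_ge0.
pose S := \sum_i C i; have S0 : 0 <= S by apply: sumr_ge0.
(* Outside the box some [|z_i| >= L >= 1], hence [z_i ^ 2 / L >= 1]; the mean of the sum of these
   squares over [L] is at most [S / L <= eps]. *)
pose L := 1 + S / eps; have L1 : 1 <= L by rewrite lerDl divr_ge0 // ltW.
have L0 : 0 < L by apply: lt_le_trans L1.
exists L => // n h _ h01 hL.
apply: (@le_trans _ _ (E n (fun x => \sum_i L^-1 * (x i 0) ^+ 2))).
  apply: ler_law => // x; set z := _ *: _.
  have sq0 (i : 'I_k.-1) : 0 <= L^-1 * (z i 0) ^+ 2.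
    by apply: mulr_ge0; [rewrite invr_ge0 ltW | exact: sqr_ge0].
  have [zL|zL] := pselect (box L z); first by rewrite hL // sumr_ge0.
  have [i Hi] : exists i, ~ `|z i 0| <= L by apply/existsNP.
  have /andP[_ h1] := h01 z; apply: le_trans h1 _.
  rewrite (bigD1 i) //=.
  have : 1 <= L^-1 * z i 0 ^+ 2.
    rewrite ler_pdivlMl // mulr1 -[z i 0 ^+ 2]real_normK ?num_real //.
    move/negP: Hi; rewrite -ltNge => /ltW Hi.
    by apply: (le_trans Hi); rewrite expr2 ler_peMl // (le_trans L1 Hi).
  by move/le_trans; apply; rewrite lerDl sumr_ge0.
rewrite /E law_lin // -mulr_sumr.
apply: (@le_trans _ _ (L^-1 * S)).
  rewrite ler_pM2l ?invr_gt0 //; apply: ler_sum => i _; apply: le_trans (HC i n).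
  apply: ler_law => // x; rewrite !mxE mean_spacingsE.
  exact: lexx.
rewrite ler_pdivrMl // mulrDl mul1r divfK ?gt_eqF //; lra.
Qed.

Let E_cos t al :
  (fun n => E n (fun x => cos (lin t x + al))) @ \oo -->
  expR (- (quad_form (Sigma_mx R k) t / 2)) * cos al.
Proof.
have -> : (fun n => E n (fun x => cos (lin t x + al))) = (fun n => lw n (fun x =>
    cos ((Num.sqrt n%:R)^-1 * (lin t x - law_mean k (gap_value R k) (lin t) n) + al))).
  apply/funext => n; congr law; apply/funext => x; congr (cos (_ + _)).
  rewrite lin_scaler; congr (_ * _).
  rewrite law_mean_lin // !linE -sumrB; apply: eq_bigr => i _.
  by rewrite !mxE mean_spacingsE mulrBr.
exact: lin_cos_cvg.
Qed.

(** [mu] is viewed as the law of the identity map of [borel_cV], so that the results on random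
    vectors apply to it. *)
Lemma spacings_clt (mu : probability (borel_cV R k.-1) R) :
  (forall t al, \int[mu]_x cos (lin t x + al) =
     expR (- (quad_form (Sigma_mx R k) t / 2)) * cos al) ->
  normalized_spacings_cvg_in_distribution mu.
Proof.
move=> Hmu f cf bf.
under eq_fun do rewrite normalized_expectE.
have mid (i : 'I_k.-1) : measurable_fun setT (fun x : borel_cV R k.-1 => (x : V) i 0).
  by apply: continuous_borel_cV_measurable; exact: coord_continuous.
apply: (@weak_convergence R k.-1 E (@rv_expect R k.-1 _ (borel_cV R k.-1) id mu)) => //.
- exact: rv_expectation_like.
- exact: rv_tight.
- by move=> t al; rewrite /rv_expect Hmu; exact: E_cos.
- split=> //; have [M [_ HM]] := bf.
  by exists (M + 1) => x; apply: HM => //; rewrite ltrDl.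
Qed.

(** The difference stays bounded: it is [defect] plus the constant [theta * k] that separates
    [n + k] from [n]. *)
Lemma mean_spacings_limit :
  (fun n : nat => (Num.sqrt n%:R)^-1 *: (mean_spacings R k n - n%:R *: theta_vec R k))
    @ \oo --> (0 : V).
Proof.
have [C HC] : exists C, forall n i,
    `|(mean_spacings R k n - n%:R *: theta_vec R k) i 0| <= C.
  have ex i : exists C, forall n, `|@defect R k i n| <= C.
    have : geo_bounded 1 (@defect R k i).
      by apply: geo_boundedW (@defect_geo R k k_gt0 i); apply/andP; split; lra.
    by case=> C HC; exists C => n; have := HC n; rewrite expr1n mulr1.
  have /choice[C HC] := ex.
  have C0 i : 0 <= C i by apply: le_trans (normr_ge0 _) (HC i 0%N).
  exists (\sum_i (C i + `|theta R k i.+1 * k%:R|)) => n i.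
  rewrite !mxE mean_spacingsE (bigD1 i) //=.
  have -> : @mean_entry R k i n - n%:R * theta R k i.+1 =
      @defect R k i n + theta R k i.+1 * k%:R by rewrite /defect natrD; ring.
  apply: le_trans (ler_normD _ _) _; rewrite -[leLHS]addr0; apply: lerD.
    by apply: lerD.
  by apply: sumr_ge0 => j _; apply: addr_ge0.
apply/cvgr0Pnorm_le => eps e0.
have H : (fun n => (Num.sqrt n%:R)^-1 * C : R) @ \oo --> (0 : R).
  by rewrite -(mul0r C); apply: cvgM; [exact: cvg_sqrtV | exact: cvg_cst].
move/cvgr0Pnorm_le : H => /(_ _ e0).
apply: filterS => n hn; apply: le_trans hn.
rewrite normrZ normrM ler_wpM2l // [leLHS]/Num.norm /= mx_normrE.
apply/bigmax_leP; split=> [|[i j] _] //=; rewrite ord1.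
exact: le_trans (HC n i) (ler_norm _).
Qed.

End spacings_limits.

Theorem theorem1p1 (R : realType) (k : nat) (hk : (2 <= k)%N) :
  (exists mu : probability (borel_cV R k.-1) R,
     is_centered_mvnormal mu (Sigma_mx R k) /\
     normalized_spacings_cvg_in_distribution mu) /\
  (fun n : nat =>
     (Num.sqrt n%:R)^-1 *: (mean_spacings R k n - n%:R *: theta_vec R k))
    @ \oo --> (0 : 'cV[R]_k.-1).
Proof.
have k_gt0 : (0 < k)%N by apply: leq_trans hk.
split; last exact: mean_spacings_limit.
have [mu [normal_mu cos_mu]] := mvnormal_exists (Sigma_mx_sym R k) (@Sigma_form_ge0 R k k_gt0).
by exists mu; split=> //; exact: spacings_clt.
Qed.
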